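(* Let $\mathbb F$ be a field of characteristic $3$ and let $\mathcal V$ be an object in $\mathsf{Rep}\,\mathsf C_3$. (i) The associative superalgebras $\operatorname{End}_{\mathbb F}(\mathcal V^{ss})$ and $\bigl(\operatorname{End}_{\mathbb F}(\mathcal V)\bigr)^{ss}$ are isomorphic. (ii) Let $\mathbf b:\mathcal V\otimes\mathcal V\to\mathbb F$ be a morphism in $\mathsf{Rep}\,\mathsf C_3$ such that the bilinear form $\mathbf b(x,y):=\mathbf b(x\otimes y)$ is symmetric and nondegenerate. Then the bilinear form corresponding to the morphism $\mathbf b^{ss}:\mathcal V^{ss}\otimes\mathcal V^{ss}\to\mathbb F$ in $\mathsf{sVec}$ is supersymmetric and nondegenerate, and the orthosymplectic Lie superalgebra $\mathfrak{osp}(\mathcal V^{ss},\mathbf b^{ss})$ is isomorphic to the semisimplification $\mathfrak{so}(\mathcal V,\mathbf b)^{ss}$.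
   Context: All vector spaces are finite-dimensional over $\mathbb F$; tensor products are over $\mathbb F$. $\mathsf C_3$ is the cyclic group of order $3$ with a fixed generator $\sigma$; $\mathsf{Rep}\,\mathsf C_3$ is the symmetric tensor category of its finite-dimensional representations over $\mathbb F$ (usual tensor product and swap). $\sigma$ acts on $\operatorname{End}_{\mathbb F}(\mathcal V)$ and on the Lie algebra $\mathfrak{so}(\mathcal V,\mathbf b)$ of $\mathbf b$-skew-symmetric endomorphisms by conjugation, which makes them algebras in $\mathsf{Rep}\,\mathsf C_3$ (under composition and commutator respectively). $\mathfrak{osp}(\mathcal V^{ss},\mathbf b^{ss})$ is the Lie superalgebra spanned by the homogeneous $d\in\operatorname{End}_{\mathbb F}(\mathcal V^{ss})$ with $\mathbf b^{ss}(d(x),y)+(-1)^{|d||x|}\mathbf b^{ss}(x,d(y))=0$ for homogeneous $x,y$. A morphism $f:X\to Y$ in $\mathsf{Rep}\,\mathsf C_3$ is negligible if $\operatorname{tr}(fg)=0$ for all morphisms $g:Y\to X$. $\mathsf{Ver}_3$ has the same objects and tensor product as $\mathsf{Rep}\,\mathsf C_3$, with morphisms the classes $[f]$ of morphisms of $\mathsf{Rep}\,\mathsf C_3$ modulo negligible ones, and braiding the class of the swap. Let $V_1=\mathbb Fv_0\oplus\mathbb Fv_1$ with $\sigma(v_0)=v_0+v_1$, $\sigma(v_1)=v_1$, and $\lambda:V_1\otimes V_1\to\mathbb F$, $v_0\otimes v_1\mapsto1$, $v_1\otimes v_0\mapsto-1$, $v_i\otimes v_i\mapsto0$. $\mathsf{sVec}$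 is the category of vector superspaces with even linear maps and braiding $x\otimes y\mapsto(-1)^{|x||y|}y\otimes x$. There is a braided monoidal equivalence $F:\mathsf{sVec}\to\mathsf{Ver}_3$, $F(X)=X_{\bar0}\oplus(X_{\bar1}\otimes V_1)$ ($\sigma$ acting only on $V_1$), $F(f)=[f_{\bar0}\oplus(f_{\bar1}\otimes\mathrm{id}_{V_1})]$, with monoidal structure $J_{X,Y}:F(X)\otimes F(Y)\to F(X\otimes Y)$ the class of $x_{\bar0}\otimes y_{\bar0}\mapsto x_{\bar0}\otimes y_{\bar0}$, $x_{\bar0}\otimes(y_{\bar1}\otimes v)\mapsto(x_{\bar0}\otimes y_{\bar1})\otimes v$, $(x_{\bar1}\otimes v)\otimes y_{\bar0}\mapsto(x_{\bar1}\otimes y_{\bar0})\otimes v$, $(x_{\bar1}\otimes u)\otimes(y_{\bar1}\otimes v)\mapsto\lambda(u\otimes v)x_{\bar1}\otimes y_{\bar1}$. For an object $\mathcal V$ of $\mathsf{Rep}\,\mathsf C_3$, $\mathcal V^{ss}$ denotes a vector superspace with $F(\mathcal V^{ss})\simeq\mathcal V$ in $\mathsf{Ver}_3$ (a semisimplification of $\mathcal V$, unique up to isomorphism). For an algebra $(\mathcal A,\mu)$ in $\mathsf{Rep}\,\mathsf C_3$, $(\mathcal A^{ss},\mu^{ss})$ denotes a superalgebra such that $(F(\mathcal A^{ss}),F(\mu^{ss})\circ J_{\mathcal A^{ss},\mathcal A^{ss}})$ is isomorphic to $(\mathcal A,[\mu])$ in $\mathsf{Ver}_3$. For a morphism $\mathbf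 b:\mathcal V\otimes\mathcal V\to\mathbb F$, $(\mathcal V^{ss},\mathbf b^{ss})$ is such that some isomorphism $F(\mathcal V^{ss})\simeq\mathcal V$ in $\mathsf{Ver}_3$ identifies $F(\mathbf b^{ss})\circ J_{\mathcal V^{ss},\mathcal V^{ss}}$ with $[\mathbf b]$. *)

(* Defs.v *)
From HB Require Import structures.
From mathcomp Require Import all_boot all_order all_algebra.
From mathcomp Require Import ring.

Set Implicit Arguments.
Unset Strict Implicit.
Unset Printing Implicit Defensive.

Import GRing.Theory.
Local Open Scope ring_scope.

Section Tensor.
Variable F : fieldType.
Implicit Types U V W : vectType F.

(* A concrete model of the tensor product: the coordinate matrices with respect
   to the bases [vbasis].  The lemmas [tliftE] and [tens_ext] are its universal
   property. *)
Definition tens V W : vectType F := 'M[F]_(\dim {:V}, \dim {:W}).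

Definition tensor V W (x : V) (y : W) : tens V W :=
  \matrix_(i, j) (coord (vbasis {:V}) i x * coord (vbasis {:W}) j y).

Definition tlift U V W (f : V -> W -> U) : 'Hom(tens V W, U) :=
  linfun (fun M : tens V W =>
    \sum_i \sum_j M i j *: f (vbasis {:V})`_i (vbasis {:W})`_j).

Definition bilin U V W (f : V -> W -> U) :=
  (forall y, linear (f^~ y)) /\ (forall x, linear (f x)).

Lemma tlift_lin U V W (f : V -> W -> U) :
  linear (fun M : tens V W =>
    \sum_i \sum_j M i j *: f (vbasis {:V})`_i (vbasis {:W})`_j).
Proof.
move=> a M N; rewrite scaler_sumr -big_split /=; apply: eq_bigr => i _.
rewrite scaler_sumr -big_split /=; apply: eq_bigr => j _.
by rewrite !mxE scalerDl scalerA.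
Qed.

Lemma linfunE U V (f : U -> V) : linear f -> linfun f =1 f.
Proof.
move=> lf x.
pose fL : {linear U -> V} := HB.pack f (GRing.isLinear.Build _ _ _ _ f lf).
exact: (lfunE fL).
Qed.

Lemma bilin_tensor V W : bilin (@tensor V W).
Proof.
split=> [y a x x'|x a y y']; apply/matrixP=> i j; rewrite !mxE linearP /=.
  by rewrite mulrDl mulrA.
by rewrite mulrDr mulrCA.
Qed.

Lemma linear_sumf U V (f : U -> V) (I : finType) (c : I -> F) (x : I -> U) :
  linear f -> f (\sum_i c i *: x i) = \sum_i c i *: f (x i).
Proof.
move=> lf; rewrite -(linfunE lf) linear_sum; apply: eq_bigr => i _.
by rewrite linearZ /= linfunE.
Qed.

Lemma tliftE U V W (f : V -> W -> U) x y :
  bilin f -> tlift f (tensor x y) = f x y.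
Proof.
move=> [fl fr]; rewrite linfunE; last exact: tlift_lin.
rewrite [in RHS](coord_vbasis (memvf x)) [in RHS](coord_vbasis (memvf y)).
rewrite (linear_sumf _ _ (fl _)); apply: eq_bigr => i _.
rewrite (linear_sumf _ _ (fr _)) scaler_sumr; apply: eq_bigr => j _.
by rewrite mxE scalerA.
Qed.

Lemma lfun_sum2 U V (f : 'Hom(U, V)) (I J : finType) (c : I -> J -> F) x :
  f (\sum_i \sum_j c i j *: x i j) = \sum_i \sum_j c i j *: f (x i j).
Proof.
rewrite linear_sum; apply: eq_bigr => i _; rewrite linear_sum.
by apply: eq_bigr => j _; rewrite linearZ.
Qed.

Lemma tens_ext U V W (f g : 'Hom(tens V W, U)) :
  (forall x y, f (tensor x y) = g (tensor x y)) -> f = g.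
Proof.
move=> fg; apply/lfunP=> M.
have -> : M = \sum_i \sum_j
    M i j *: (tensor (vbasis {:V})`_i (vbasis {:W})`_j : tens V W).
  rewrite [LHS]matrix_sum_delta; apply: eq_bigr => i _; apply: eq_bigr => j _.
  congr (_ *: _); apply/matrixP=> k l; rewrite !mxE.
  have fV : free (vbasis {:V}) := basis_free (vbasisP _).
  have fW : free (vbasis {:W}) := basis_free (vbasisP _).
  by rewrite !coord_free // -natrM mulnb [i == k]eq_sym [j == l]eq_sym.
by rewrite !lfun_sum2; apply: eq_bigr => i _; apply: eq_bigr => j _; rewrite fg.
Qed.

Definition tmap U U' V V' (f : 'Hom(U, V)) (g : 'Hom(U', V')) :
    'Hom(tens U U', tens V V') :=
  tlift (fun x y => tensor (f x) (g y)).

Lemma tmapE U U' V V' (f : 'Hom(U, V)) (g : 'Hom(U', V')) x y :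
  tmap f g (tensor x y) = tensor (f x) (g y).
Proof.
apply: tliftE; split=> [z a u v|z a u v].
  by rewrite linearP; apply: (bilin_tensor _ _).1.
by rewrite linearP; apply: (bilin_tensor _ _).2.
Qed.

Definition dsum U V : vectType F := (U * V)%type.

Definition pmap U U' V V' (f : 'Hom(U, V)) (g : 'Hom(U', V')) :
    'Hom(dsum U U', dsum V V') :=
  linfun (fun p : dsum U U' => (f p.1, g p.2) : dsum V V').

Lemma pmapE U U' V V' (f : 'Hom(U, V)) (g : 'Hom(U', V')) p :
  pmap f g p = (f p.1, g p.2).
Proof. by rewrite linfunE // => a [u u'] [v v']; rewrite /= !linearP. Qed.

Definition ltrace V (f : 'End(V)) : F :=
  \sum_i coord (vbasis {:V}) i (f (vbasis {:V})`_i).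

(* The supercommutator; [s] is the parity of the product |d||e|. *)
Definition scomm V (s : bool) (d e : 'End(V)) : 'End(V) :=
  (d \o e)%VF - (-1) ^+ s *: (e \o d)%VF.

Lemma scommE V s (d e : 'End(V)) x :
  scomm s d e x = d (e x) - (-1) ^+ s *: e (d x).
Proof. by rewrite add_lfunE opp_lfunE scale_lfunE !comp_lfunE. Qed.

Lemma scomm_bilin V s : @bilin 'End(V) 'End(V) 'End(V) (scomm s).
Proof.
have H (f g h k : 'End(V)) a : scomm s f g = a *: h + k <->
    forall x, f (g x) - (-1) ^+ s *: g (f x) = a *: h x + k x.
  split=> [/lfunP fg x|fg].
    by have := fg x; rewrite scommE add_lfunE scale_lfunE.
  by apply/lfunP=> x; rewrite scommE add_lfunE scale_lfunE.
split=> [z a u v|z a u v]; apply/H => x; rewrite !scommE.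
  rewrite !add_lfunE !scale_lfunE linearP /= !scalerDr scalerN opprD addrACA.
  by rewrite !scalerA [a * _]mulrC.
rewrite !add_lfunE !scale_lfunE linearP /= !scalerDr scalerN opprD addrACA.
by rewrite !scalerA [a * _]mulrC.
Qed.

End Tensor.

Section TensorMore.
Variable F : fieldType.
Implicit Types U V W : vectType F.

Lemma tlift_lincomb U V W (f g h : V -> W -> U) a t :
  (forall x y, f x y = a *: g x y + h x y) ->
  tlift f t = a *: tlift g t + tlift h t.
Proof.
move=> fgh; rewrite !linfunE; try exact: tlift_lin.
rewrite scaler_sumr -big_split /=; apply: eq_bigr => i _.
rewrite scaler_sumr -big_split /=; apply: eq_bigr => j _.
by rewrite fgh scalerDr !scalerA mulrC.
Qed.

Lemma tlift_eq U V W (f g : V -> W -> U) t :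
  (forall x y, f x y = g x y) -> tlift f t = tlift g t.
Proof.
move=> fg; rewrite !linfunE; try exact: tlift_lin.
by apply: eq_bigr => i _; apply: eq_bigr => j _; rewrite fg.
Qed.

Lemma tens_ind U V W (f g : tens V W -> U) :
  linear f -> linear g ->
  (forall x y, f (tensor x y) = g (tensor x y)) -> f =1 g.
Proof.
move=> lf lg fg t; rewrite -(linfunE lf) -(linfunE lg).
by congr (fun_of_lfun _ t); apply: tens_ext => x y; rewrite !linfunE.
Qed.

Lemma tmap_comp U U' V V' W W' (f : 'Hom(V, W)) (f' : 'Hom(V', W'))
    (g : 'Hom(U, V)) (g' : 'Hom(U', V')) :
  (tmap f f' \o tmap g g' = tmap (f \o g) (f' \o g'))%VF.
Proof. by apply: tens_ext => x y; rewrite !(comp_lfunE, tmapE). Qed.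

Lemma tmap1 U V : tmap \1%VF \1%VF = \1%VF :> 'End(tens U V).
Proof. by apply: tens_ext => x y; rewrite !(id_lfunE, tmapE). Qed.

Lemma pmap_comp U U' V V' W W' (f : 'Hom(V, W)) (f' : 'Hom(V', W'))
    (g : 'Hom(U, V)) (g' : 'Hom(U', V')) :
  (pmap f f' \o pmap g g' = pmap (f \o g) (f' \o g'))%VF.
Proof. by apply/lfunP=> p; rewrite !(comp_lfunE, pmapE). Qed.

Lemma pmap1 U V : pmap \1%VF \1%VF = \1%VF :> 'End(dsum U V).
Proof. by apply/lfunP=> -[x y]; rewrite !(id_lfunE, pmapE). Qed.

End TensorMore.

Section RepC3.
Variable F : fieldType.

(* A representation of C_3, given by the action of the generator sigma. *)
Record repC3 := RepC3 {
  rep_car :> vectType F;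
  gact : 'End(rep_car);
  gact3 : (gact \o gact \o gact = \1)%VF }.

Record homC3 (X Y : repC3) := HomC3 {
  hom_fun :> 'Hom(X, Y);
  hom_eqv : (hom_fun \o gact X = gact Y \o hom_fun)%VF }.

Lemma homC3E X Y (f : homC3 X Y) x : f (gact X x) = gact Y (f x).
Proof. by rewrite -!comp_lfunE hom_eqv. Qed.

Lemma hom1_subproof (X : repC3) : (\1 \o gact X = gact X \o \1)%VF.
Proof. by rewrite comp_lfun1l comp_lfun1r. Qed.
Definition hom1 X : homC3 X X := HomC3 (hom1_subproof X).

Lemma homM_subproof X Y Z (f : homC3 Y Z) (g : homC3 X Y) :
  ((f \o g) \o gact X = gact Z \o (f \o g))%VF.
Proof. by rewrite -comp_lfunA hom_eqv comp_lfunA hom_eqv comp_lfunA. Qed.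
Definition homM X Y Z (f : homC3 Y Z) (g : homC3 X Y) : homC3 X Z :=
  HomC3 (homM_subproof f g).

Lemma homB_subproof X Y (f g : homC3 X Y) :
  ((hom_fun f - hom_fun g) \o gact X = gact Y \o (hom_fun f - hom_fun g))%VF.
Proof.
by rewrite comp_lfunDl comp_lfunDr comp_lfunNl comp_lfunNr !hom_eqv.
Qed.
Definition homB X Y (f g : homC3 X Y) : homC3 X Y := HomC3 (homB_subproof f g).

Definition negligible X Y (f : homC3 X Y) :=
  forall g : homC3 Y X, ltrace (homM f g) = 0.

(* [ver_eq f g] is the equality of the classes of f and g in Ver_3; morphisms
   of Ver_3 are handled through representatives. *)
Definition ver_eq X Y (f g : homC3 X Y) := negligible (homB f g).

Definition ver_isom X Y (f : homC3 X Y) :=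
  exists g : homC3 Y X,
    ver_eq (homM g f) (hom1 X) /\ ver_eq (homM f g) (hom1 Y).

Lemma triv_subproof (V : vectType F) : (\1 \o \1 \o \1 = \1 :> 'End(V))%VF.
Proof. by rewrite !comp_lfun1l. Qed.
Definition trivR (V : vectType F) : repC3 := RepC3 (triv_subproof V).

Definition unitR : repC3 := trivR F^o.

Lemma dsum_subproof (X Y : repC3) :
  (pmap (gact X) (gact Y) \o pmap (gact X) (gact Y) \o pmap (gact X) (gact Y)
   = \1)%VF.
Proof. by rewrite !pmap_comp !gact3 pmap1. Qed.
Definition dsumR (X Y : repC3) : repC3 := RepC3 (dsum_subproof X Y).

Lemma tens_subproof (X Y : repC3) :
  (tmap (gact X) (gact Y) \o tmap (gact X) (gact Y) \o tmap (gact X) (gact Y)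
   = \1)%VF.
Proof. by rewrite !tmap_comp !gact3 tmap1. Qed.
Definition tensR (X Y : repC3) : repC3 := RepC3 (tens_subproof X Y).

Lemma dsumM_subproof X X' Y Y' (f : homC3 X Y) (f' : homC3 X' Y') :
  (pmap f f' \o gact (dsumR X X') = gact (dsumR Y Y') \o pmap f f')%VF.
Proof. by rewrite /= !pmap_comp !hom_eqv. Qed.
Definition dsumM X X' Y Y' (f : homC3 X Y) (f' : homC3 X' Y') :
  homC3 (dsumR X X') (dsumR Y Y') :=
  @HomC3 (dsumR X X') (dsumR Y Y') _ (dsumM_subproof f f').

Lemma tensM_subproof X X' Y Y' (f : homC3 X Y) (f' : homC3 X' Y') :
  (tmap f f' \o gact (tensR X X') = gact (tensR Y Y') \o tmap f f')%VF.
Proof. by rewrite /= !tmap_comp !hom_eqv. Qed.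
Definition tensM X X' Y Y' (f : homC3 X Y) (f' : homC3 X' Y') :
  homC3 (tensR X X') (tensR Y Y') :=
  @HomC3 (tensR X X') (tensR Y Y') _ (tensM_subproof f f').

Lemma trivM_subproof (V W : vectType F) (f : 'Hom(V, W)) :
  (f \o gact (trivR V) = gact (trivR W) \o f)%VF.
Proof. by rewrite comp_lfun1l comp_lfun1r. Qed.
Definition trivM (V W : vectType F) (f : 'Hom(V, W)) :
  homC3 (trivR V) (trivR W) :=
  @HomC3 (trivR V) (trivR W) _ (trivM_subproof f).

Record algC3 := AlgC3 {
  alg_car :> repC3;
  amul : homC3 (tensR alg_car alg_car) alg_car }.

Lemma gact_lker0 (X : repC3) : lker (gact X) == 0%VS.
Proof.
apply/lker0P/(can_inj (g := (gact X \o gact X)%VF)) => x.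
by rewrite -comp_lfunE gact3 id_lfunE.
Qed.

Definition gconj (V : repC3) (d : 'End(V)) : 'End(V) :=
  (gact V \o d \o (gact V)^-1)%VF.

Lemma gconj_lin (V : repC3) : linear (@gconj V).
Proof.
move=> a d e; rewrite /gconj comp_lfunDr comp_lfunDl.
by rewrite -comp_lfunZr -comp_lfunZl.
Qed.

Lemma gconjE (V : repC3) (d : 'End(V)) x : gconj d (gact V x) = gact V (d x).
Proof. by rewrite !comp_lfunE (lker0_lfunK (gact_lker0 V)). Qed.

Lemma gact_surj (V : repC3) x : exists y, x = gact V y.
Proof.
by exists (gact V (gact V x)); rewrite -!comp_lfunE gact3 id_lfunE.
Qed.

Lemma gconjM (V : repC3) (d e : 'End(V)) :
  gconj (d \o e)%VF = (gconj d \o gconj e)%VF.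
Proof.
apply/lfunP=> x; case: (gact_surj x) => y ->.
by rewrite [RHS]comp_lfunE !gconjE !comp_lfunE.
Qed.

Lemma end_subproof (V : repC3) :
  (linfun (@gconj V) \o linfun (@gconj V) \o linfun (@gconj V) = \1)%VF.
Proof.
apply/lfunP=> d; rewrite !comp_lfunE !(linfunE (@gconj_lin V)) id_lfunE.
apply/lfunP=> x; case: (gact_surj x) => x1 ->; rewrite gconjE.
case: (gact_surj x1) => x2 ->; rewrite gconjE; case: (gact_surj x2) => x3 ->.
have g3 y : gact V (gact V (gact V y)) = y
  by rewrite -!comp_lfunE gact3 id_lfunE.
by rewrite gconjE !g3.
Qed.
Definition endR (V : repC3) : repC3 := RepC3 (end_subproof V).

Definition end_mul (V : repC3) : 'Hom(tens 'End(V) 'End(V), 'End(V)) :=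
  tlift (fun d e : 'End(V) => (d \o e)%VF).

Lemma end_mulE (V : repC3) (d e : 'End(V)) :
  end_mul V (tensor d e) = (d \o e)%VF.
Proof.
apply: tliftE; split=> [z a u v|z a u v].
  by rewrite comp_lfunDl comp_lfunZl.
by rewrite comp_lfunDr comp_lfunZr.
Qed.

Lemma end_mul_subproof (V : repC3) :
  (end_mul V \o gact (tensR (endR V) (endR V)) = gact (endR V) \o end_mul V)%VF.
Proof.
apply: tens_ext => d e; rewrite !comp_lfunE /= tmapE.
by rewrite !end_mulE !(linfunE (@gconj_lin V)) gconjM.
Qed.

Definition endA (V : repC3) : algC3 := 
  @AlgC3 (endR V)
    (@HomC3 (tensR (endR V) (endR V)) (endR V) _ (end_mul_subproof V)).

End RepC3.

Section SoC3.
Variable F : fieldType.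
Implicit Types (V : repC3 F).

Definition form V (b : homC3 (tensR V V) (unitR F)) (x y : V) : F :=
  b (tensor x y).

Definition form_sym V (b : homC3 (tensR V V) (unitR F)) :=
  forall x y, form b x y = form b y x.

Definition form_nondeg V (b : homC3 (tensR V V) (unitR F)) :=
  forall x, (forall y, form b x y = 0) -> x = 0.

Definition so_def V (b : homC3 (tensR V V) (unitR F)) (d : 'End(V)) :
    'Hom(tens V V, F^o) :=
  @tlift F F^o V V (fun x y => form b (d x) y + form b x (d y)).

Definition so V (b : homC3 (tensR V V) (unitR F)) : {vspace 'End(V)} :=
  lker (linfun (so_def b)).

Lemma form_bilin V (b : homC3 (tensR V V) (unitR F)) :
  bilin (form b : V -> V -> F^o).
Proof.
split=> [y a u v|x a u v]; rewrite /form -linearP; congr (b _).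
  exact: (bilin_tensor _ _).1.
exact: (bilin_tensor _ _).2.
Qed.

Lemma form_gact V (b : homC3 (tensR V V) (unitR F)) x y :
  form b (gact V x) (gact V y) = form b x y.
Proof.
by rewrite /form -tmapE; have := homC3E b (tensor x y); rewrite /= id_lfunE.
Qed.

Lemma so_def_lin V (b : homC3 (tensR V V) (unitR F)) : linear (so_def b).
Proof.
move=> a d e; apply/lfunP=> t; rewrite add_lfunE scale_lfunE.
apply: tlift_lincomb => x y; rewrite !add_lfunE !scale_lfunE.
rewrite (form_bilin b).1 (form_bilin b).2 scalerDr addrACA.
by [].
Qed.

Lemma so_memP V (b : homC3 (tensR V V) (unitR F)) (d : 'End(V)) :
  d \in so b <-> forall x y, form b (d x) y + form b x (d y) = 0.
Proof.
have B : @bilin F F^o V V (fun x y => form b (d x) y + form b x (d y)).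
  split=> [y a u v|x a u v]; rewrite linearP.
    by rewrite !(form_bilin b).1 scalerDr addrACA.
  by rewrite !(form_bilin b).2 scalerDr addrACA.
rewrite memv_ker (linfunE (so_def_lin b)); split=> [/eqP d0 x y|d0].
  by rewrite -(tliftE _ _ B) -/(so_def b d) d0 zero_lfunE.
by apply/eqP/tens_ext => x y; rewrite (tliftE _ _ B) d0 zero_lfunE.
Qed.

Lemma gconj_scomm V s (d e : 'End(V)) :
  gconj (scomm s d e) = scomm s (gconj d) (gconj e).
Proof.
apply/lfunP=> x; case: (gact_surj x) => y ->.
by rewrite gconjE !scommE !gconjE linearB linearZ.
Qed.

Lemma so_conj V (b : homC3 (tensR V V) (unitR F)) (d : 'End(V)) :
  d \in so b -> gconj d \in so b.
Proof.
move=> /so_memP hd; apply/so_memP => x y.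
case: (gact_surj x) => x' ->; case: (gact_surj y) => y' ->.
by rewrite !gconjE !form_gact.
Qed.

Lemma so_comm V (b : homC3 (tensR V V) (unitR F)) (d e : 'End(V)) :
  d \in so b -> e \in so b -> scomm false d e \in so b.
Proof.
have fB u v w : form b (u - v) w = form b u w - form b v w.
  by rewrite -[u - v]addrC -scaleN1r (form_bilin b).1 scaleN1r addrC.
have fC u v w : form b w (u - v) = form b w u - form b w v.
  by rewrite -[u - v]addrC -scaleN1r (form_bilin b).2 scaleN1r addrC.
have sk (h : 'End(V)) x y : h \in so b -> form b (h x) y = - form b x (h y).
  by move=> /so_memP /(_ x y)/eqP; rewrite addr_eq0 => /eqP.
move=> hd he; apply/so_memP => x y.
rewrite !scommE expr0 !scale1r fB fC !(sk _ _ _ hd, sk _ _ _ he).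
by rewrite !opprK addrA subrK subrr.
Qed.

(* [vsproj] is only applied to elements of [so b], on which it is the inverse
   of the inclusion [vsval]. *)
Definition so_gact V (b : homC3 (tensR V V) (unitR F)) :
    'End(subvs_of (so b)) :=
  linfun (fun d => vsproj (so b) (gconj (vsval d))).

Definition so_mul V (b : homC3 (tensR V V) (unitR F)) :
    'Hom(tens (subvs_of (so b)) (subvs_of (so b)), subvs_of (so b)) :=
  tlift (fun d e =>
    vsproj (so b) (scomm false (vsval d) (vsval e))).

Lemma so_gactE V (b : homC3 (tensR V V) (unitR F)) (d : subvs_of (so b)) :
  vsval (so_gact b d) = gconj (vsval d).
Proof.
rewrite linfunE ?vsprojK //; first by apply/so_conj/subvsP.
by move=> a u v; rewrite linearP /= gconj_lin linearP.
Qed.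

Lemma so_mulE V (b : homC3 (tensR V V) (unitR F)) (d e : subvs_of (so b)) :
  vsval (so_mul b (tensor d e)) = (scomm false (vsval d) (vsval e)).
Proof.
rewrite tliftE ?vsprojK //; first by apply: so_comm; apply: subvsP.
split=> [y a u v|x a u v]; rewrite -linearP; congr (vsproj _ _);
  rewrite linearP.
  exact: (scomm_bilin _ _).1.
exact: (scomm_bilin _ _).2.
Qed.

Lemma so_subproof V (b : homC3 (tensR V V) (unitR F)) :
  (so_gact b \o so_gact b \o so_gact b = \1)%VF.
Proof.
apply/lfunP=> d; apply: val_inj; rewrite /= !comp_lfunE !so_gactE id_lfunE.
have /lfunP/(_ (vsval d)) := gact3 (endR V).
by rewrite /= !comp_lfunE !(linfunE (@gconj_lin _ V)) id_lfunE.
Qed.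
Definition soR V (b : homC3 (tensR V V) (unitR F)) : repC3 F :=
  RepC3 (so_subproof b).

Lemma so_mul_subproof V (b : homC3 (tensR V V) (unitR F)) :
  (so_mul b \o gact (tensR (soR b) (soR b)) = gact (soR b) \o so_mul b)%VF.
Proof.
apply: tens_ext => d e; apply: val_inj; rewrite /= !comp_lfunE /= tmapE.
by rewrite so_gactE !so_mulE !so_gactE gconj_scomm.
Qed.

Definition soA V (b : homC3 (tensR V V) (unitR F)) : algC3 F :=
  @AlgC3 _ (soR b)
    (@HomC3 _ (tensR (soR b) (soR b)) (soR b) _ (so_mul_subproof b)).

End SoC3.

Section Super.
Variable F : fieldType.

Record svect := SVect { ev : vectType F; od : vectType F }.

Record shom (X Y : svect) := SHom {
  hev : 'Hom(ev X, ev Y);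
  hod : 'Hom(od X, od Y) }.

Definition total (X : svect) : vectType F := dsum (ev X) (od X).

Definition homog (X : svect) (p : bool) (x : total X) : Prop :=
  if p then x.1 = 0 else x.2 = 0.

Definition sapp (X Y : svect) (f : shom X Y) : 'Hom(total X, total Y) :=
  pmap (hev f) (hod f).

Definition sunit : svect := SVect F^o 'rV[F]_0.

Definition stens (X Y : svect) : svect :=
  SVect (dsum (tens (ev X) (ev Y)) (tens (od X) (od Y)))
        (dsum (tens (ev X) (od Y)) (tens (od X) (ev Y))).

Definition stensor (X Y : svect) (x : total X) (y : total Y) :
    total (stens X Y) :=
  ((tensor x.1 y.1, tensor x.2 y.2), (tensor x.1 y.2, tensor x.2 y.1)).

Record salg := SAlg {
  salg_car :> svect;
  smul : shom (stens salg_car salg_car) salg_car }.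

Definition sprod (A : salg) (x y : total A) : total A :=
  sapp (smul A) (stensor x y).

Definition salg_iso (A B : salg) := exists phi : shom A B,
  bijective (sapp phi) /\
  forall x y, sapp phi (sprod x y) = sprod (sapp phi x) (sapp phi y).

(* Superalgebra with homogeneous components [U false] and [U true] inside a
   space E, with product [op p q] on U p x U q.  If U is closed under [op],
   [vsproj] below only inverts the inclusion [vsval], see [sub_salgE]. *)
Definition sub_salg (E : vectType F) (U : bool -> {vspace E})
    (op : bool -> bool -> E -> E -> E) : salg :=
  let X := SVect (subvs_of (U false)) (subvs_of (U true)) in
  let m p q r : 'Hom(tens (subvs_of (U p)) (subvs_of (U q)), subvs_of (U r)) :=
    tlift (fun x y => vsproj (U r) (op p q (vsval x) (vsval y))) in
  @SAlg X (@SHom (stens X X) X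
    (linfun (fun z => m false false false z.1 + m true true false z.2))
    (linfun (fun z => m false true true z.1 + m true false true z.2))).

Lemma sub_salgE (E : vectType F) (U : bool -> {vspace E}) op :
  (forall p q, @bilin F E E E (op p q)) ->
  (forall p q d e, d \in U p -> e \in U q -> op p q d e \in U (p (+) q)) ->
  forall x y : total (sub_salg U op),
    vsval (sprod x y).1 = op false false (vsval x.1) (vsval y.1)
                        + op true true (vsval x.2) (vsval y.2) /\
    vsval (sprod x y).2 = op false true (vsval x.1) (vsval y.2)
                        + op true false (vsval x.2) (vsval y.1).
Proof.
move=> opB opU x y.
have lin2 (A B C : vectType F) (f : 'Hom(A, C)) (g : 'Hom(B, C)) :
    linear (fun z : dsum A B => f z.1 + g z.2 : C).
  by move=> a [u1 u2] [v1 v2]; rewrite !linearP /= scalerDr addrACA.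
have mE p q (d : subvs_of (U p)) (e : subvs_of (U q)) :
    vsval (tlift (fun x y => vsproj (U (p (+) q)) (op p q (vsval x) (vsval y)))
             (tensor d e)) = op p q (vsval d) (vsval e).
  rewrite tliftE ?vsprojK //; first by apply: opU; apply: subvsP.
  split=> [z a u v|z a u v]; rewrite -linearP; congr (vsproj _ _);
  rewrite linearP.
    exact: (opB _ _).1.
  exact: (opB _ _).2.
rewrite /sprod /sapp pmapE /= !(linfunE (lin2 _ _ _ _ _)) /=.
by split; congr (_ + _); [apply: (mE false false)|apply: (mE true true)
  |apply: (mE false true)|apply: (mE true false)].
Qed.

Definition sproj (W : svect) (p : bool) : 'End(total W) :=
  linfun (fun x : total W => (if p then (0, x.2) else (x.1, 0)) : total W).

(* The endomorphisms of parity p: the component of d mapping W_q to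
   W_(p + q + 1) vanishes, for q = 0, 1. *)
Definition send (W : svect) (p : bool) : {vspace 'End(total W)} :=
  (lker (linfun (fun d : 'End(total W) =>
           sproj W (~~ p) \o d \o sproj W false)%VF)
   :&: lker (linfun (fun d : 'End(total W) =>
           sproj W p \o d \o sproj W true)%VF))%VS.

Definition sendA (W : svect) : salg :=
  sub_salg (send W) (fun _ _ d e => (d \o e)%VF).

Definition sform (W : svect) (b : shom (stens W W) sunit) (x y : total W) : F :=
  (sapp b (stensor x y)).1.

Definition supersymmetric (W : svect) (b : shom (stens W W) sunit) :=
  forall p q (x y : total W), homog p x -> homog q y ->
    sform b x y = (-1) ^+ (p && q) * sform b y x.

Definition sform_nondeg (W : svect) (b : shom (stens W W) sunit) :=
  forall x, (forall y, sform b x y = 0) -> x = 0.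

(* x |-> (-1)^(p|x|) x *)
Definition ssign (W : svect) (p : bool) (x : total W) : total W :=
  (x.1, (-1) ^+ p *: x.2).

Definition osp_def (W : svect) (b : shom (stens W W) sunit) (p : bool)
    (d : 'End(total W)) : 'Hom(tens (total W) (total W), F^o) :=
  @tlift F F^o (total W) (total W)
    (fun x y => sform b (d x) y + sform b (ssign p x) (d y)).

Definition osp (W : svect) (b : shom (stens W W) sunit) (p : bool) :
    {vspace 'End(total W)} :=
  (send W p :&: lker (linfun (osp_def b p)))%VS.

Definition ospA (W : svect) (b : shom (stens W W) sunit) : salg :=
  sub_salg (osp b) (fun p q => @scomm F (total W) (p && q)).

Lemma send_memP (W : svect) p (d : 'End(total W)) :
  d \in send W p <-> forall q x, homog q x -> homog (p (+) q) (d x).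
Proof.
have projE q (x : total W) : sproj W q x = if q then (0, x.2) else (x.1, 0).
  by rewrite linfunE // => a [u1 u2] [v1 v2]; case: q; congr (_, _);
    rewrite /= ?scaler0 ?addr0.
have lin q r : linear (fun d : 'End(total W) => sproj W q \o d \o sproj W r)%VF.
  by move=> a u v; rewrite comp_lfunDr comp_lfunDl -comp_lfunZr -comp_lfunZl.
have kerE q r : d \in lker (linfun (fun d : 'End(total W) =>
    sproj W q \o d \o sproj W r)%VF) <->
    forall x, homog r x -> homog (~~ q) (d x).
  rewrite memv_ker (linfunE (lin q r)); split=> [/eqP/lfunP d0 x hx|d0].
    have := d0 x; rewrite !comp_lfunE zero_lfunE.
    have -> : sproj W r x = x.
      by rewrite projE; case: (r) hx; case: (x) => x1 x2 /= ->.
    by rewrite projE; case: (q) => -[].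
  apply/eqP/lfunP=> x; rewrite !comp_lfunE zero_lfunE.
  have /d0 : homog r (sproj W r x) by rewrite projE; case: (r).
  by rewrite [LHS]projE; case: (q) => /= ->.
split=> [|h].
  case/memv_capP=> /kerE h0 /kerE h1 [] x hx.
    by rewrite addbT; apply: h1.
  by rewrite addbF -[p]negbK; apply: h0.
apply/memv_capP; split; apply/kerE => x /h; first by rewrite addbF negbK.
by rewrite addbT.
Qed.

Lemma send_comp (W : svect) p q (d e : 'End(total W)) :
  d \in send W p -> e \in send W q -> (d \o e)%VF \in send W (p (+) q).
Proof.
move=> /send_memP hd /send_memP he; apply/send_memP=> r x hx.
by rewrite comp_lfunE -addbA; apply/hd/he.
Qed.

Lemma sendAE (W : svect) (x y : total (sendA W)) :
  (vsval (sprod x y).1 + vsval (sprod x y).2 =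
  (vsval x.1 + vsval x.2) \o (vsval y.1 + vsval y.2))%VF.
Proof.
have [||-> ->] := @sub_salgE _ (send W) (fun _ _ d e => (d \o e)%VF) _ _ x y.
- split=> [z a u v|z a u v].
    by rewrite comp_lfunDl comp_lfunZl.
  by rewrite comp_lfunDr comp_lfunZr.
- exact: send_comp.
by rewrite comp_lfunDl !comp_lfunDr addrACA [X in _ + X]addrC addrACA.
Qed.

Lemma sform_bilin (W : svect) (b : shom (stens W W) sunit) :
  @bilin F F^o (total W) (total W) (sform b).
Proof.
have st : bilin (@stensor W W).
  split=> [[y1 y2] a [u1 u2] [v1 v2]|[y1 y2] a [u1 u2] [v1 v2]].
    by rewrite /stensor /= !(bilin_tensor _ _).1.
  by rewrite /stensor /= !(bilin_tensor _ _).2.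
split=> [y a u v|y a u v]; rewrite /sform ?st.1 ?st.2 linearP //.
Qed.

Lemma ssignE (W : svect) p q (x : total W) :
  homog q x -> ssign p x = (-1) ^+ (p && q) *: x.
Proof.
case: x => x1 x2; rewrite /homog /ssign; case: q => /= ->.
  by rewrite andbT; congr (_, _); rewrite /= scaler0.
by rewrite andbF expr0 scale1r scaler0.
Qed.

Lemma osp_memP' (W : svect) (b : shom (stens W W) sunit) p (d : 'End(total W)) :
  d \in osp b p <-> d \in send W p /\
  forall q x y, homog q x ->
    sform b (d x) y + (-1) ^+ (p && q) * sform b x (d y) = 0.
Proof.
have bZ a x y : sform b (a *: x) y = a * sform b x y.
  have := (sform_bilin b).1 y a x 0; rewrite !addr0 => ->.
  have := (sform_bilin b).1 y 1 0 0; rewrite scaler0 addr0 scale1r.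
  by rewrite -[LHS]addr0 => /addrI <-; rewrite addr0.
have sgn_lin : linear (@ssign W p).
  move=> a [u1 u2] [v1 v2]; congr (_, _); rewrite /= scalerDr !scalerA.
  by rewrite [a * _]mulrC.
have B (e : 'End(total W)) : @bilin F F^o (total W) (total W)
    (fun x y => sform b (e x) y + sform b (ssign p x) (e y)).
  split=> [y a u v|x a u v]; rewrite linearP.
    by rewrite sgn_lin !(sform_bilin b).1 scalerDr addrACA.
  by rewrite !(sform_bilin b).2 scalerDr addrACA.
have L : linear (osp_def b p).
  move=> a u v; apply/lfunP=> t; rewrite add_lfunE scale_lfunE.
  apply: tlift_lincomb => x y; rewrite !add_lfunE !scale_lfunE.
  by rewrite (sform_bilin b).1 (sform_bilin b).2 scalerDr addrACA.
have K : d \in lker (linfun (osp_def b p)) <->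
    forall x y, sform b (d x) y + sform b (ssign p x) (d y) = 0.
  rewrite memv_ker (linfunE L); split=> [/eqP d0 x y|d0].
    by rewrite -(tliftE _ _ (B d)) -/(osp_def b p d) d0 zero_lfunE.
  by apply/eqP/tens_ext => x y; rewrite (tliftE _ _ (B d)) d0 zero_lfunE.
split=> [/memv_capP[dp /K d0]|[dp d0]].
  by split=> // q x y hx; rewrite -bZ -(ssignE p hx) d0.
apply/memv_capP; split=> //; apply/K => -[x1 x2] y.
pose u : total W := (x1, 0); pose v : total W := (0, x2).
have -> : ((x1, x2) : total W) = 1 *: u + v.
  by rewrite scale1r; congr (_, _); rewrite /= ?addr0 ?add0r.
rewrite ((B d).1 y) scale1r (@ssignE _ p false u) //.
rewrite (@ssignE _ p true v) // !bZ.
by rewrite d0 // d0 // addr0.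
Qed.

Lemma osp_memP (W : svect) (b : shom (stens W W) sunit) p (d : 'End(total W)) :
  d \in osp b p <-> d \in send W p /\
  forall q r x y, homog q x -> homog r y ->
    sform b (d x) y + (-1) ^+ (p && q) * sform b x (d y) = 0.
Proof.
apply: iff_trans (osp_memP' _ _ _) _; split=> -[dp d0]; split=> // q.
  by move=> r x y hx _; apply: d0.
move=> x [y1 y2] hx.
have Bl := (sform_bilin b).1; have Br := (sform_bilin b).2.
have -> : ((y1, y2) : total W) = 1 *: ((y1, 0) : total W) + (0, y2).
  by rewrite scale1r; congr (_, _); rewrite /= ?addr0 ?add0r.
rewrite linearP !Br !scale1r mulrDr addrACA.
by rewrite (d0 q false) // (d0 q true) // addr0.
Qed.

Lemma osp_comm (W : svect) (b : shom (stens W W) sunit) p q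
    (d e : 'End(total W)) :
  d \in osp b p -> e \in osp b q -> scomm (p && q) d e \in osp b (p (+) q).
Proof.
move=> /osp_memP'[dp d0] /osp_memP'[eq e0]; apply/osp_memP'; split.
  rewrite /scomm; apply: memvB; first exact: send_comp.
  by apply: memvZ; rewrite addbC; apply: send_comp.
have lf w : linear (sform b ^~ w : _ -> F^o) := (sform_bilin b).1 w.
have lr w : linear (sform b w : _ -> F^o) := (sform_bilin b).2 w.
have bB u v a w : sform b (u - a *: v) w = sform b u w - a * sform b v w.
  by rewrite -scaleNr addrC lf addrC; congr (_ + _); rewrite -mulNr.
have bC u v a w : sform b w (u - a *: v) = sform b w u - a * sform b w v.
  by rewrite -scaleNr addrC lr addrC; congr (_ + _); rewrite -mulNr.
move=> r x y hx; rewrite !scommE bB bC.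
have dE s u v : homog s u ->
    sform b (d u) v = - ((-1) ^+ (p && s) * sform b u (d v)).
  by move=> hu; apply/eqP; rewrite -addr_eq0 d0.
have eE s u v : homog s u ->
    sform b (e u) v = - ((-1) ^+ (q && s) * sform b u (e v)).
  by move=> hu; apply/eqP; rewrite -addr_eq0 e0.
have /send_memP/(_ _ _ hx) hd := dp; have /send_memP/(_ _ _ hx) he := eq.
rewrite (dE _ _ _ he) (eE _ _ _ hd) (dE _ _ _ hx) (eE _ _ _ hx).
set A := sform b x _; set B := sform b x _.
clearbody A B; clear; move: p q r => [] [] [];
  by rewrite /= ?expr0 ?expr1 ?mul1r ?mulN1r ?mulrN ?mulNr ?mul1r ?opprK; ring.
Qed.

End Super.

Section Semisimplification.
Variable F : fieldType.
Hypothesis char3 : 3%N \in [pchar F].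

(* The pair (a, c) stands for a v_0 + c v_1. *)
Definition V1_gact : 'End(dsum F^o F^o) :=
  linfun (fun u : dsum F^o F^o => (u.1, u.1 + u.2) : dsum F^o F^o).

Lemma V1_gactE u : V1_gact u = (u.1, u.1 + u.2).
Proof.
rewrite linfunE // => a [u1 u2] [v1 v2].
by congr (_, _); rewrite /= scalerDr addrACA.
Qed.

Lemma V1_subproof : (V1_gact \o V1_gact \o V1_gact = \1)%VF.
Proof.
apply/lfunP=> -[a c]; rewrite !comp_lfunE !V1_gactE id_lfunE /=.
have a3 : a *+ 3 = 0 by rewrite -mulr_natr (pcharf0 char3) mulr0.
by congr (_, _);
  rewrite !addrA -[RHS]add0r -[in RHS]a3 !mulrS mulr0n addr0 !addrA.
Qed.
Definition V1 : repC3 F := RepC3 V1_subproof.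

(* The form lambda: v_0 (x) v_1 |-> 1, v_1 (x) v_0 |-> -1. *)
Definition lam (u v : V1) : F := u.1 * v.2 - u.2 * v.1.

Definition Fobj (X : svect F) : repC3 F :=
  dsumR (trivR (ev X)) (tensR (trivR (od X)) V1).

Definition Fmor (X Y : svect F) (f : shom X Y) : homC3 (Fobj X) (Fobj Y) :=
  dsumM (trivM (hev f)) (tensM (trivM (hod f)) (hom1 V1)).

Definition J_oo (X Y : svect F) (t : tens (od X) V1) (s : tens (od Y) V1) :
    tens (od X) (od Y) :=
  tlift (fun x u => tlift (fun y v => lam u v *: tensor x y) s) t.

Definition J_eo (X Y : svect F) (x : ev X) (s : tens (od Y) V1) :
    tens (od (stens X Y)) V1 :=
  tlift (fun y v => tensor ((tensor x y, 0) : od (stens X Y)) v) s.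

Definition J_oe (X Y : svect F) (t : tens (od X) V1) (y : ev Y) :
    tens (od (stens X Y)) V1 :=
  tlift (fun x u => tensor ((0, tensor x y) : od (stens X Y)) u) t.

Definition J_fun (X Y : svect F) (a : Fobj X) (b : Fobj Y) :
    Fobj (stens X Y) :=
  ((tensor a.1 b.1, J_oo a.2 b.2), J_eo a.1 b.2 + J_oe a.2 b.1).

Definition J_lfun (X Y : svect F) :
    'Hom(tensR (Fobj X) (Fobj Y), Fobj (stens X Y)) :=
  tlift (@J_fun X Y).

Lemma lamDl a u u' v : lam (a *: u + u') v = a * lam u v + lam u' v.
Proof.
by rewrite /lam; case: u u' => [u1 u2] [v1 v2]; rewrite /= /GRing.scale /=; ring.
Qed.

Lemma lamDr a u u' v : lam v (a *: u + u') = a * lam v u + lam v u'.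
Proof.
by rewrite /lam; case: u u' => [u1 u2] [v1 v2]; rewrite /= /GRing.scale /=; ring.
Qed.

Lemma lam_gact u v : lam (gact V1 u) (gact V1 v) = lam u v.
Proof. by rewrite /lam /= !V1_gactE /=; ring. Qed.

Lemma J_ooE X Y x u y v :
  @J_oo X Y (tensor x u) (tensor y v) = lam u v *: tensor x y.
Proof.
have B x' u' : bilin (fun (y : od Y) (v : V1) => lam u' v *: tensor x' y).
  split=> [z a w w'|z a w w'].
    by rewrite (bilin_tensor _ _).2 scalerDr !scalerA mulrC.
  by rewrite lamDr scalerDl scalerA.
rewrite /J_oo tliftE ?tliftE //.
split=> [z a w w'|z a w w']; apply: tlift_lincomb => y' v'.
  by rewrite (bilin_tensor _ _).1 scalerDr !scalerA mulrC.
by rewrite lamDl scalerDl scalerA.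
Qed.

Lemma J_eo_bilin X Y : bilin (@J_eo X Y).
Proof.
split=> [s a x x'|x]; last exact: linearP.
apply: tlift_lincomb => y v; rewrite -(bilin_tensor _ _).1.
congr (tensor _ _); rewrite (bilin_tensor _ _).1.
by congr (_, _); rewrite /= scaler0 addr0.
Qed.

Lemma J_oe_bilin X Y : bilin (@J_oe X Y).
Proof.
split=> [y|t a y y']; first exact: linearP.
apply: tlift_lincomb => x u; rewrite -(bilin_tensor _ _).1.
congr (tensor _ _); rewrite (bilin_tensor _ _).2.
by congr (_, _); rewrite /= scaler0 addr0.
Qed.

Lemma J_oo_bilin X Y : bilin (@J_oo X Y).
Proof.
split=> [s|t a s s']; first exact: linearP.
by apply: tlift_lincomb => x u; rewrite linearP.
Qed.

Lemma J_eoE X Y (x : ev X) (y : od Y) v :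
  J_eo x (tensor y v) = tensor ((tensor x y, 0) : od (stens X Y)) v.
Proof.
rewrite /J_eo tliftE //; split=> [z a w w'|z]; last exact: (bilin_tensor _ _).2.
rewrite -(bilin_tensor _ _).1.
congr (tensor _ _); rewrite (bilin_tensor _ _).2.
by congr (_, _); rewrite /= scaler0 addr0.
Qed.

Lemma J_oeE X Y (x : od X) (y : ev Y) u :
  J_oe (tensor x u) y = tensor ((0, tensor x y) : od (stens X Y)) u.
Proof.
rewrite /J_oe tliftE //; split=> [z a w w'|z]; last exact: (bilin_tensor _ _).2.
rewrite -(bilin_tensor _ _).1.
congr (tensor _ _); rewrite (bilin_tensor _ _).1.
by congr (_, _); rewrite /= scaler0 addr0.
Qed.

Lemma J_fun_bilin X Y : bilin (@J_fun X Y).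
Proof.
split=> [[y s] a [x t] [x' t']|[x t] a [y s] [y' s']]; rewrite /J_fun /=.
  rewrite (bilin_tensor _ _).1 (J_oo_bilin _ _).1 (J_eo_bilin _ _).1.
  by rewrite (J_oe_bilin _ _).1 addrACA -scalerDr.
rewrite (bilin_tensor _ _).2 (J_oo_bilin _ _).2 (J_eo_bilin _ _).2.
by rewrite (J_oe_bilin _ _).2 addrACA -scalerDr.
Qed.

Lemma J_lfunE X Y (a : Fobj X) (b : Fobj Y) :
  J_lfun X Y (tensor a b) = J_fun a b.
Proof. exact: (tliftE _ _ (J_fun_bilin X Y)). Qed.

Lemma J_subproof X Y :
  (J_lfun X Y \o gact (tensR (Fobj X) (Fobj Y))
   = gact (Fobj (stens X Y)) \o J_lfun X Y)%VF.
Proof.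
apply: tens_ext => -[x t] [y s]; rewrite !comp_lfunE /= tmapE !J_lfunE.
rewrite !pmapE /J_fun /= !id_lfunE.
congr ((_, _), _).
  move: s; apply: tens_ind => [a u v|a u v|y' v].
  - by rewrite linearP (J_oo_bilin _ _).2.
  - by rewrite (J_oo_bilin _ _).2.
  move: t; apply: tens_ind => [a u w|a u w|x' u].
  - by rewrite linearP (J_oo_bilin _ _).1.
  - by rewrite (J_oo_bilin _ _).1.
  by rewrite !tmapE !id_lfunE !J_ooE lam_gact.
rewrite [RHS](linearD (tmap _ _)); congr (_ + _).
  move: s; apply: tens_ind => [a u v|a u v|y' v].
  - by rewrite linearP (J_eo_bilin _ _).2.
  - by rewrite (J_eo_bilin _ _).2 linearP.
  rewrite tmapE !J_eoE id_lfunE; apply/esym/(etrans (tmapE _ _ _ _)).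
  by rewrite id_lfunE.
move: t; apply: tens_ind => [a u v|a u v|x' u].
- by rewrite linearP (J_oe_bilin _ _).1.
- by rewrite (J_oe_bilin _ _).1 linearP.
rewrite tmapE !J_oeE id_lfunE; apply/esym/(etrans (tmapE _ _ _ _)).
  by rewrite id_lfunE.
Qed.

Definition J (X Y : svect F) :
    homC3 (tensR (Fobj X) (Fobj Y)) (Fobj (stens X Y)) :=
  @HomC3 _ (tensR (Fobj X) (Fobj Y)) (Fobj (stens X Y)) _ (J_subproof X Y).

(* The identification of F(sunit) = F (+) (0 (x) V_1) with the unit object. *)
Lemma unit_subproof :
  (linfun (fst : Fobj (sunit F) -> F^o) \o gact (Fobj (sunit F))
   = gact (unitR F) \o linfun (fst : Fobj (sunit F) -> F^o))%VF.
Proof.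
have L : linear (fst : Fobj (sunit F) -> F^o) by [].
apply/lfunP=> z; rewrite !comp_lfunE id_lfunE !(linfunE L) /= pmapE /=.
by rewrite id_lfunE.
Qed.
Definition Funit : homC3 (Fobj (sunit F)) (unitR F) :=
  @HomC3 _ (Fobj (sunit F)) (unitR F) _ unit_subproof.

Definition ss_obj (V : repC3 F) (W : svect F) :=
  exists f : homC3 (Fobj W) V, ver_isom f.

Definition ss_alg (A : algC3 F) (B : salg F) :=
  exists f : homC3 (Fobj B) A, ver_isom f /\
    ver_eq (homM f (homM (Fmor (smul B)) (J B B))) (homM (amul A) (tensM f f)).

Definition ss_form (V : repC3 F) (b : homC3 (tensR V V) (unitR F))
    (W : svect F) (c : shom (stens W W) (sunit F)) :=
  exists f : homC3 (Fobj W) V, ver_isom f /\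
    ver_eq (homM Funit (homM (Fmor c) (J W W))) (homM b (tensM f f)).

End Semisimplification.

(* Main.v *)
(* Fix an isomorphism F(W) = V in Ver_3.  A morphism h : F(X) -> End(V) in
   Ver_3 amounts to a morphism F(X) (x) V -> V, hence to F(X (x) W) -> F(W),
   hence, F being fully faithful, to an action X (x) W -> W, that is to a map
   X -> End(W).  This correspondence is multiplicative, and if h takes values
   in so(V, b), the action is skew for the form on W; conversely, if the action
   is skew, then h followed by the adjunction involution is - h.  So the
   semisimplification of End(V) acts faithfully on W through all of End(W), and
   that of so(V, b), a direct summand of End(V) as 2 is invertible, through
   exactly the skew endomorphisms.  Negligible morphisms form a tensor ideal
   because equivariant linear maps between spaces of homomorphisms have
   equivariant adjoints for the trace pairing. *)

Require Import Defs.
From mathcomp Require Import all_boot all_order all_algebra.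
From mathcomp Require Import ring ssrAC.

Set Implicit Arguments.
Unset Strict Implicit.
Unset Printing Implicit Defensive.

Import GRing.Theory.
Local Open Scope ring_scope.

(* [form] and [total] are shadowed by notions of mathcomp. *)
Local Notation form := Defs.form.
Local Notation total := Defs.total.

(** * Traces and negligible morphisms *)

Section Trace.
Variable F : fieldType.
Implicit Types U V W X Y : vectType F.

(** Morphisms of Ver_3 being classes, a lift of an action on W is controlled only up to negligible
    maps. In particular, the morphism into End(V) that represents a skew action need not take values
    in so(V, b); only its class is anti-invariant under adjunction, and the projection adj - 1 then
    replaces it by one with values in so(V, b). No dimensions are compared: faithfulness gives
    injectivity, and lifting the tautological action of End(W), or of the orthosymplectic algebra,
    gives the inverse. Identities between maps of superspaces are extracted from Ver_3 by evaluating
    any equivariant representative on even vectors x and on vectors x (x) v_1, which determine its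
    class. All signs come from one source: on the odd-odd summand, J is split by the invariant v_1
    (x) v_0 - v_0 (x) v_1, antisymmetric under the swap, on which lambda takes the value -2 = 1.
    Thus a swap of two odd factors costs -1, whereas composition of endomorphisms, which permutes
    nothing, costs no sign. *)

Lemma ltraceC U V (f : 'Hom(U, V)) (g : 'Hom(V, U)) :
  ltrace (f \o g)%VF = ltrace (g \o f)%VF.
Proof.
have tr2 X Y (h : 'Hom(X, Y)) (k : 'Hom(Y, X)) : ltrace (h \o k)%VF =
    \sum_(i < \dim {:Y}) \sum_(j < \dim {:X})
      coord (vbasis {:X}) j (k (vbasis {:Y})`_i)
      * coord (vbasis {:Y}) i (h (vbasis {:X})`_j).
  apply: eq_bigr => i _; rewrite comp_lfunE.
  rewrite {1}(coord_vbasis (memvf (k _))) !linear_sum /=.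
  by apply: eq_bigr => j _; rewrite !linearZ.
rewrite !tr2 exchange_big; apply: eq_bigr => i _; apply: eq_bigr => j _.
exact: mulrC.
Qed.

Lemma ltrace_is_linear V : linear (@ltrace F V : 'End(V) -> F^o).
Proof.
move=> a f g; rewrite /ltrace scaler_sumr -big_split; apply: eq_bigr => i _.
by rewrite add_lfunE scale_lfunE linearP.
Qed.

Lemma ltraceD V (f g : 'End(V)) : ltrace (f + g) = ltrace f + ltrace g.
Proof. by have := ltrace_is_linear 1 f g; rewrite !scale1r. Qed.

Lemma ltrace0 V : ltrace (0 : 'End(V)) = 0.
Proof. by apply: big1 => i _; rewrite zero_lfunE linear0. Qed.

Lemma ltraceN V (f : 'End(V)) : ltrace (- f) = - ltrace f.
Proof. by apply/eqP; rewrite -addr_eq0 -ltraceD addNr ltrace0. Qed.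

Lemma ltraceB V (f g : 'End(V)) : ltrace (f - g) = ltrace f - ltrace g.
Proof. by rewrite ltraceD ltraceN. Qed.

Definition rank1 V U (l : 'Hom(V, F^o)) (u : U) : 'Hom(V, U) :=
  linfun (fun v => (l v : F) *: u).

Lemma rank1E V U (l : 'Hom(V, F^o)) (u : U) v : rank1 l u v = (l v : F) *: u.
Proof. by rewrite linfunE // => a x y; rewrite linearP scalerDl scalerA. Qed.

Lemma rank1P V U (l : 'Hom(V, F^o)) : linear (@rank1 V U l).
Proof.
move=> a u v; apply/lfunP => x.
by rewrite add_lfunE scale_lfunE !rank1E scalerDr !scalerA mulrC.
Qed.

Lemma comp_rank1 V U W (h : 'Hom(U, W)) (l : 'Hom(V, F^o)) u :
  (h \o rank1 l u)%VF = rank1 l (h u).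
Proof. by apply/lfunP => x; rewrite comp_lfunE !rank1E linearZ. Qed.

Lemma ltrace_rank1 V (l : 'Hom(V, F^o)) u : ltrace (rank1 l u) = l u.
Proof.
rewrite [in RHS](coord_vbasis (memvf u)) linear_sum; apply: eq_bigr => i _.
by rewrite rank1E !linearZ /= mulrC.
Qed.

Definition vcoord V (i : 'I_(\dim {:V})) : 'Hom(V, F^o) :=
  linfun (coord (vbasis {:V}) i : V -> F^o).

Lemma vcoordE V i v : @vcoord V i v = coord (vbasis {:V}) i v.
Proof. by rewrite linfunE // => a x y; rewrite linearP. Qed.

Lemma functional_eq0 V (v : V) : (forall l : 'Hom(V, F^o), l v = 0) -> v = 0.
Proof.
move=> v0; rewrite (coord_vbasis (memvf v)); apply: big1 => i _.
by rewrite -vcoordE v0 scale0r.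
Qed.

Lemma ltrace_nondeg U V (f : 'Hom(U, V)) :
  (forall h : 'Hom(V, U), ltrace (h \o f)%VF = 0) -> f = 0.
Proof.
move=> f0; apply/lfunP => u; rewrite zero_lfunE; apply: functional_eq0 => l.
by rewrite -ltrace_rank1 -comp_rank1 ltraceC f0.
Qed.

(** The candidate is forced by rank one maps: the i-th coordinate of G v is the value of l on the
    map sending u to its i-th coordinate times v. *)
Lemma ltrace_represents U V (l : 'Hom(U, V) -> F^o) : linear l ->
  exists G : 'Hom(V, U), forall h, l h = ltrace (h \o G)%VF.
Proof.
move=> ll; pose G v := \sum_i (l (rank1 (vcoord i) v) : F) *: (vbasis {:U})`_i.
have Gl : linear G.
  move=> a u v; rewrite scaler_sumr -big_split; apply: eq_bigr => i _.
  by rewrite rank1P ll scalerDl scalerA.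
exists (linfun G) => h.
have lsum (I : finType) (H : I -> 'Hom(U, V)) : l (\sum_i H i) = \sum_i l (H i).
  rewrite -(linfunE ll) linear_sum; apply: eq_bigr => i _; exact: linfunE.
have lZ a k : l (a *: k) = a * l k by rewrite -!(linfunE ll) linearZ.
have {1}-> : h = \sum_(i < \dim {:U}) \sum_(j < \dim {:V})
    coord (vbasis {:V}) j (h (vbasis {:U})`_i) *:
    rank1 (vcoord i) (vbasis {:V})`_j.
  apply/lfunP => u; rewrite sum_lfunE [in LHS](coord_vbasis (memvf u)).
  rewrite linear_sum; apply: eq_bigr => i _; rewrite sum_lfunE linearZ /=.
  rewrite [in LHS](coord_vbasis (memvf (h _))) scaler_sumr.
  by apply: eq_bigr => j _; rewrite scale_lfunE rank1E vcoordE !scalerA mulrC.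
rewrite lsum; under eq_bigr => i _ do rewrite lsum.
rewrite exchange_big; apply: eq_bigr => j _; rewrite comp_lfunE linfunE //.
rewrite !linear_sum; apply: eq_bigr => i _.
by rewrite lZ !linearZ /= mulrC.
Qed.

(** With p a projection onto the image of k, k = p k, so tr k = tr (k p), and k p = 0 because k
    kills its image. *)
Lemma ltrace_sq0 V (k : 'End(V)) : (k \o k = 0)%VF -> ltrace k = 0.
Proof.
move=> k0; have -> : k = (projv (limg k) \o k)%VF.
  by apply/lfunP => x; rewrite comp_lfunE projv_id // memv_img ?memvf.
rewrite ltraceC (_ : (_ \o _)%VF = 0) ?ltrace0 //; apply/lfunP => x.
rewrite comp_lfunE zero_lfunE.
have /memv_imgP[y _ ->] : projv (limg k) x \in limg k by exact: memv_proj.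
by rewrite -comp_lfunE k0 zero_lfunE.
Qed.

(** The same exchange lowers the nilpotency order: tr k = tr (k p), and k p k p = k k p vanishes
    because the image of p is that of k. *)
Lemma ltrace_cube0 V (k : 'End(V)) : (k \o k \o k = 0)%VF -> ltrace k = 0.
Proof.
move=> k0; set p := projv (limg k).
have pk x : p (k x) = k x by rewrite projv_id // memv_img ?memvf.
have -> : k = (p \o k)%VF by apply/lfunP => x; rewrite comp_lfunE pk.
rewrite ltraceC; apply: ltrace_sq0; apply/lfunP => x.
rewrite !comp_lfunE zero_lfunE pk.
have /memv_imgP[y _ ->] : p x \in limg k by exact: memv_proj.
by rewrite -!comp_lfunE k0 zero_lfunE.
Qed.

End Trace.

Section Negligible.
Variable F : fieldType.
Implicit Types X Y Z : repC3 F.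

Lemma homC3P X Y (f g : homC3 X Y) : f =1 g -> f = g.
Proof.
case: f g => [f f_eq] [g g_eq] /= /lfunP fg.
by case: g / fg g_eq => g_eq; rewrite (eq_irrelevance f_eq g_eq).
Qed.

Lemma gactK X x : gact X (gact X (gact X x)) = x.
Proof. by rewrite -!comp_lfunE gact3 id_lfunE. Qed.

Lemma homME X Y Z (f : homC3 Y Z) (g : homC3 X Y) x : homM f g x = f (g x).
Proof. exact: comp_lfunE. Qed.

Lemma homMA X Y Z T (f : homC3 Z T) (g : homC3 Y Z) (h : homC3 X Y) :
  homM f (homM g h) = homM (homM f g) h.
Proof. by apply: homC3P => x; rewrite !homME. Qed.

Lemma hom1E X x : hom1 X x = x.
Proof. exact: id_lfunE. Qed.

Lemma homM1 X Y (f : homC3 X Y) : homM f (hom1 X) = f.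
Proof. by apply: homC3P => x; rewrite homME hom1E. Qed.

Lemma hom1M X Y (f : homC3 X Y) : homM (hom1 Y) f = f.
Proof. by apply: homC3P => x; rewrite homME hom1E. Qed.

Lemma negligible_eq X Y (f g : homC3 X Y) :
  (f = g :> 'Hom(X, Y)) -> negligible f -> negligible g.
Proof. by move=> fg f0 h; rewrite /= -fg f0. Qed.

(* Adjunction with respect to the trace pairing turns Phi into an equivariant
   map from Hom(Y', X') to Hom(Y, X). *)
Lemma negligible_map X Y X' Y' (Phi : 'Hom(X, Y) -> 'Hom(X', Y')) :
  linear Phi ->
  (forall h, Phi (gact Y \o h) \o gact X' = gact Y' \o Phi (h \o gact X))%VF ->
  forall (f : homC3 X Y) (f' : homC3 X' Y'),
    f' = Phi f :> 'Hom(X', Y') -> negligible f -> negligible f'.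
Proof.
move=> Pl Pe f f' ff' f0 g.
pose l (h : 'Hom(X, Y)) : F^o := ltrace (Phi h \o g)%VF.
have ll : linear l.
  move=> a u v; rewrite /l Pl comp_lfunDl -comp_lfunZl.
  exact: ltrace_is_linear.
have [G lG] := ltrace_represents ll.
(* Write [g] as sigma g sigma^2, sigma^2 being the inverse of sigma, let [Pe] move sigma across
   [Phi], and cycle the remaining sigma around the trace. *)
have lC h : l (gact Y \o h)%VF = l (h \o gact X)%VF :> F.
  have gE : hom_fun g = (gact X' \o g \o gact Y' \o gact Y')%VF.
    by apply/lfunP => y; rewrite !comp_lfunE -!homC3E gactK.
  rewrite /l {1}gE !comp_lfunA Pe -!comp_lfunA ltraceC.
  apply: (congr1 (@ltrace _ _)); apply/lfunP => x.
  by rewrite !comp_lfunE gactK.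
have GE : (G \o gact Y = gact X \o G)%VF.
  apply/eqP; rewrite -subr_eq0; apply/eqP/ltrace_nondeg => h.
  rewrite comp_lfunDr comp_lfunNr ltraceB comp_lfunA -ltraceC -/(l _).
  by rewrite comp_lfunA -lG comp_lfunA -lG lC subrr.
by have := f0 (HomC3 GE); rewrite /= -lG ff'.
Qed.

Lemma negligible0 X Y (f : homC3 X Y) : f =1 (fun=> 0) -> negligible f.
Proof.
move=> f0 g; rewrite (_ : hom_fun _ = 0) ?ltrace0 //.
by apply/lfunP => x; rewrite homME f0 zero_lfunE.
Qed.

Lemma negligibleMl X Y Z (f : homC3 Y Z) (g : homC3 X Y) :
  negligible g -> negligible (homM f g).
Proof.
by move=> g0 h; rewrite /= -comp_lfunA ltraceC -comp_lfunA (g0 (homM h f)).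
Qed.

Lemma negligibleMr X Y Z (f : homC3 Y Z) (g : homC3 X Y) :
  negligible f -> negligible (homM f g).
Proof. by move=> f0 h; rewrite /= -comp_lfunA (f0 (homM g h)). Qed.

End Negligible.

Local Notation "f =v g" := (ver_eq f g) (at level 70, no associativity).

(** * Equality of morphisms in Ver_3 and tests for negligibility *)

Section VerEq.
Variable F : fieldType.
Implicit Types X Y Z : repC3 F.

Lemma ver_eqP X Y (f g : homC3 X Y) : (f =v g) <->
  forall h : homC3 Y X, ltrace (f \o h)%VF = ltrace (g \o h)%VF.
Proof.
split=> fg h; last by rewrite /= comp_lfunDl comp_lfunNl ltraceB fg subrr.
apply/eqP; rewrite -subr_eq0 -ltraceB -comp_lfunNl -comp_lfunDl.
exact/eqP/(fg h).
Qed.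

Lemma ver_refl X Y (f : homC3 X Y) : f =v f.
Proof. exact/ver_eqP. Qed.

Lemma ver_sym X Y (f g : homC3 X Y) : (f =v g) -> (g =v f).
Proof. by move=> /ver_eqP fg; apply/ver_eqP => h; rewrite fg. Qed.

Lemma ver_trans X Y (g f h : homC3 X Y) : (f =v g) -> (g =v h) -> (f =v h).
Proof.
by move=> /ver_eqP fg /ver_eqP gh; apply/ver_eqP => k; rewrite fg gh.
Qed.

Lemma ver_comp X Y Z (f f' : homC3 Y Z) (g g' : homC3 X Y) :
  (f =v f') -> (g =v g') -> (homM f g =v homM f' g').
Proof.
move=> ff' gg'; apply: (@ver_trans _ _ (homM f g')).
  apply: negligible_eq (negligibleMl f gg').
  by rewrite /= comp_lfunDr comp_lfunNr.
apply: negligible_eq (negligibleMr g' ff').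
by rewrite /= comp_lfunDl comp_lfunNl.
Qed.

Lemma ver_compl X Y Z (f : homC3 Y Z) (g g' : homC3 X Y) :
  (g =v g') -> (homM f g =v homM f g').
Proof. exact/ver_comp/ver_refl. Qed.

Lemma ver_compr X Y Z (f f' : homC3 Y Z) (g : homC3 X Y) :
  (f =v f') -> (homM f g =v homM f' g).
Proof. by move=> ff'; apply/ver_comp/ver_refl. Qed.

Lemma tensME X X' Y Y' (f : homC3 X Y) (f' : homC3 X' Y') x x' :
  tensM f f' (tensor x x') = tensor (f x) (f' x').
Proof. exact: tmapE. Qed.

Lemma tensMM X X' Y Y' Z Z' (f : homC3 Y Z) (f' : homC3 Y' Z')
    (g : homC3 X Y) (g' : homC3 X' Y') :
  tensM (homM f g) (homM f' g') = homM (tensM f f') (tensM g g').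
Proof. by apply: homC3P => t; rewrite /= tmap_comp. Qed.

(** Tensoring with an identity is an equivariant operation on Hom spaces, to which [negligible_map]
    applies; a general second factor is then split off by the interchange law, composition
    preserving classes. *)
Lemma ver_tensl X X' Y Y' (f g : homC3 X Y) (h : homC3 X' Y') :
  (f =v g) -> (tensM f h =v tensM g h).
Proof.
move=> fg.
have {fg} : tensM f (hom1 X') =v tensM g (hom1 X').
  apply: (@negligible_map _ _ _ (tensR X X') (tensR Y X')
    (fun k => tmap k \1%VF) _ _ (homB f g)) fg => [a k l|k|].
  - apply: tens_ext => x y; rewrite add_lfunE scale_lfunE !tmapE.
    by rewrite add_lfunE scale_lfunE; apply: (bilin_tensor _ _).1.
  - by rewrite /= !tmap_comp !comp_lfun1l !comp_lfun1r !comp_lfunA.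
  apply: tens_ext => x y; rewrite !(tmapE, add_lfunE, opp_lfunE).
  by rewrite -scaleN1r addrC -(bilin_tensor _ _).1 scaleN1r [- _ + _]addrC.
have split_tens (k : homC3 X Y) :
    tensM k h = homM (tensM (hom1 Y) h) (tensM k (hom1 X')).
  by rewrite -tensMM hom1M homM1.
by move=> fg; rewrite (split_tens f) (split_tens g); apply: ver_compl fg.
Qed.

Lemma ver_tensr X X' Y Y' (h : homC3 X Y) (f g : homC3 X' Y') :
  (f =v g) -> (tensM h f =v tensM h g).
Proof.
move=> fg.
have {fg} : tensM (hom1 X) f =v tensM (hom1 X) g.
  apply: (@negligible_map _ _ _ (tensR X X') (tensR X Y')
    (fun k => tmap \1%VF k) _ _ (homB f g)) fg => [a k l|k|].
  - apply: tens_ext => x y; rewrite add_lfunE scale_lfunE !tmapE.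
    by rewrite add_lfunE scale_lfunE; apply: (bilin_tensor _ _).2.
  - by rewrite /= !tmap_comp !comp_lfun1l !comp_lfun1r !comp_lfunA.
  apply: tens_ext => x y; rewrite !(tmapE, add_lfunE, opp_lfunE).
  by rewrite -scaleN1r addrC -(bilin_tensor _ _).2 scaleN1r [- _ + _]addrC.
have split_tens (k : homC3 X' Y') :
    tensM h k = homM (tensM h (hom1 Y')) (tensM (hom1 X) k).
  by rewrite -tensMM hom1M homM1.
by move=> fg; rewrite (split_tens f) (split_tens g); apply: ver_compl fg.
Qed.

Lemma ver_tens X X' Y Y' (f f' : homC3 X Y) (g g' : homC3 X' Y') :
  (f =v f') -> (g =v g') -> (tensM f g =v tensM f' g').
Proof.
by move=> ff' gg'; apply: ver_trans (ver_tensl _ ff') (ver_tensr _ gg').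
Qed.

Lemma ver_subr X Y (f f' g g' : homC3 X Y) :
  (f =v f') -> (g =v g') -> (homB f g =v homB f' g').
Proof.
move=> /ver_eqP ff' /ver_eqP gg'; apply/ver_eqP => h.
by rewrite /= !comp_lfunDl !comp_lfunNl !ltraceB ff' gg'.
Qed.

Lemma negligible_ver X Y (f g : homC3 X Y) :
  (f =v g) -> negligible f -> negligible g.
Proof. by move=> /ver_eqP fg f0 h; rewrite /= -fg (f0 h). Qed.

(** Since x is fixed and l invariant, y |-> l(y) x is equivariant, hence a legitimate test map, and
    its trace against f is l(f x). *)
Lemma negligible_fixed X Y (f : homC3 X Y) (x : X) (l : 'Hom(Y, F^o)) :
  negligible f -> gact X x = x -> (l \o gact Y = l)%VF -> l (f x) = 0.
Proof.
move=> f0 xE lE; have gE : (rank1 l x \o gact Y = gact X \o rank1 l x)%VF.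
  by apply/lfunP => y; rewrite !comp_lfunE !rank1E linearZ /= xE -comp_lfunE lE.
by have := f0 (HomC3 gE); rewrite /= comp_rank1 ltrace_rank1.
Qed.

Hypothesis char3 : 3%N \in [pchar F].

Lemma two_eqN1 : 2%:R = -1 :> F.
Proof.
by apply/eqP; rewrite -subr_eq0 opprK -(natrD _ 2 1); apply/eqP/(pcharf0 char3).
Qed.

Lemma three_eq0 : 3%:R = 0 :> F.
Proof. exact: (pcharf0 char3). Qed.

(* The equivariant test map [y |-> l y (n x) + l (n y) x], with n = sigma - 1,
   pairs with [f] to 2 l (f (n x)). *)
Lemma negligible_jordan2 X Y (f : homC3 X Y) (x : X) (l : 'Hom(Y, F^o)) :
  let n Z : 'End(Z) := gact Z - \1%VF in
  negligible f -> n X (n X x) = 0 -> (l \o n Y \o n Y = 0)%VF ->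
  l (f (n X x)) = 0.
Proof.
move=> n f0 nx ln.
have nE Z (z : rep_car Z) : n Z z = gact Z z - z.
  by rewrite add_lfunE opp_lfunE id_lfunE.
pose g := rank1 l (n X x) + rank1 (l \o n Y) x.
have gE : (g \o gact Y = gact X \o g)%VF.
  have gn : (g \o n Y = n X \o g)%VF.
    have gy y : g y = l y *: n X x + l (n Y y) *: x.
      by rewrite add_lfunE !rank1E comp_lfunE.
    apply/lfunP => y; rewrite !comp_lfunE !gy linearD !linearZ /= nx scaler0.
    by rewrite -!comp_lfunE ln zero_lfunE scale0r addr0 add0r.
  apply/lfunP => y; have /lfunP/(_ y) := gn.
  by rewrite !comp_lfunE !nE linearB => /addIr.
have := f0 (HomC3 gE); rewrite /= comp_lfunDr ltraceD !comp_rank1 !ltrace_rank1.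
have -> : (l \o n Y)%VF (f x) = l (f (n X x)).
  by rewrite comp_lfunE !nE -homC3E -linearB.
rewrite -mulr2n -mulr_natr two_eqN1 mulrN1 => /eqP.
by rewrite oppr_eq0 => /eqP.
Qed.

(* Such an f is a sum over C_3 of conjugates of t, so that its trace against
   any morphism is divisible by 3. *)
Lemma negligible_rel_trace X Y (f : homC3 X Y) (t : 'Hom(X, Y)) :
  (f = t + (gact Y \o t \o gact X \o gact X) + (gact Y \o gact Y \o t \o gact X)
     :> 'Hom(X, Y))%VF ->
  negligible f.
Proof.
move=> fE g; rewrite /= fE !comp_lfunDl !ltraceD.
have -> : ltrace (gact Y \o t \o gact X \o gact X \o g)%VF = ltrace (t \o g)%VF.
  rewrite -!comp_lfunA ltraceC; apply: (congr1 (@ltrace _ _)); apply/lfunP => y.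
  by rewrite !comp_lfunE -!homC3E gactK.
have -> : ltrace (gact Y \o gact Y \o t \o gact X \o g)%VF = ltrace (t \o g)%VF.
  rewrite -!comp_lfunA comp_lfunA ltraceC; apply: (congr1 (@ltrace _ _)).
  apply/lfunP => y.
  by rewrite !comp_lfunE -!homC3E gactK.
by rewrite -mulr2n -mulrSr -mulr_natr three_eq0 mulr0.
Qed.

Lemma negligible_cube0 X Y (f : homC3 X Y) :
  (forall (g : homC3 Y X) x, f (g (f (g (f x)))) = 0) -> negligible f.
Proof.
move=> f0 g; apply: ltrace_cube0; apply/lfunP => y.
by rewrite !comp_lfunE f0 zero_lfunE.
Qed.

End VerEq.

(** * Linearity rules for tensors and direct sums *)

Section Linear.
Variable F : fieldType.
Implicit Types U V : vectType F.

(* Specializations of [linearD], ... whose right-hand sides display the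
   application of the linear map without simplification. *)
Lemma lfunD U V (f : 'Hom(U, V)) x y : f (x + y) = f x + f y.
Proof. exact: linearD. Qed.

Lemma lfunB U V (f : 'Hom(U, V)) x y : f (x - y) = f x - f y.
Proof. exact: linearB. Qed.

Lemma lfunN U V (f : 'Hom(U, V)) x : f (- x) = - f x.
Proof. exact: linearN. Qed.

Lemma lfunZ U V (f : 'Hom(U, V)) a x : f (a *: x) = a *: f x.
Proof. exact: linearZ. Qed.

Lemma lfun0 U V (f : 'Hom(U, V)) : f 0 = 0.
Proof. exact: linear0. Qed.

Lemma tensor_linl U V (y : V) : linear (@tensor F U V ^~ y).
Proof. exact: (bilin_tensor _ _).1. Qed.

Lemma tensor_linr U V (x : U) : linear (@tensor F U V x).
Proof. exact: (bilin_tensor _ _).2. Qed.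

Lemma tensor0l U V (y : V) : tensor (0 : U) y = 0.
Proof. by rewrite -(linfunE (tensor_linl y)) linear0. Qed.

Lemma tensor0r U V (x : U) : tensor x (0 : V) = 0.
Proof. by rewrite -(linfunE (tensor_linr x)) linear0. Qed.

Lemma tensorDl U V (x x' : U) (y : V) :
  tensor (x + x') y = tensor x y + tensor x' y.
Proof. by rewrite -!(linfunE (tensor_linl y)) linearD. Qed.

Lemma tensorDr U V (x : U) (y y' : V) :
  tensor x (y + y') = tensor x y + tensor x y'.
Proof. by rewrite -!(linfunE (tensor_linr x)) linearD. Qed.

Lemma tensorZl U V a (x : U) (y : V) : tensor (a *: x) y = a *: tensor x y.
Proof. by rewrite -!(linfunE (tensor_linl y)) linearZ. Qed.

Lemma tensorZr U V a (x : U) (y : V) : tensor x (a *: y) = a *: tensor x y.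
Proof. by rewrite -!(linfunE (tensor_linr x)) linearZ. Qed.

Lemma tensorNl U V (x : U) (y : V) : tensor (- x) y = - tensor x y.
Proof. by rewrite -!scaleN1r tensorZl. Qed.

Lemma bilin0l U V (W : vectType F) (f : U -> V -> W) y :
  bilin f -> f 0 y = 0.
Proof. by move=> [fl _]; rewrite -(linfunE (fl y)) lfun0. Qed.

Lemma bilin0r U V (W : vectType F) (f : U -> V -> W) x :
  bilin f -> f x 0 = 0.
Proof. by move=> [_ fr]; rewrite -(linfunE (fr x)) lfun0. Qed.

Lemma dsum_ext U V (W : vectType F) (f g : 'Hom(dsum U V, W)) :
  (forall x, f (x, 0) = g (x, 0)) -> (forall y, f (0, y) = g (0, y)) -> f = g.
Proof.
move=> fg1 fg2; apply/lfunP => -[x y].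
have -> : ((x, y) : dsum U V) = (x, 0) + (0, y).
  by congr (_, _); rewrite /= ?addr0 ?add0r.
by rewrite !lfunD fg1 fg2.
Qed.

Lemma pair0_linearl U V : linear (fun x => (x, 0) : dsum U V).
Proof. by move=> a x y; congr (_, _); rewrite /= scaler0 addr0. Qed.

Lemma pair0_linearr U V : linear (fun y => (0, y) : dsum U V).
Proof. by move=> a x y; congr (_, _); rewrite /= scaler0 addr0. Qed.

End Linear.

(** * The functor F is fully faithful modulo negligible morphisms *)

Section FunctorF.
Variable F : fieldType.
Hypothesis char3 : 3%N \in [pchar F].
Implicit Types (X Y Z : svect F) (U : vectType F).

Local Notation V1 := (V1 char3).
Local Notation Fobj := (Fobj char3).
Local Notation Fmor := (Fmor char3).

Definition v0 : V1 := ((1, 0) : dsum F^o F^o).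
Definition v1 : V1 := ((0, 1) : dsum F^o F^o).

Lemma V1_decomp (v : V1) : v = v.1 *: v0 + v.2 *: v1.
Proof.
by case: v => a c; congr (_, _); rewrite /= !scaler0 ?addr0 ?add0r [RHS]mulr1.
Qed.

Lemma gact_v0 : gact V1 v0 = v0 + v1.
Proof. by rewrite V1_gactE; congr (_, _); rewrite /= ?addr0 ?add0r. Qed.

Lemma gact_v1 : gact V1 v1 = v1.
Proof. by rewrite V1_gactE; congr (_, _); rewrite /= ?addr0 ?add0r. Qed.

(* [Fe x] and [Fo x v] are the elements x and x (x) v of F(X). *)
Definition Fe X (x : ev X) : Fobj X := (x, 0).
Definition Fo X (x : od X) (v : V1) : Fobj X := (0, tensor x v).

Lemma Fe_linear X : linear (@Fe X).
Proof. by move=> a x y; congr (_, _); rewrite /= scaler0 addr0. Qed.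

Lemma Fo_bilin X : bilin (@Fo X).
Proof.
by split=> [v|x] a y y'; congr (_, _);
  rewrite /= ?scaler0 ?addr0 ?tensor_linl ?tensor_linr.
Qed.

Lemma FeZ X a (x : ev X) : Fe (a *: x) = a *: Fe x.
Proof. by rewrite -!(linfunE (@Fe_linear X)) linearZ. Qed.

Lemma Fe0 X : Fe (0 : ev X) = 0.
Proof. by []. Qed.

Lemma FoDr X (x : od X) u v : Fo x (u + v) = Fo x u + Fo x v.
Proof. by rewrite -!(linfunE ((@Fo_bilin X).2 x)) linearD. Qed.

Lemma FoZr X (x : od X) a v : Fo x (a *: v) = a *: Fo x v.
Proof. by rewrite -!(linfunE ((@Fo_bilin X).2 x)) linearZ. Qed.

Lemma FoZl X (x : od X) a v : Fo (a *: x) v = a *: Fo x v.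
Proof. by rewrite -!(linfunE ((@Fo_bilin X).1 v)) linearZ. Qed.

Lemma Fo0l X v : Fo (0 : od X) v = 0.
Proof. by rewrite /Fo tensor0l. Qed.

Lemma gact_Fe X (x : ev X) : gact (Fobj X) (Fe x) = Fe x.
Proof. by rewrite /= pmapE /= id_lfunE linear0. Qed.

Lemma gact_Fo X (x : od X) v : gact (Fobj X) (Fo x v) = Fo x (gact V1 v).
Proof. by rewrite /= pmapE /= tmapE !id_lfunE. Qed.

Lemma Fmor_Fe X Y (f : shom X Y) x : Fmor f (Fe x) = Fe (hev f x).
Proof. by rewrite /= pmapE /= linear0. Qed.

Lemma Fmor_Fo X Y (f : shom X Y) x v : Fmor f (Fo x v) = Fo (hod f x) v.
Proof. by rewrite /= pmapE /= tmapE linear0 id_lfunE. Qed.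

Lemma F_ext X U (f g : 'Hom(Fobj X, U)) :
  (forall x, f (Fe x) = g (Fe x)) -> (forall x v, f (Fo x v) = g (Fo x v)) ->
  f = g.
Proof.
move=> fge fgo; apply/lfunP => -[x t].
have -> : ((x, t) : Fobj X) = Fe x + (0, t).
  by congr (_, _); rewrite /= ?addr0 ?add0r.
rewrite !linearD /= fge; congr (_ + _); move: t.
pose io (t : tens (od X) V1) : Fobj X := (0, t).
have iol : linear io by move=> a u v; congr (_, _); rewrite /= scaler0 addr0.
suff H : (f \o linfun io = g \o linfun io)%VF.
  by move=> t; have /lfunP/(_ t) := H; rewrite !comp_lfunE linfunE.
by apply: tens_ext => y v; rewrite !comp_lfunE linfunE // fgo.
Qed.

(* The coordinate in X_1 along [v0] or [v1]. *)
Definition Fc X (i : bool) : 'Hom(Fobj X, od X) :=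
  linfun (fun z : Fobj X =>
    tlift (fun y (v : V1) => (if i then v.2 else v.1) *: y) z.2).

Lemma FcE X i z :
  @Fc X i z = tlift (fun y (v : V1) => (if i then v.2 else v.1) *: y) z.2.
Proof. by rewrite linfunE // => a u v; rewrite linearP. Qed.

Lemma Fc_Fe X i x : @Fc X i (Fe x) = 0.
Proof. by rewrite FcE linear0. Qed.

Lemma Fc_Fo X i x v : @Fc X i (Fo x v) = (if i then v.2 else v.1) *: x.
Proof.
rewrite FcE tliftE //; split=> [u a y y'|y a u u'].
  by rewrite scalerDr !scalerA mulrC.
by case: i; rewrite scalerDl scalerA.
Qed.

Lemma F_decomp X (z : Fobj X) :
  z = Fe z.1 + Fo (Fc X false z) v0 + Fo (Fc X true z) v1.
Proof.
pose d (z : Fobj X) := Fe z.1 + Fo (Fc X false z) v0 + Fo (Fc X true z) v1.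
have dl : linear d.
  move=> a u v; rewrite /d !linearP Fe_linear !(Fo_bilin X).1.
  by rewrite !scalerDr (AC (2*2*2) ((1*3*5)*(2*4*6))).
rewrite -[LHS]id_lfunE -[RHS]/(d z) -(linfunE dl); congr (fun_of_lfun _ z).
apply: F_ext => [x|x v]; rewrite id_lfunE linfunE // /d.
  by rewrite !Fc_Fe !Fo0l !addr0.
by rewrite !Fc_Fo Fe0 add0r !FoZl -!FoZr -FoDr -V1_decomp.
Qed.

Lemma Fo_v1 X (x : od X) : Fo x v1 = gact (Fobj X) (Fo x v0) - Fo x v0.
Proof. by rewrite gact_Fo gact_v0 FoDr addrC addKr. Qed.

(** The operator sigma - 1 sends v_0 to v_1 and kills v_1 and the even part. Hence a vector is fixed
    exactly when its v_0-coordinate vanishes, which is how equivariance is exploited below. *)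
Lemma gact_F X (z : Fobj X) :
  gact (Fobj X) z = z + Fo (Fc X false z) v1.
Proof.
rewrite {1}(F_decomp z) !lfunD gact_Fe !gact_Fo gact_v0 gact_v1 FoDr.
by rewrite addrA [LHS]addrAC -F_decomp.
Qed.

Section FullyFaithful.
Variables X Y : svect F.
Implicit Types f : homC3 (Fobj X) (Fobj Y).

(* By equivariance the odd part can be read off on the fixed vectors
   x (x) v_1, or as the coefficient of v_0 in the image of x (x) v_0. *)
Definition ev_part f : 'Hom(ev X, ev Y) :=
  linfun (fun x => (f (Fe x)).1).

Definition od_part f : 'Hom(od X, od Y) :=
  linfun (fun x => Fc Y true (f (Fo x v1))).

Lemma ev_partE f x : ev_part f x = (f (Fe x)).1.
Proof. by rewrite linfunE // => a u v; rewrite Fe_linear linearP. Qed.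

Lemma od_partE f x : od_part f x = Fc Y true (f (Fo x v1)).
Proof. by rewrite linfunE // => a u v; rewrite (Fo_bilin X).1 !linearP. Qed.

Lemma hom_Fe f x : Fc Y false (f (Fe x)) = 0.
Proof.
have := gact_F (f (Fe x)); rewrite -homC3E gact_Fe -[LHS]addr0 => /addrI.
move=> /(congr1 (Fc Y true)); rewrite lfun0 Fc_Fo scale1r.
by move=> <-.
Qed.

Lemma hom_Fo_v1 f x : f (Fo x v1) = Fo (Fc Y false (f (Fo x v0))) v1.
Proof. by rewrite Fo_v1 lfunB homC3E gact_F addrC addKr. Qed.

Lemma od_part_v0 f x : od_part f x = Fc Y false (f (Fo x v0)).
Proof. by rewrite od_partE hom_Fo_v1 Fc_Fo scale1r. Qed.

Lemma hom_Fo_v1E f x : f (Fo x v1) = Fo (od_part f x) v1.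
Proof. by rewrite od_part_v0 -hom_Fo_v1. Qed.

Lemma ev_part_Fmor (h : shom X Y) : ev_part (Fmor h) = hev h.
Proof. by apply/lfunP => x; rewrite ev_partE Fmor_Fe. Qed.

Lemma od_part_Fmor (h : shom X Y) : od_part (Fmor h) = hod h.
Proof. by apply/lfunP => x; rewrite od_partE Fmor_Fo Fc_Fo scale1r. Qed.

End FullyFaithful.

Lemma parts_eq0_negligible X Y (f : homC3 (Fobj X) (Fobj Y)) :
  ev_part f = 0 -> od_part f = 0 -> negligible f.
Proof.
move=> e0 o0.
have fv1 x : f (Fo x v1) = 0 by rewrite hom_Fo_v1E o0 zero_lfunE Fo0l.
have fe x : f (Fe x) = Fo (Fc Y true (f (Fe x))) v1.
  rewrite {1}(F_decomp (f (Fe x))) hom_Fe -ev_partE e0 zero_lfunE Fe0 Fo0l.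
  by rewrite !add0r.
have fv0 x : Fc Y false (f (Fo x v0)) = 0.
  by rewrite -od_part_v0 o0 zero_lfunE.
have fker z : Fc Y false (f z) = 0.
  rewrite (F_decomp z) !lfunD hom_Fe fv0 fv1 lfun0 !addr0 //.
have fker2 z : Fc X false z = 0 -> exists y, f z = Fo y v1.
  move=> z0; exists (Fc Y true (f (Fe z.1))).
  by rewrite [in LHS](F_decomp z) !lfunD z0 Fo0l lfun0 fv1 !addr0.
have gker (g : homC3 (Fobj Y) (Fobj X)) z : 
    Fc Y false z = 0 -> Fc X false (g z) = 0.
  move=> z0; rewrite (F_decomp z) z0 Fo0l addr0 !lfunD hom_Fe add0r.
  by rewrite hom_Fo_v1 Fc_Fo scale0r.
(* [f] maps F(X) to the kernel of sigma - 1, that kernel to the image of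
   sigma - 1, and that image to 0; any [g] preserves these subspaces. *)
apply: negligible_cube0 => g x.
have [y ->] := fker2 _ (gker g _ (fker x)).
by rewrite hom_Fo_v1 fv1.
Qed.

(** Faithfulness of F. The even part is detected by an invariant functional on a fixed vector; the
    odd part by the Jordan block spanned by x (x) v_0 and x (x) v_1, whose length 2 is nonzero in
    characteristic 3. *)
Lemma negligible_parts X Y (f : homC3 (Fobj X) (Fobj Y)) :
  negligible f -> ev_part f = 0 /\ od_part f = 0.
Proof.
have nE Z z : (gact (Fobj Z) - \1)%VF z = Fo (Fc Z false z) v1.
  by rewrite add_lfunE opp_lfunE id_lfunE gact_F addrC addKr.
move=> f0; split; apply/lfunP => x; rewrite zero_lfunE.
  rewrite ev_partE; apply: functional_eq0 => l.
  pose l' := (l \o linfun (fst : Fobj Y -> ev Y))%VF.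
  have l'E z : l' z = l z.1 by rewrite comp_lfunE linfunE.
  rewrite -l'E; apply: negligible_fixed f0 _ _; first exact: gact_Fe.
  by apply/lfunP => z; rewrite comp_lfunE !l'E gact_F /= addr0.
rewrite od_partE; apply: functional_eq0 => l.
have -> : Fo x v1 = (gact (Fobj X) - \1)%VF (Fo x v0).
  by rewrite nE Fc_Fo scale1r.
rewrite -comp_lfunE; apply: (negligible_jordan2 char3) f0 _ _.
  by rewrite !nE !Fc_Fo scale0r Fo0l.
apply/lfunP => z; rewrite !comp_lfunE !nE !Fc_Fo scale0r scaler0.
by rewrite lfun0 zero_lfunE.
Qed.

(** Taking parts is additive and inverts [Fmor], so the difference of the two sides has zero parts
    and is negligible. *)
Lemma F_full X Y (f : homC3 (Fobj X) (Fobj Y)) :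
  f =v Fmor (SHom (ev_part f) (od_part f)).
Proof.
have parts_sub (g h : homC3 (Fobj X) (Fobj Y)) :
    ev_part (homB g h) = ev_part g - ev_part h /\
    od_part (homB g h) = od_part g - od_part h.
  split; apply/lfunP => x; rewrite !(add_lfunE, opp_lfunE) ?ev_partE ?od_partE.
    by rewrite add_lfunE opp_lfunE.
  by rewrite add_lfunE opp_lfunE lfunB.
apply: parts_eq0_negligible; rewrite ?(parts_sub _ _).1 ?(parts_sub _ _).2.
  by rewrite ev_part_Fmor subrr.
by rewrite od_part_Fmor subrr.
Qed.

Lemma ver_parts X Y (f g : homC3 (Fobj X) (Fobj Y)) :
  (f =v g) -> ev_part f = ev_part g /\ od_part f = od_part g.
Proof.
move=> /negligible_parts [e0 o0]; split; apply/lfunP => x; apply/eqP.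
  have /lfunP/(_ x) := e0; rewrite -subr_eq0 zero_lfunE !ev_partE => <-.
  by rewrite add_lfunE opp_lfunE.
have /lfunP/(_ x) := o0; rewrite -subr_eq0 zero_lfunE !od_partE => <-.
by rewrite add_lfunE opp_lfunE lfunB.
Qed.

(** A test map from the unit has fixed values, whose odd components lie along v_1. Now x (x) v_1 is
    (sigma - 1)(x (x) v_0), so an invariant functional kills it. *)
Lemma F_to_unit_negligible X (f : homC3 (Fobj X) (unitR F)) :
  (forall x, f (Fe x) = 0) -> negligible f.
Proof.
move=> f0 g; have fg : (f \o g = 0)%VF.
  apply/lfunP => a; rewrite comp_lfunE zero_lfunE.
  have : gact (Fobj X) (g a) = g a by rewrite -homC3E id_lfunE.
  rewrite gact_F -[RHS]addr0 => /addrI/(congr1 (Fc X true)).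
  rewrite lfun0 Fc_Fo scale1r => ga.
  rewrite (F_decomp (g a)) ga Fo0l addr0 lfunD f0 add0r.
  by rewrite Fo_v1 lfunB homC3E id_lfunE subrr.
by rewrite /= fg ltrace0.
Qed.

Lemma negligible_F_to_unit X (f : homC3 (Fobj X) (unitR F)) :
  negligible f -> forall x, f (Fe x) = 0.
Proof.
move=> f0 x; apply: functional_eq0 => l; apply: negligible_fixed f0 _ _.
  exact: gact_Fe.
by rewrite comp_lfun1r.
Qed.

End FunctorF.

(** * The monoidal structure of F *)

Section Monoidal.
Variable F : fieldType.
Hypothesis char3 : 3%N \in [pchar F].
Implicit Types (X Y Z : svect F) (U : vectType F).

Local Notation Fobj := (Fobj char3).
Local Notation J := (J char3).
Local Notation v0 := (v0 char3).
Local Notation v1 := (v1 char3).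

(* The pure tensors in the four summands of [stens X Y]. *)
Definition tee X Y (x : ev X) (y : ev Y) : ev (stens X Y) := (tensor x y, 0).
Definition too X Y (x : od X) (y : od Y) : ev (stens X Y) := (0, tensor x y).
Definition teo X Y (x : ev X) (y : od Y) : od (stens X Y) := (tensor x y, 0).
Definition toe X Y (x : od X) (y : ev Y) : od (stens X Y) := (0, tensor x y).

Lemma stens_ev_ext X Y U (f g : 'Hom(ev (stens X Y), U)) :
  (forall x y, f (tee x y) = g (tee x y)) ->
  (forall x y, f (too x y) = g (too x y)) -> f = g.
Proof.
move=> fgee fgoo; apply: dsum_ext; apply: tens_ind => [a s t|a s t|//];
  by rewrite ?pair0_linearl ?pair0_linearr linearP.
Qed.

Lemma stens_od_ext X Y U (f g : 'Hom(od (stens X Y), U)) :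
  (forall x y, f (teo x y) = g (teo x y)) ->
  (forall x y, f (toe x y) = g (toe x y)) -> f = g.
Proof.
move=> fgeo fgoe; apply: dsum_ext; apply: tens_ind => [a s t|a s t|//];
  by rewrite ?pair0_linearl ?pair0_linearr linearP.
Qed.

Lemma F_stens_ext X Y U (f g : 'Hom(Fobj (stens X Y), U)) :
  (forall x y, f (Fe char3 (tee x y)) = g (Fe char3 (tee x y))) ->
  (forall x y, f (Fe char3 (too x y)) = g (Fe char3 (too x y))) ->
  (forall x y v, f (Fo (teo x y) v) = g (Fo (teo x y) v)) ->
  (forall x y v, f (Fo (toe x y) v) = g (Fo (toe x y) v)) -> f = g.
Proof.
move=> fgee fgoo fgeo fgoe; apply: F_ext => [x|x v].
  pose e := linfun (@Fe F char3 (stens X Y)).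
  have eE t : e t = Fe char3 t by rewrite linfunE //; apply: Fe_linear.
  rewrite -eE -!comp_lfunE; congr (fun_of_lfun _ x).
  by apply: stens_ev_ext => y z; rewrite !comp_lfunE eE.
pose e := linfun (@Fo F char3 (stens X Y) ^~ v).
have eE t : e t = Fo t v.
  by rewrite linfunE //; apply: (Fo_bilin char3 (stens X Y)).1.
rewrite -eE -!comp_lfunE; congr (fun_of_lfun _ x).
by apply: stens_od_ext => y z; rewrite !comp_lfunE eE.
Qed.

Lemma J_ee X Y (x : ev X) (y : ev Y) :
  J X Y (tensor (Fe char3 x) (Fe char3 y)) = Fe char3 (tee x y).
Proof.
rewrite /= J_lfunE /J_fun /= (bilin0l _ (J_oo_bilin _ _ _)).
by rewrite (bilin0r _ (J_eo_bilin _ _ _)) (bilin0l _ (J_oe_bilin _ _ _)) addr0.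
Qed.

Lemma J_eo X Y (x : ev X) (y : od Y) v :
  J X Y (tensor (Fe char3 x) (Fo y v)) = Fo (teo x y) v.
Proof.
rewrite /= J_lfunE /J_fun /= (bilin0l _ (J_oo_bilin _ _ _)) tensor0r.
by rewrite (bilin0l _ (J_oe_bilin _ _ _)) addr0 J_eoE.
Qed.

Lemma J_oe X Y (x : od X) (y : ev Y) u :
  J X Y (tensor (Fo x u) (Fe char3 y)) = Fo (toe x y) u.
Proof.
rewrite /= J_lfunE /J_fun /= (bilin0r _ (J_oo_bilin _ _ _)) tensor0l.
by rewrite (bilin0r _ (J_eo_bilin _ _ _)) add0r J_oeE.
Qed.

Lemma J_oo X Y (x : od X) (y : od Y) u v :
  J X Y (tensor (Fo x u) (Fo y v)) = lam u v *: Fe char3 (too x y).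
Proof.
rewrite /= J_lfunE /J_fun /= J_ooE tensor0l (bilin0l _ (J_eo_bilin _ _ _)).
rewrite (bilin0r _ (J_oe_bilin _ _ _)) addr0.
by congr ((_, _), _); rewrite /= scaler0.
Qed.

Definition Ji_fun X Y (z : Fobj (stens X Y)) : tens (Fobj X) (Fobj Y) :=
  tlift (fun x y => tensor (Fe char3 x) (Fe char3 y)) z.1.1
  + tlift (fun x y => tensor (Fo x v1) (Fo y v0)
                      - tensor (Fo x v0) (Fo y v1)) z.1.2
  + tlift (fun (d : od (stens X Y)) v =>
      tlift (fun x y => tensor (Fe char3 x) (Fo y v)) d.1
      + tlift (fun x y => tensor (Fo x v) (Fe char3 y)) d.2) z.2.

Lemma Ji_linear X Y : linear (@Ji_fun X Y).
Proof.
move=> a z z'; rewrite /Ji_fun !linearP !scalerDr /=.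
by rewrite (AC (2*2*2) ((1*3*5)*(2*4*6))).
Qed.

Definition Ji_lfun X Y : 'Hom(Fobj (stens X Y), tens (Fobj X) (Fobj Y)) :=
  linfun (@Ji_fun X Y).

Lemma Ji_lee X Y (x : ev X) (y : ev Y) :
  Ji_lfun X Y (Fe char3 (tee x y)) = tensor (Fe char3 x) (Fe char3 y).
Proof.
rewrite linfunE; last exact: Ji_linear.
rewrite /Ji_fun /= !lfun0 !addr0 tliftE //.
by split=> [z a u v|z a u v]; rewrite Fe_linear ?tensor_linl ?tensor_linr.
Qed.

Lemma Ji_loo X Y (x : od X) (y : od Y) :
  Ji_lfun X Y (Fe char3 (too x y)) =
  tensor (Fo x v1) (Fo y v0) - tensor (Fo x v0) (Fo y v1).
Proof.
rewrite linfunE; last exact: Ji_linear.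
rewrite /Ji_fun /= !lfun0 addr0 add0r tliftE //.
split=> [z a u v|z a u v].
  rewrite !(Fo_bilin _ _).1 !tensor_linl scalerBr opprD.
  by rewrite addrACA.
rewrite !(Fo_bilin _ _).1 !tensor_linr scalerBr opprD.
by rewrite addrACA.
Qed.

Lemma Ji_lo X Y (d : od (stens X Y)) v :
  Ji_lfun X Y (Fo d v) =
  tlift (fun x y => tensor (Fe char3 x) (Fo y v)) d.1
  + tlift (fun x y => tensor (Fo x v) (Fe char3 y)) d.2.
Proof.
rewrite linfunE; last exact: Ji_linear.
rewrite /Ji_fun /= !lfun0 !add0r tliftE //.
split=> [u a z z'|[z1 z2] a u u'].
  by rewrite !linearP /= scalerDr addrACA.
rewrite scalerDr addrACA /=; congr (_ + _).
  apply: tlift_lincomb => x y.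
  by rewrite (Fo_bilin _ _).2 tensor_linr.
apply: tlift_lincomb => x y.
by rewrite (Fo_bilin _ _).2 tensor_linl.
Qed.

Lemma Ji_leo X Y (x : ev X) (y : od Y) v :
  Ji_lfun X Y (Fo (teo x y) v) = tensor (Fe char3 x) (Fo y v).
Proof.
rewrite Ji_lo /= lfun0 addr0 tliftE //; split=> [z a u u'|z a u u'].
  by rewrite Fe_linear tensor_linl.
by rewrite (Fo_bilin _ _).1 tensor_linr.
Qed.

Lemma Ji_loe X Y (x : od X) (y : ev Y) v :
  Ji_lfun X Y (Fo (toe x y) v) = tensor (Fo x v) (Fe char3 y).
Proof.
rewrite Ji_lo /= lfun0 add0r tliftE //; split=> [z a u u'|z a u u'].
  by rewrite (Fo_bilin _ _).1 tensor_linl.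
by rewrite Fe_linear tensor_linr.
Qed.

Lemma Ji_subproof X Y :
  (Ji_lfun X Y \o gact (Fobj (stens X Y))
   = gact (tensR (Fobj X) (Fobj Y)) \o Ji_lfun X Y)%VF.
Proof.
apply: F_stens_ext => [x y|x y|x y v|x y v]; rewrite !comp_lfunE.
- by rewrite gact_Fe Ji_lee tmapE !gact_Fe.
(* Invariance of v_1 (x) v_0 - v_0 (x) v_1: applying sigma adds v_1 (x) v_1 to both tensors, and
   these cancel. *)
- rewrite gact_Fe Ji_loo lfunB !tmapE !gact_Fo gact_v0 gact_v1 !FoDr.
  rewrite tensorDl tensorDr opprD.
  by rewrite [RHS]addrACA subrr addr0.
- by rewrite gact_Fo !Ji_leo tmapE gact_Fe gact_Fo.
by rewrite gact_Fo !Ji_loe tmapE gact_Fe gact_Fo.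
Qed.

(* The section of J given by v_1 (x) v_0 - v_0 (x) v_1, on which lambda takes
   the value -2 = 1. *)
Definition Ji X Y : homC3 (Fobj (stens X Y)) (tensR (Fobj X) (Fobj Y)) :=
  @HomC3 _ (Fobj (stens X Y)) (tensR (Fobj X) (Fobj Y)) _ (Ji_subproof X Y).

Lemma Ji_ee X Y (x : ev X) (y : ev Y) :
  Ji X Y (Fe char3 (tee x y)) = tensor (Fe char3 x) (Fe char3 y).
Proof. exact: Ji_lee. Qed.

Lemma Ji_oo X Y (x : od X) (y : od Y) :
  Ji X Y (Fe char3 (too x y)) =
  tensor (Fo x v1) (Fo y v0) - tensor (Fo x v0) (Fo y v1).
Proof. exact: Ji_loo. Qed.

Lemma Ji_eo X Y (x : ev X) (y : od Y) v :
  Ji X Y (Fo (teo x y) v) = tensor (Fe char3 x) (Fo y v).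
Proof. exact: Ji_leo. Qed.

Lemma Ji_oe X Y (x : od X) (y : ev Y) v :
  Ji X Y (Fo (toe x y) v) = tensor (Fo x v) (Fe char3 y).
Proof. exact: Ji_loe. Qed.

Lemma lam00 : lam v0 v0 = 0. Proof. by rewrite /lam /=; ring. Qed.
Lemma lam11 : lam v1 v1 = 0. Proof. by rewrite /lam /=; ring. Qed.
Lemma lam01 : lam v0 v1 = 1. Proof. by rewrite /lam /=; ring. Qed.
Lemma lam10 : lam v1 v0 = -1. Proof. by rewrite /lam /=; ring. Qed.

Lemma JJi X Y : homM (J X Y) (Ji X Y) = hom1 _.
Proof.
apply: homC3P => z; congr (fun_of_lfun _ z).
apply: F_stens_ext => [x y|x y|x y v|x y v]; rewrite [LHS]homME [RHS]hom1E.
- by rewrite Ji_ee J_ee.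
- rewrite Ji_oo lfunB !J_oo lam01 lam10 -scalerBl -opprD -[1 + 1]/2%:R.
  by rewrite (two_eqN1 char3) opprK scale1r.
- by rewrite Ji_eo J_eo.
by rewrite Ji_oe J_oe.
Qed.

End Monoidal.

(** * Invertibility of J in Ver_3 *)

Section Monoidal.
Variable F : fieldType.
Hypothesis char3 : 3%N \in [pchar F].
Implicit Types (X Y Z : svect F) (U : vectType F).

Local Notation V1 := (V1 char3).
Local Notation Fobj := (Fobj char3).
Local Notation J := (J char3).
Local Notation v0 := (v0 char3).
Local Notation v1 := (v1 char3).

Local Notation Ji := (Ji char3).

Lemma FF_ext X Y U (f g : 'Hom(tensR (Fobj X) (Fobj Y), U)) :
  (forall x y, f (tensor (Fe char3 x) (Fe char3 y))
             = g (tensor (Fe char3 x) (Fe char3 y))) ->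
  (forall x y v, f (tensor (Fe char3 x) (Fo y v))
               = g (tensor (Fe char3 x) (Fo y v))) ->
  (forall x u y, f (tensor (Fo x u) (Fe char3 y))
               = g (tensor (Fo x u) (Fe char3 y))) ->
  (forall x u y v, f (tensor (Fo x u) (Fo y v))
                 = g (tensor (Fo x u) (Fo y v))) ->
  f = g.
Proof.
move=> fee feo foe foo; apply: tens_ext => z z'.
rewrite (F_decomp z) (F_decomp z') !tensorDl !tensorDr !lfunD.
by rewrite !fee !feo !foe !foo.
Qed.

Lemma JiJ X Y : homM (Ji X Y) (J X Y) =v hom1 _.
Proof.
apply: ver_sym.
(* The difference of the two sides is the projection of V_1 (x) V_1 on its free
   summand, the relative trace of u (x) v |-> l(u, v) v_0 (x) v_0, where
   l(u, v) = u_0 v_0 - u_1 v_1. *)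
pose T (x : od X) (u : V1) (y : od Y) (v : V1) := tensor (Fo x u) (Fo y v).
pose thf (z : Fobj X) (z' : Fobj Y) :=
  T (Fc char3 X false z) v0 (Fc char3 Y false z') v0
  - T (Fc char3 X true z) v0 (Fc char3 Y true z') v0.
have thB : bilin thf.
  split=> [z' a u v|z a u v]; rewrite /thf !linearP /T.
    by rewrite !(Fo_bilin _ _).1 !tensor_linl scalerBr opprD addrACA.
  by rewrite !(Fo_bilin _ _).1 !tensor_linr scalerBr opprD addrACA.
pose th := tlift thf.
have th0l x z : th (tensor (Fe char3 x) z) = 0.
  by rewrite tliftE // /thf !Fc_Fe /T !Fo0l !tensor0l subrr.
have th0r z x : th (tensor z (Fe char3 x)) = 0.
  by rewrite tliftE // /thf !Fc_Fe /T !Fo0l !tensor0r subrr.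
have thE x u y v : th (tensor (Fo x u) (Fo y v)) =
    (u.1 * v.1 - u.2 * v.2) *: T x v0 y v0.
  rewrite tliftE // /thf !Fc_Fo /T !FoZl !tensorZl !tensorZr !scalerA.
  by rewrite -scalerBl.
(* Coefficients with respect to v_i (x) v_j: the identity below reduces to four polynomial
   identities in the coordinates of u and v, valid modulo 3. *)
pose lin4 x y a b c d := a *: T x v0 y v0 + b *: T x v0 y v1
  + (c *: T x v1 y v0 + d *: T x v1 y v1).
have TE x u y v : T x u y v =
    lin4 x y (u.1 * v.1) (u.1 * v.2) (u.2 * v.1) (u.2 * v.2).
  rewrite {1}/T {1}(V1_decomp u) {1}(V1_decomp v) !FoDr !FoZr.
  by rewrite tensorDl !tensorDr !tensorZl !tensorZr !scalerA.
have lin4Z k x y a b c d :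
    k *: lin4 x y a b c d = lin4 x y (k * a) (k * b) (k * c) (k * d).
  by rewrite /lin4 !scalerDr !scalerA.
have lin4D x y a b c d a' b' c' d' :
    lin4 x y a b c d + lin4 x y a' b' c' d' =
    lin4 x y (a + a') (b + b') (c + c') (d + d').
  by rewrite /lin4 !scalerDl addrACA; congr (_ + _); apply: addrACA.
have lin4N x y a b c d :
    - lin4 x y a b c d = lin4 x y (- a) (- b) (- c) (- d).
  by rewrite /lin4 !scaleNr !opprD.
rewrite /ver_eq.
pose FF := tensR (Fobj X) (Fobj Y).
apply: (@negligible_rel_trace _ char3 FF FF _ th).
apply: FF_ext => [x y|x y v|x u y|x u y v];
  rewrite !(add_lfunE, opp_lfunE, comp_lfunE, id_lfunE) !tmapE;
  rewrite ?gact_Fe ?gact_Fo ?th0l ?th0r ?lfun0 ?addr0.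
- by rewrite J_ee Ji_ee subrr.
- by rewrite J_eo Ji_eo subrr.
- by rewrite J_oe Ji_oe subrr.
rewrite J_oo lfunZ Ji_oo !thE !lfunZ -![tensor (Fo x _) _]/(T _ _ _ _).
have gT u' v' : gact FF (T x u' y v') = T x (gact V1 u') y (gact V1 v').
  by rewrite /FF /T tmapE !gact_Fo.
have mod3 (a b c : F) : a = b + 3%:R * c -> a = b.
  by move=> ->; rewrite (three_eq0 char3) mul0r addr0.
rewrite !gT !TE !(lin4N, lin4D, lin4Z) /= !V1_gactE /lam /=.
move: u.1 u.2 v.1 v.2 => a c a' c'; congr (lin4 x y).
(* Each witness is the quotient by 3 of the difference of the two sides, computed over the
   integers. *)
- by apply: (mod3 _ _ (a * a' + c * c' + a * c' + c * a')); ring.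
- by apply: (mod3 _ _ (a * a' + 2%:R * a * c' + c * a' + c * c')); ring.
- by apply: (mod3 _ _ (a * a' + a * c' + 2%:R * c * a' + c * c')); ring.
apply: (mod3 _ _ (a * a' + 2%:R * a * c' + 2%:R * c * a' + 2%:R * c * c')).
by ring.
Qed.

End Monoidal.

(** * Internal endomorphisms and forms in Rep C_3 *)

Section RepConstructions.
Variable F : fieldType.
Implicit Types (X Y Z V : repC3 F).

Lemma homN_subproof X Y (f : homC3 X Y) :
  (- hom_fun f \o gact X = gact Y \o - hom_fun f)%VF.
Proof. by rewrite comp_lfunNl comp_lfunNr hom_eqv. Qed.
Definition homN X Y (f : homC3 X Y) : homC3 X Y := HomC3 (homN_subproof f).

Lemma homNE X Y (f : homC3 X Y) x : homN f x = - f x.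
Proof. exact: opp_lfunE. Qed.

Lemma homBE X Y (f g : homC3 X Y) x : homB f g x = f x - g x.
Proof. by rewrite /= add_lfunE opp_lfunE. Qed.

Lemma ver_homN X Y (f g : homC3 X Y) : (f =v g) -> (homN f =v homN g).
Proof.
by move=> /ver_eqP fg; apply/ver_eqP => h; rewrite /= !comp_lfunNl !ltraceN fg.
Qed.

Lemma homNK X Y (f : homC3 X Y) : homN (homN f) = f.
Proof. by apply: homC3P => x; rewrite !homNE opprK. Qed.

Lemma tens_homP X Y Z (f g : homC3 (tensR X Y) Z) :
  (forall x y, f (tensor x y) = g (tensor x y)) -> f = g.
Proof.
by move=> fg; apply: homC3P => t; congr (fun_of_lfun _ t); apply: tens_ext.
Qed.

Lemma tensM1 X Y : tensM (hom1 X) (hom1 Y) = hom1 (tensR X Y).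
Proof. by apply: tens_homP => x y; rewrite tensME !hom1E. Qed.

Lemma tensorBl (U V : vectType F) (x x' : U) (y : V) :
  tensor (x - x') y = tensor x y - tensor x' y.
Proof. by rewrite tensorDl tensorNl. Qed.

Lemma tens3_ext (U V W T : vectType F) (f g : 'Hom(tens (tens U V) W, T)) :
  (forall x y z, f (tensor (tensor x y) z) = g (tensor (tensor x y) z)) ->
  f = g.
Proof.
move=> fg; apply: tens_ext => t z; move: t.
by apply: tens_ind => [a u v|a u v|x y]; rewrite ?tensor_linl ?linearP.
Qed.

Lemma tens3_homP X Y Z T (f g : homC3 (tensR (tensR X Y) Z) T) :
  (forall x y z, f (tensor (tensor x y) z) = g (tensor (tensor x y) z)) ->
  f = g.
Proof.
by move=> fg; apply: homC3P => t; congr (fun_of_lfun _ t); apply: tens3_ext.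
Qed.

Definition asso_lfun X Y Z : 'Hom(tens (tens X Y) Z, tens X (tens Y Z)) :=
  tlift (fun t z => tlift (fun x y => tensor x (tensor y z)) t).

Lemma asso_lfunE X Y Z (x : X) (y : Y) (z : Z) :
  asso_lfun X Y Z (tensor (tensor x y) z) = tensor x (tensor y z).
Proof.
rewrite tliftE; last first.
  split=> [w a u v|t a u v]; first exact: linearP.
  by apply: tlift_lincomb => x' y'; rewrite !tensor_linr.
by rewrite tliftE //; split=> [w a u v|w a u v];
  rewrite ?tensor_linl ?tensor_linr.
Qed.

Lemma asso_subproof X Y Z :
  (asso_lfun X Y Z \o gact (tensR (tensR X Y) Z)
   = gact (tensR X (tensR Y Z)) \o asso_lfun X Y Z)%VF.
Proof.
by apply: tens3_ext => x y z; rewrite !comp_lfunE /= !(tmapE, asso_lfunE).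
Qed.
Definition asso X Y Z : homC3 (tensR (tensR X Y) Z) (tensR X (tensR Y Z)) :=
  @HomC3 _ (tensR (tensR X Y) Z) (tensR X (tensR Y Z)) _ (asso_subproof X Y Z).

Lemma assoE X Y Z (x : X) (y : Y) (z : Z) :
  asso X Y Z (tensor (tensor x y) z) = tensor x (tensor y z).
Proof. exact: asso_lfunE. Qed.

Definition swap_lfun (U V : vectType F) : 'Hom(tens U V, tens V U) :=
  tlift (fun x y => tensor y x).

Lemma swap_lfunE (U V : vectType F) (x : U) (y : V) :
  swap_lfun U V (tensor x y) = tensor y x.
Proof.
by rewrite tliftE //; split=> [z a u v|z a u v];
  rewrite ?tensor_linl ?tensor_linr.
Qed.

Lemma swap_subproof X Y :
  (swap_lfun X Y \o gact (tensR X Y) = gact (tensR Y X) \o swap_lfun X Y)%VF.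
Proof.
by apply: tens_ext => x y; rewrite !comp_lfunE /= !(tmapE, swap_lfunE).
Qed.
Definition swapR X Y : homC3 (tensR X Y) (tensR Y X) :=
  @HomC3 _ (tensR X Y) (tensR Y X) _ (swap_subproof X Y).

Lemma swapRE X Y (x : X) (y : Y) : swapR X Y (tensor x y) = tensor y x.
Proof. exact: swap_lfunE. Qed.

(** * Evaluation and currying for End(V) *)

Section InternalEnd.
Variable V : repC3 F.

Definition ev_lfun : 'Hom(tens 'End(V) V, V) :=
  tlift (fun (d : 'End(V)) v => d v).

Lemma ev_lfunE d v : ev_lfun (tensor d v) = d v.
Proof.
rewrite tliftE //; split=> [w a d1 d2|e]; last exact: linearP.
by rewrite add_lfunE scale_lfunE.
Qed.

Lemma endR_gactE (d : endR V) v : gact (endR V) d (gact V v) = gact V (d v).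
Proof. by rewrite /= (linfunE (@gconj_lin _ V)) gconjE. Qed.

Lemma ev_subproof :
  (ev_lfun \o gact (tensR (endR V) V) = gact V \o ev_lfun)%VF.
Proof.
apply: tens_ext => d v; rewrite !comp_lfunE tmapE !ev_lfunE.
exact: endR_gactE.
Qed.
Definition evR : homC3 (tensR (endR V) V) V :=
  @HomC3 _ (tensR (endR V) V) V _ ev_subproof.

Lemma evRE (d : endR V) (v : V) : evR (tensor d v) = d v.
Proof. exact: ev_lfunE. Qed.

Definition curry_lfun (Z : vectType F) (h : 'Hom(tens Z V, V)) :
    'Hom(Z, 'End(V)) :=
  linfun (fun z => linfun (fun v => h (tensor z v))).

Lemma curry_lfunE (Z : vectType F) (h : 'Hom(tens Z V, V)) z v :
  curry_lfun h z v = h (tensor z v).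
Proof.
have hl y : linear (fun v => h (tensor y v)).
  by move=> a u u'; rewrite tensor_linr linearP.
rewrite [curry_lfun h z]linfunE; first by rewrite linfunE.
move=> a y y'; apply/lfunP => u.
by rewrite add_lfunE scale_lfunE !linfunE // tensor_linl linearP.
Qed.

Lemma curry_subproof Z (h : homC3 (tensR Z V) V) :
  (curry_lfun h \o gact Z = gact (endR V) \o curry_lfun h)%VF.
Proof.
apply/lfunP => z; rewrite !comp_lfunE; apply/lfunP => v.
have [u ->] := gact_surj v.
by rewrite endR_gactE !curry_lfunE -tmapE; apply: (homC3E h (tensor z u)).
Qed.
Definition curryR Z (h : homC3 (tensR Z V) V) : homC3 Z (endR V) :=
  @HomC3 _ Z (endR V) _ (curry_subproof h).

Lemma ev_curry Z (h : homC3 (tensR Z V) V) :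
  homM evR (tensM (curryR h) (hom1 V)) = h.
Proof.
apply: tens_homP => z v.
by rewrite homME tensME evRE hom1E /= curry_lfunE.
Qed.

(** Currying recovers k from the displayed morphism, and it is equivariant on all linear maps, so
    [negligible_map] transfers negligibility. *)
Lemma negligible_end Z (k : homC3 Z (endR V)) :
  negligible (homM evR (tensM k (hom1 V))) -> negligible k.
Proof.
apply: (@negligible_map _ (tensR Z V) V Z (endR V) (@curry_lfun Z)).
- move=> a h h'; apply/lfunP => z; apply/lfunP => v.
  by rewrite curry_lfunE !(add_lfunE, scale_lfunE) !curry_lfunE.
- move=> h; apply/lfunP => z; rewrite !comp_lfunE; apply/lfunP => v.
  have [u ->] := gact_surj v.
  by rewrite endR_gactE !curry_lfunE !comp_lfunE tmapE.
apply/lfunP => z; apply/lfunP => v.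
rewrite curry_lfunE; apply/esym.
apply: etrans (homME evR (tensM k (hom1 V)) (tensor z v)) _.
by rewrite tensME evRE hom1E.
Qed.

Lemma tens_homB X Y X' Y' (k k' : homC3 X Y) (h : homC3 X' Y') :
  tensM (homB k k') h = homB (tensM k h) (tensM k' h).
Proof.
by apply: tens_homP => x y; rewrite homBE !tensME homBE tensorDl tensorNl.
Qed.

Lemma homM_homB X Y Z (h : homC3 Y Z) (k k' : homC3 X Y) :
  homM h (homB k k') = homB (homM h k) (homM h k').
Proof. by apply: homC3P => x; rewrite homBE !homME homBE lfunB. Qed.

Lemma ver_end Z (k k' : homC3 Z (endR V)) :
  (homM evR (tensM k (hom1 V)) =v homM evR (tensM k' (hom1 V))) -> (k =v k').
Proof. by move=> kk'; apply: negligible_end; rewrite tens_homB homM_homB. Qed.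

End InternalEnd.

(** * The adjunction involution and the retraction of End(V) onto so(V, b) *)

Section FormTransposition.
Variables (V : repC3 F) (b : homC3 (tensR V V) (unitR F)).
Hypothesis b_nondeg : form_nondeg b.

Definition flat : 'Hom(V, 'Hom(V, F^o)) :=
  linfun (fun x => linfun (form b x : V -> F^o)).

Lemma flatE x y : flat x y = form b x y.
Proof.
rewrite [flat x]linfunE ?linfunE //; first exact: (form_bilin b).2.
move=> a u v; apply/lfunP => w; rewrite add_lfunE scale_lfunE.
by rewrite !linfunE; [apply: (form_bilin b).1|apply: (form_bilin b).2..].
Qed.

Lemma flat_inj : lker flat == 0%VS.
Proof.
apply/lker0P => x y xy; apply/eqP; rewrite -subr_eq0; apply/eqP/b_nondeg => z.
by rewrite -flatE lfunB xy subrr zero_lfunE.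
Qed.

Lemma flat_surj (l : 'Hom(V, F^o)) : exists x, flat x = l.
Proof.
have /memv_imgP[x _ ->] : l \in limg flat; last by exists x.
suff -> : limg flat = fullv by apply: memvf.
apply/eqP; rewrite eqEdim subvf /= limg_dim_eq.
  by rewrite !dimvf /dim /= muln1.
by rewrite (eqP flat_inj) capv0.
Qed.

Definition sharp : 'Hom('Hom(V, F^o), V) := (flat^-1)%VF.

Lemma sharpK x : sharp (flat x) = x.
Proof. exact: lker0_lfunK flat_inj x. Qed.

Lemma form_sharp l y : form b (sharp l) y = l y.
Proof. by have [x <-] := flat_surj l; rewrite sharpK flatE. Qed.

Lemma form_inj x x' : (forall y, form b x y = form b x' y) -> x = x'.
Proof.
by move=> xx'; apply: (lker0P flat_inj); apply/lfunP => y; rewrite !flatE.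
Qed.

(** Nondegeneracy recovers h(z) from the functional v |-> b(h(z), v) by [sharp]; this is equivariant
    by invariance of b, so the argument for currying applies. *)
Lemma negligible_form Z (h : homC3 Z V) :
  negligible (homM b (tensM h (hom1 V))) -> negligible h.
Proof.
pose Phi0 (k : 'Hom(tens Z V, F^o)) (z : Z) : V :=
  sharp (linfun (fun v => k (tensor z v))).
have kl (k : 'Hom(tens Z V, F^o)) z : linear (fun v => k (tensor z v)).
  by move=> a u u'; rewrite tensor_linr linearP.
have P0E k z v : form b (Phi0 k z) v = k (tensor z v).
  by rewrite form_sharp linfunE.
have P0l k : linear (Phi0 k).
  move=> a z z'; apply: form_inj => v.
  by rewrite (form_bilin b).1 !P0E tensor_linl linearP.
apply: (@negligible_map _ (tensR Z V) (unitR F) Z V (fun k => linfun (Phi0 k))).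
- move=> a k k'; apply/lfunP => z.
  rewrite add_lfunE scale_lfunE !linfunE //; apply: form_inj => v.
  by rewrite (form_bilin b).1 !P0E add_lfunE scale_lfunE.
- move=> k; apply/lfunP => z; rewrite !comp_lfunE !linfunE //.
  apply: form_inj => v; have [u ->] := gact_surj v.
  by rewrite form_gact !P0E !comp_lfunE tmapE id_lfunE.
apply/lfunP => z; rewrite linfunE //; apply: form_inj => v.
rewrite P0E; apply/esym.
apply: etrans (homME b (tensM h (hom1 V)) (tensor z v)) _.
by rewrite tensME hom1E.
Qed.

Lemma ver_form Z (h h' : homC3 Z V) :
  (homM b (tensM h (hom1 V)) =v homM b (tensM h' (hom1 V))) -> (h =v h').
Proof. by move=> hh'; apply: negligible_form; rewrite tens_homB homM_homB. Qed.

Definition adj_fun (d : 'End(V)) : 'End(V) :=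
  linfun (fun x => sharp (flat x \o d)%VF).

Lemma form_adj d x y : form b (adj_fun d x) y = form b x (d y).
Proof.
rewrite linfunE; first by rewrite form_sharp comp_lfunE flatE.
by move=> a u v; rewrite linearP comp_lfunDl -comp_lfunZl linearP.
Qed.

Definition adj_lfun : 'Hom('End(V), 'End(V)) := linfun adj_fun.

Lemma form_adjR d x y : form b (adj_lfun d x) y = form b x (d y).
Proof.
rewrite [adj_lfun d]linfunE ?form_adj // => a e e'.
apply/lfunP => u; apply: form_inj => v.
rewrite add_lfunE scale_lfunE (form_bilin b).1 !form_adj.
by rewrite add_lfunE scale_lfunE (form_bilin b).2.
Qed.

Lemma adj_subproof :
  (adj_lfun \o gact (endR V) = gact (endR V) \o adj_lfun)%VF.
Proof.
apply/lfunP => d; rewrite !comp_lfunE; apply/lfunP => x; apply: form_inj => y.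
have [x' ->] := gact_surj x; have [y' ->] := gact_surj y.
by rewrite form_adjR !endR_gactE !form_gact form_adjR.
Qed.
Definition adjR : homC3 (endR V) (endR V) :=
  @HomC3 _ (endR V) (endR V) _ adj_subproof.

Lemma form_adjE (d : endR V) x y :
  form b ((adjR d : 'End(V)) x) y = form b x (d y).
Proof. exact: form_adjR. Qed.

Lemma so_incl_linear : linear (vsval : subvs_of (so b) -> 'End(V)).
Proof. exact: linearP. Qed.

Lemma so_incl_subproof :
  (linfun (vsval : subvs_of (so b) -> 'End(V)) \o gact (soR b)
   = gact (endR V) \o linfun (vsval : subvs_of (so b) -> 'End(V)))%VF.
Proof.
apply/lfunP => d; rewrite !comp_lfunE !(linfunE so_incl_linear) so_gactE.
by rewrite (linfunE (@gconj_lin _ V)).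
Qed.
Definition so_incl : homC3 (soR b) (endR V) :=
  @HomC3 _ (soR b) (endR V) _ so_incl_subproof.

Lemma so_inclE d : so_incl d = vsval d.
Proof. exact: (linfunE so_incl_linear). Qed.

Hypothesis b_sym : form_sym b.

Lemma form_adjEr (d : endR V) x y :
  form b x ((adjR d : 'End(V)) y) = form b ((d : 'End(V)) x) y.
Proof. by rewrite b_sym form_adjE b_sym. Qed.

Lemma formBl x y z : form b (x - y) z = form b x z - form b y z.
Proof. by rewrite -!flatE lfunB add_lfunE opp_lfunE. Qed.

Lemma formBr x y z : form b x (y - z) = form b x y - form b x z.
Proof. by rewrite -!flatE lfunB. Qed.

(** Symmetry of b lets adjunction act on either argument ([form_adjEr]), so the terms b(x, d y) and
    b(d x, y) cancel in pairs. *)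
Lemma adjB_so (d : endR V) : (adjR d - d : 'End(V)) \in so b.
Proof.
apply/so_memP => x y; rewrite !add_lfunE !opp_lfunE formBl formBr.
by rewrite form_adjE form_adjEr addrA subrK subrr.
Qed.

Definition so_proj_lfun : 'Hom('End(V), subvs_of (so b)) :=
  linfun (fun d : endR V => vsproj (so b) (adjR d - d)).

Lemma so_proj_lfunE (d : endR V) :
  vsval (so_proj_lfun d) = (adjR d : 'End(V)) - d.
Proof.
rewrite linfunE ?vsprojK ?adjB_so // => a u v; rewrite -linearP.
by congr (vsproj _ _); rewrite linearP scalerBr opprD addrACA.
Qed.

Lemma so_proj_subproof :
  (so_proj_lfun \o gact (endR V) = gact (soR b) \o so_proj_lfun)%VF.
Proof.
apply/lfunP => d; rewrite !comp_lfunE; apply: val_inj => /=.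
rewrite so_gactE so_proj_lfunE [in RHS]so_proj_lfunE homC3E.
by rewrite /= !(linfunE (@gconj_lin _ V)) -!(linfunE (@gconj_lin _ V)) lfunB.
Qed.
Definition so_proj : homC3 (endR V) (soR b) :=
  @HomC3 _ (endR V) (soR b) _ so_proj_subproof.

(* The projection is (1 - adj) / 2 = adj - 1, as 2 = -1. *)
Lemma so_incl_proj d : so_incl (so_proj d) = adjR d - d.
Proof. by rewrite so_inclE so_proj_lfunE. Qed.

Lemma so_adj d : adjR (so_incl d) = - so_incl d.
Proof.
apply/lfunP => x; apply: form_inj => y.
have /so_memP/(_ x y) := subvsP d.
rewrite form_adjE so_inclE opp_lfunE -[- _]sub0r formBl => /eqP.
rewrite addrC addr_eq0 => /eqP ->.
by rewrite -[0 in RHS](subrr x) formBl subrr sub0r.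
Qed.

(** Adjunction is -1 on so(V, b), so adj - 1 is -2 = 1 there. *)
Lemma so_proj_incl : 3%N \in [pchar F] -> homM so_proj so_incl = hom1 _.
Proof.
move=> char3; apply: homC3P => d; rewrite homME hom1E; apply: val_inj => /=.
rewrite so_proj_lfunE -[adj_lfun _]/(adjR _) so_adj -opprD so_inclE.
rewrite -mulr2n -scaler_nat (two_eqN1 char3) scaleN1r opprK.
by [].
Qed.

End FormTransposition.
End RepConstructions.

(** * Actions of superspaces *)

Section SuperAction.
Variable F : fieldType.
Hypothesis char3 : 3%N \in [pchar F].
Implicit Types (X Y Z : svect F) (U : vectType F).

Local Notation Fobj := (Fobj char3).
Local Notation Fmor := (Fmor char3).
Local Notation J := (J char3).
Local Notation v1 := (v1 char3).
Local Notation Ji := (Ji char3).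
Local Notation Fe := (Fe char3).

(** The coefficients are lambda(v_1, v_0) = -1 and lambda(v_0, v_1) = 1: this is the combination
    produced by a pairing of odd vectors evaluated on [Ji]. *)
Lemma scaleN1B1 U (z : U) : (-1) *: z - 1 *: z = z.
Proof.
by rewrite -scalerBl -opprD -[1 + 1]/2%:R (two_eqN1 char3) opprK scale1r.
Qed.

Lemma scale1BN1 U (z : U) : 1 *: z - (-1) *: z = - z.
Proof. by rewrite -[RHS](congr1 -%R (scaleN1B1 z)) opprB. Qed.

(** The tool for computing a map of superspaces known only through its class: any representative may
    be evaluated on even vectors and on x (x) v_1. *)
Lemma Fmor_values X Y (mu : shom X Y) (t : homC3 (Fobj X) (Fobj Y)) :
  (Fmor mu =v t) ->
  (forall x, hev mu x = (t (Fe x)).1) /\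
  (forall x, hod mu x = Fc char3 Y true (t (Fo x v1))).
Proof.
move=> /ver_parts[]; rewrite ev_part_Fmor od_part_Fmor => -> ->.
by split=> x; rewrite ?ev_partE ?od_partE.
Qed.

Section Components.
Variables X Y Z : svect F.
Variable mu : shom (stens X Y) Z.
(* The components of [mu]: [meo] is its restriction to X_0 (x) Y_1, etc. *)
Definition mee x y := hev mu (tee x y).
Definition moo x y := hev mu (too x y).
Definition meo x y := hod mu (teo x y).
Definition moe x y := hod mu (toe x y).

Definition FJ := homM (Fmor mu) (J X Y).

Lemma FJ_ee x y : FJ (tensor (Fe x) (Fe y)) = Fe (mee x y).
Proof. by rewrite homME J_ee Fmor_Fe. Qed.

Lemma FJ_eo x y v : FJ (tensor (Fe x) (Fo y v)) = Fo (meo x y) v.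
Proof. by rewrite homME J_eo Fmor_Fo. Qed.

Lemma FJ_oe x y v : FJ (tensor (Fo x v) (Fe y)) = Fo (moe x y) v.
Proof. by rewrite homME J_oe Fmor_Fo. Qed.

Lemma FJ_oo x y u v :
  FJ (tensor (Fo x u) (Fo y v)) = lam u v *: Fe (moo x y).
Proof. by rewrite homME J_oo lfunZ Fmor_Fe. Qed.

Lemma FJ_Ji : homM FJ (Ji X Y) = Fmor mu.
Proof. by rewrite /FJ -homMA JJi homM1. Qed.

Lemma sapp_stensor (x : total X) (y : total Y) :
  sapp mu (stensor x y) =
  (mee x.1 y.1 + moo x.2 y.2, meo x.1 y.2 + moe x.2 y.1).
Proof.
rewrite /sapp pmapE /mee /moo /meo /moe -!lfunD /= /tee /too /teo /toe.
by congr (hev mu _, hod mu _); congr (_, _); rewrite /= ?addr0 ?add0r.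
Qed.

End Components.

Definition FJE := (FJ_ee, FJ_eo, FJ_oe, FJ_oo).
Definition JiE := (Ji_ee, Ji_eo, Ji_oe, Ji_oo).
Definition FmorE := (Fmor_Fe, Fmor_Fo).
Definition lamE := (lam00 char3, lam01 char3, lam10 char3, lam11 char3).

(** * Actions on W and morphisms into End(V) *)

Section Representation.
Variables (V : repC3 F) (W : svect F).
Variables (f : homC3 (Fobj W) V) (g : homC3 V (Fobj W)).
Hypothesis gf1 : homM g f =v hom1 _.
Hypothesis fg1 : homM f g =v hom1 _.
Local Notation evV := (evR V).

(* [mu] is the action on W of the superspace X which acts on V through [h]. *)
Definition represents X (h : homC3 (Fobj X) (endR V))
    (mu : shom (stens X W) W) :=
  homM evV (tensM h f) =v homM f (FJ mu).

Lemma cancel_f (X : repC3 F) (a b : homC3 X (Fobj W)) :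
  (homM f a =v homM f b) -> (a =v b).
Proof.
have gfa (c : homC3 X (Fobj W)) : homM g (homM f c) =v c.
  by rewrite homMA -[X in _ =v X]hom1M; apply: ver_compr.
move=> /(ver_compl g) fab.
by apply: ver_trans (ver_sym (gfa a)) (ver_trans fab (gfa b)).
Qed.

Lemma Fmor_FJ X (mu : shom (stens X W) W) t :
  (homM f (FJ mu) =v homM f t) -> (Fmor mu =v homM t (Ji X W)).
Proof. by move=> /cancel_f mt; rewrite -FJ_Ji; apply: ver_compr. Qed.

(** Transport evaluation to W through f and g, restrict along [Ji], and let fullness of F supply a
    map of superspaces; [JiJ] undoes the restriction. *)
Lemma represents_exists X (h : homC3 (Fobj X) (endR V)) :
  exists mu, represents h mu.
Proof.
pose t := homM g (homM evV (tensM h f)).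
have tF := F_full (homM t (Ji X W)).
exists (SHom (ev_part (homM t (Ji X W))) (od_part (homM t (Ji X W)))).
apply: ver_sym; apply: (@ver_trans _ _ _ (homM f t)).
  apply: ver_compl; apply: ver_trans (ver_compr _ (ver_sym tF)) _.
  by rewrite -homMA -[X in _ =v X]homM1; apply/ver_compl/JiJ.
by rewrite homMA -[X in _ =v X]hom1M; apply: ver_compr.
Qed.

Lemma tens_1g (Z : repC3 F) (a : homC3 Z (endR V)) :
  homM evV (tensM a (hom1 V)) =v homM (homM evV (tensM a f)) (tensM (hom1 Z) g).
Proof.
rewrite -homMA -tensMM homM1; apply/ver_compl/ver_tensr.
exact: ver_sym.
Qed.

(** Conversely, the action on W, transported to V by f and g, is an actual equivariant map F(X) (x)
    V -> V, which can be curried. *)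
Lemma represents_lift X (mu : shom (stens X W) W) :
  exists h : homC3 (Fobj X) (endR V), represents h mu.
Proof.
exists (curryR (homM (homM f (FJ mu)) (tensM (hom1 _) g))).
rewrite /represents.
rewrite -[in X in tensM X _](homM1 (curryR _)) -[in X in tensM _ X](hom1M f).
rewrite tensMM homMA ev_curry -homMA -tensMM homM1 -[X in _ =v X]homM1.
by rewrite -tensM1; apply/ver_compl/ver_tensr.
Qed.

Lemma represents_ver X (h h' : homC3 (Fobj X) (endR V)) mu :
  (h =v h') -> represents h mu -> represents h' mu.
Proof.
by move=> hh' hm; apply: ver_trans hm; apply/ver_compl/ver_tensl/ver_sym.
Qed.

Lemma represents_pre X (Y : repC3 F) (h : homC3 (Fobj X) (endR V)) mu
    (p : homC3 Y (Fobj X)) :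
  represents h mu ->
  homM evV (tensM (homM h p) f) =v homM f (homM (FJ mu) (tensM p (hom1 _))).
Proof.
move=> hm; rewrite -[in X in tensM _ X](homM1 f) tensMM homMA (homMA f).
exact: ver_compr.
Qed.

Lemma represents_comp X Y (h : homC3 (Fobj X) (endR V)) mu (chi : shom Y X) nu :
  represents h mu -> represents (homM h (Fmor chi)) nu ->
  [/\ forall y w, mee nu y w = mee mu (hev chi y) w,
      forall y w, moo nu y w = moo mu (hod chi y) w,
      forall y w, meo nu y w = meo mu (hev chi y) w &
      forall y w, moe nu y w = moe mu (hod chi y) w].
Proof.
move=> hm hn; have/Fmor_FJ/Fmor_values[E O] :=
  ver_trans (ver_sym hn) (represents_pre (Fmor chi) hm).
split=> y w; rewrite ?[LHS]E ?[LHS]O 2!homME JiE ?lfunB !tensME !FmorE !hom1E.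
- by rewrite FJE.
- by rewrite !FJE !lamE scaleN1B1.
- by rewrite FJE Fc_Fo scale1r.
by rewrite FJE Fc_Fo scale1r.
Qed.

(** Faithfulness of the correspondence: the four conditions make the action map vanish on all pure
    tensors, and by currying and the invertibility of f only the zero class of morphisms into End(V)
    has this action. *)
Lemma represents_eq0 X Y (h : homC3 (Fobj X) (endR V)) mu (chi : shom Y X) :
  represents h mu ->
  (forall y w, mee mu (hev chi y) w = 0) ->
  (forall y w, moo mu (hod chi y) w = 0) ->
  (forall y w, meo mu (hev chi y) w = 0) ->
  (forall y w, moe mu (hod chi y) w = 0) ->
  negligible (homM h (Fmor chi)).
Proof.
move=> hm ee oo eo oe; apply: negligible_end.
apply: negligible_ver (ver_sym (tens_1g _)) _; apply: negligibleMr.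
apply: negligible_ver (ver_sym (represents_pre (Fmor chi) hm)) _.
apply: negligible0 => t; rewrite -[RHS](zero_lfunE _ t).
congr (fun_of_lfun _ t).
apply: FF_ext => [x y|x y v|x u y|x u y v]; rewrite zero_lfunE 2!homME tensME;
  rewrite hom1E FmorE FJE ?ee ?oo ?eo ?oe ?Fo0l ?lfun0 //.
by rewrite Fe0 scaler0 lfun0.
Qed.

Lemma represents_homB X (h h' : homC3 (Fobj X) (endR V)) mu mu' nu :
  represents h mu -> represents h' mu' -> represents (homB h h') nu ->
  (forall x, hev nu x = hev mu x - hev mu' x) /\
  (forall x, hod nu x = hod mu x - hod mu' x).
Proof.
move=> hm hm' hn.
have : Fmor nu =v homB (Fmor mu) (Fmor mu').
  rewrite -!FJ_Ji.
  apply: (@ver_trans _ _ _ (homM (homB (FJ mu) (FJ mu')) (Ji X W))).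
    apply/ver_compr/cancel_f/(ver_trans (ver_sym hn)).
    by rewrite homM_homB tens_homB homM_homB; apply: ver_subr.
  rewrite (_ : homB _ _ = homM (homB (FJ mu) (FJ mu')) (Ji X W)).
    exact: ver_refl.
  by apply: homC3P => x; rewrite !(homME, homBE).
move=> /Fmor_values[E O]; split=> x; first by rewrite E homBE !Fmor_Fe.
by rewrite O homBE lfunB !Fmor_Fo !Fc_Fo !scale1r.
Qed.

(** Evaluation is associative, so the product acts by [mu] after [mu']. The tensor factors keep
    their order, hence no signs. *)
Lemma represents_mul X Y (h : homC3 (Fobj X) (endR V)) mu
    (h' : homC3 (Fobj Y) (endR V)) mu' nu :
  represents h mu -> represents h' mu' ->
  represents (homM (homM (amul (endA V)) (tensM h h')) (Ji X Y)) nu ->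
  [/\ forall x y w, mee nu (tee x y) w = mee mu x (mee mu' y w),
      forall x y w, mee nu (too x y) w = moo mu x (moe mu' y w),
      forall x y w, moo nu (teo x y) w = mee mu x (moo mu' y w) &
      forall x y w, moo nu (toe x y) w = moo mu x (meo mu' y w)] /\
  [/\ forall x y w, meo nu (tee x y) w = meo mu x (meo mu' y w),
      forall x y w, meo nu (too x y) w = moe mu x (moo mu' y w),
      forall x y w, moe nu (teo x y) w = meo mu x (moe mu' y w) &
      forall x y w, moe nu (toe x y) w = moe mu x (mee mu' y w)].
Proof.
move=> hm hm' hn.
pose A3 := asso (Fobj X) (Fobj Y) (Fobj W).
pose t := homM (homM (homM (FJ mu) (tensM (hom1 _) (FJ mu'))) A3)
               (tensM (Ji X Y) (hom1 _)).
have /Fmor_FJ/Fmor_values[E O] : homM f (FJ nu) =v homM f t.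
  apply: ver_trans (ver_sym hn) _.
  rewrite -[in X in tensM _ X](homM1 f) tensMM homMA /t.
  rewrite (homMA f); apply: ver_compr.
  have -> : homM evV (tensM (homM (amul (endA V)) (tensM h h')) f) =
      homM (homM evV (tensM h (homM evV (tensM h' f)))) A3.
    apply: tens3_homP => x y w.
    rewrite homME tensME [in RHS]homME assoE homME tensME homME tensME.
    rewrite homME tensME !evRE [amul _ _]end_mulE.
    exact: comp_lfunE.
  rewrite (homMA f); apply: ver_compr.
  apply: ver_trans (ver_compl _ (ver_tensr _ hm')) _.
  rewrite -[X in tensM X _](homM1 h) tensMM homMA (homMA f).
  exact: ver_compr.
split; split=> x y w; rewrite ?[LHS]E ?[LHS]O 4!homME.
- by rewrite JiE tensME JiE hom1E assoE tensME hom1E !FJE.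
- rewrite JiE tensME JiE hom1E tensorBl !lfunB !assoE !tensME !hom1E !FJE.
  by rewrite !lamE scaleN1B1.
- rewrite JiE !lfunB !tensME !JiE !hom1E !assoE !tensME !hom1E !FJE.
  by rewrite !tensorZr !lfunZ !FJE !lamE scaleN1B1.
- rewrite JiE !lfunB !tensME !JiE !hom1E !assoE !tensME !hom1E !FJE.
  by rewrite !lamE scaleN1B1.
- by rewrite JiE tensME JiE hom1E assoE tensME hom1E !FJE Fc_Fo scale1r.
(* Here w carries v_1; since lambda(v_1, v_1) = 0, only the term of the section in which x carries
   v_1 and y carries v_0 contributes, with lambda(v_0, v_1) = 1. *)
- rewrite JiE tensME JiE hom1E tensorBl !lfunB !assoE !tensME !hom1E !FJE.
  rewrite !tensorZr !lfunZ !FJE !lamE scale0r subr0.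
  by rewrite scale1r Fc_Fo scale1r.
- by rewrite JiE tensME JiE hom1E assoE tensME hom1E !FJE Fc_Fo scale1r.
by rewrite JiE tensME JiE hom1E assoE tensME hom1E !FJE Fc_Fo scale1r.
Qed.

End Representation.
End SuperAction.

(** * Supersymmetric forms *)

Section SuperForm.
Variable F : fieldType.
Hypothesis char3 : 3%N \in [pchar F].
Implicit Types (X Y Z : svect F) (U : vectType F).

Local Notation Fobj := (Fobj char3).
Local Notation Fmor := (Fmor char3).
Local Notation J := (J char3).
Local Notation v0 := (v0 char3).
Local Notation v1 := (v1 char3).
Local Notation Ji := (Ji char3).
Local Notation Fe := (Fe char3).
Local Notation FJ := (FJ char3).
Local Notation Funit := (Funit char3).

Lemma FunitE z : Funit z = z.1.
Proof. exact: linfunE. Qed.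

(** A pair of vectors as a morphism from the (1|1)-dimensional superspace, so that vanishing of
    vectors becomes negligibility of a morphism. *)
Definition point X (x : ev X) (y : od X) : shom (SVect F^o F^o) X :=
  @SHom _ (SVect F^o F^o) X
    (linfun (fun a : F^o => (a : F) *: x))
    (linfun (fun a : F^o => (a : F) *: y)).

Lemma hev_point X (x : ev X) (y : od X) a : hev (point x y) a = (a : F) *: x.
Proof. by rewrite linfunE // => k u v; rewrite scalerDl scalerA. Qed.

Lemma hod_point X (x : ev X) (y : od X) a : hod (point x y) a = (a : F) *: y.
Proof. by rewrite linfunE // => k u v; rewrite scalerDl scalerA. Qed.

Lemma point_negligible X (x : ev X) (y : od X) :
  negligible (Fmor (point x y)) -> x = 0 /\ y = 0.
Proof.
move=> /negligible_parts; rewrite ev_part_Fmor od_part_Fmor.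
move=> [/lfunP/(_ 1) x0 /lfunP/(_ 1) y0].
by move: x0 y0; rewrite hev_point hod_point !zero_lfunE !scale1r.
Qed.

Section Bilinearity.
Variables (X Y Z : svect F) (mu : shom (stens X Y) Z).

Lemma mee_bilin : bilin (mee mu).
Proof.
by split=> [z a u v|z a u v];
  rewrite /mee /tee ?tensor_linl ?tensor_linr pair0_linearl linearP.
Qed.

Lemma moo_bilin : bilin (moo mu).
Proof.
by split=> [z a u v|z a u v];
  rewrite /moo /too ?tensor_linl ?tensor_linr pair0_linearr linearP.
Qed.

Lemma meo_bilin : bilin (meo mu).
Proof.
by split=> [z a u v|z a u v];
  rewrite /meo /teo ?tensor_linl ?tensor_linr pair0_linearl linearP.
Qed.

Lemma moe_bilin : bilin (moe mu).
Proof.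
by split=> [z a u v|z a u v];
  rewrite /moe /toe ?tensor_linl ?tensor_linr pair0_linearr linearP.
Qed.

Lemma meeZl a x y : mee mu (a *: x) y = a *: mee mu x y.
Proof. by rewrite -!(linfunE (mee_bilin.1 y)) linearZ. Qed.

Lemma mooZl a x y : moo mu (a *: x) y = a *: moo mu x y.
Proof. by rewrite -!(linfunE (moo_bilin.1 y)) linearZ. Qed.

Lemma meoZl a x y : meo mu (a *: x) y = a *: meo mu x y.
Proof. by rewrite -!(linfunE (meo_bilin.1 y)) linearZ. Qed.

Lemma moeZl a x y : moe mu (a *: x) y = a *: moe mu x y.
Proof. by rewrite -!(linfunE (moe_bilin.1 y)) linearZ. Qed.

End Bilinearity.

Section Form.
Variables (V : repC3 F) (b : homC3 (tensR V V) (unitR F)).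
Hypotheses (b_sym : form_sym b) (b_nondeg : form_nondeg b).
Variables (W : svect F) (c : shom (stens W W) (sunit F)).
Variables (f : homC3 (Fobj W) V) (g : homC3 V (Fobj W)).
Hypothesis gf1 : homM g f =v hom1 _.
Hypothesis fg1 : homM f g =v hom1 _.
Local Notation bc := (homM Funit (FJ c)).
Hypothesis cb : bc =v homM b (tensM f f).

Lemma sformE x y : sform c x y = mee c x.1 y.1 + moo c x.2 y.2.
Proof. by rewrite /sform sapp_stensor. Qed.

Lemma bc_ee x y : bc (tensor (Fe x) (Fe y)) = mee c x y.
Proof. by rewrite homME FunitE FJ_ee. Qed.

Lemma bc_eo x y v : bc (tensor (Fe x) (Fo y v)) = 0.
Proof. by rewrite homME FunitE FJ_eo. Qed.

Lemma bc_oe x y v : bc (tensor (Fo x v) (Fe y)) = 0.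
Proof. by rewrite homME FunitE FJ_oe. Qed.

Lemma bc_oo x y u v : bc (tensor (Fo x u) (Fo y v)) = lam u v *: moo c x y.
Proof. by rewrite homME FunitE FJ_oo. Qed.

Definition bcE := (bc_ee, bc_eo, bc_oe, bc_oo).

Lemma ver_unit_values X (r s : homC3 (Fobj X) (unitR F)) :
  (r =v s) -> forall x, r (Fe x) = s (Fe x).
Proof.
move=> rs x; apply/eqP; rewrite -subr_eq0 -homBE.
by apply/eqP/negligible_F_to_unit.
Qed.

(** The swap negates the section v_1 (x) v_0 - v_0 (x) v_1 of J; this turns the symmetry of b into
    skew-symmetry on W_1. *)
Lemma c_sym :
  (forall x y, mee c y x = mee c x y) /\ (forall x y, moo c y x = - moo c x y).
Proof.
have bS : homM bc (swapR _ _) =v bc.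
  apply: ver_trans (ver_compr _ cb) (ver_trans _ (ver_sym cb)).
  suff -> : homM (homM b (tensM f f)) (swapR _ _) = homM b (tensM f f).
    exact: ver_refl.
  by apply: tens_homP => x y; rewrite !homME swapRE !tensME; apply: b_sym.
have E z : bc (swapR _ _ (Ji W W (Fe z))) = bc (Ji W W (Fe z)).
  rewrite -(homME bc (swapR _ _)) -(homME bc (Ji W W)).
  rewrite -(homME (homM bc (swapR _ _))).
  exact: (ver_unit_values (ver_compr (Ji W W) bS)).
split=> x y; first by have := E (tee x y); rewrite Ji_ee swapRE !bcE.
have := E (too x y); rewrite Ji_oo !lfunB !swapRE !bcE.
rewrite !(lamE char3) (scaleN1B1 char3) (scale1BN1 char3) => /(congr1 -%R).
by rewrite opprK.
Qed.

Lemma c_supersymmetric : supersymmetric c.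
Proof.
have [ce co] := c_sym.
have e0l := bilin0l _ (mee_bilin c); have e0r := bilin0r _ (mee_bilin c).
have o0l := bilin0l _ (moo_bilin c); have o0r := bilin0r _ (moo_bilin c).
move=> p q x y; rewrite !sformE.
case: p q => -[] /= -> ->; rewrite ?(e0l, e0r, o0l, o0r) ?(add0r, addr0).
- by rewrite co expr1 mulN1r.
- by rewrite mulr0.
- by rewrite mulr0.
by rewrite ce mul1r.
Qed.

(** A vector of the radical, viewed as a morphism i into F(W), makes b(f i, -) negligible;
    nondegeneracy of b kills f i in Ver_3, and f is invertible there. *)
Lemma c_nondeg : sform_nondeg c.
Proof.
move=> x x0.
have ce y : mee c x.1 y = 0.
  have := x0 (y, 0); rewrite sformE /=.
  by rewrite (bilin0r _ (moo_bilin c)) addr0.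
have co y : moo c x.2 y = 0.
  have := x0 (0, y); rewrite sformE /=.
  by rewrite (bilin0r _ (mee_bilin c)) add0r.
suff /point_negligible[x10 x20] : negligible (Fmor (point x.1 x.2)).
  by rewrite [x]surjective_pairing x10 x20.
pose i := Fmor (point x.1 x.2).
have gfi : i =v homM g (homM f i).
  by rewrite homMA -[X in X =v _]hom1M; apply/ver_compr/ver_sym.
apply: negligible_ver (ver_sym gfi) _; apply: negligibleMl.
apply: (negligible_form b_nondeg).
have : homM b (tensM (homM f i) (hom1 V)) =v
       homM (homM bc (tensM i (hom1 _))) (tensM (hom1 _) g).
  rewrite -homMA -tensMM homM1 hom1M.
  apply: ver_trans (ver_sym (ver_compr _ cb)).
  rewrite -homMA -tensMM; apply/ver_compl/ver_tensr/ver_sym.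
  exact: fg1.
move=> /ver_sym/negligible_ver; apply; apply: negligibleMr.
apply: negligible0 => t; rewrite -[RHS](zero_lfunE _ t).
congr (fun_of_lfun _ t).
apply: FF_ext => [y z|y z v|y u z|y u z v]; rewrite zero_lfunE [LHS]homME;
  rewrite tensME hom1E /i FmorE ?hev_point ?hod_point bcE //.
  by rewrite meeZl ce scaler0.
by rewrite mooZl co !scaler0.
Qed.

(** * Skew actions and adjunction *)

Section Skew.
Variables (X : svect F) (mu : shom (stens X W) W).

(** The identity c(x w, w') = - (-1)^(|x||w|) c(w, x w') by parities. In the second clause alone x
    and w are both odd, hence its sign. *)
Definition super_skew :=
  [/\ forall x w w', mee c (mee mu x w) w' = - mee c w (mee mu x w'),
      forall x w w', mee c (moo mu x w) w' = moo c w (moe mu x w'),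
      forall x w w', moo c (meo mu x w) w' = - moo c w (meo mu x w') &
      forall x w w', moo c (moe mu x w) w' = - mee c w (moo mu x w')].

(* z (x) x (x) y |-> c(z x, y) and z (x) x (x) y |-> c(x, z y). *)
Definition skew_l := homM bc (tensM (FJ mu) (hom1 (Fobj W))).

Definition twist (R S : repC3 F) :
    homC3 (tensR (tensR R S) S) (tensR S (tensR R S)) :=
  homM (asso S R S) (tensM (swapR R S) (hom1 S)).

Lemma twistE (R S : repC3 F) (z : R) (x y : S) :
  twist R S (tensor (tensor z x) y) = tensor x (tensor z y).
Proof. by rewrite homME tensME swapRE hom1E assoE. Qed.

Definition skew_r :=
  homM bc (homM (tensM (hom1 (Fobj W)) (FJ mu)) (twist (Fobj X) (Fobj W))).

Definition tri : homC3 (Fobj (stens (stens X W) W))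
    (tensR (tensR (Fobj X) (Fobj W)) (Fobj W)) :=
  homM (tensM (Ji X W) (hom1 (Fobj W))) (Ji (stens X W) W).

(** [tri] has a right inverse in Ver_3, assembled from two copies of J, so the class of a is
    determined by its restriction along [tri]; and the class of an invariant functional on an object
    F(Z) is determined by even vectors. *)
Lemma negligible_tri (a : homC3 (tensR (tensR (Fobj X) (Fobj W)) (Fobj W))
    (unitR F)) :
  (forall z, a (tri (Fe z)) = 0) -> negligible a.
Proof.
move=> a0.
have triK : homM tri (homM (J (stens X W) W) (tensM (J X W) (hom1 _)))
    =v hom1 _.
  rewrite /tri homMA -(homMA (tensM _ _)).
  apply: (@ver_trans _ _ _
    (homM (tensM (Ji X W) (hom1 _)) (tensM (J X W) (hom1 _)))).
    apply: ver_compr; rewrite -[X in _ =v X]homM1; apply/ver_compl/JiJ.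
  by rewrite -tensMM homM1 -tensM1; apply/ver_tensl/JiJ.
apply: negligible_ver (_ : homM (homM a tri) _ =v a) _.
  by rewrite -[X in _ =v X]homM1 -homMA; apply/ver_compl/triK.
apply: negligibleMr; apply: F_to_unit_negligible => z.
by rewrite homME.
Qed.

Lemma negligible_tri_pure (a : homC3 (tensR (tensR (Fobj X) (Fobj W)) (Fobj W))
    (unitR F)) :
  (forall x w w', a (tri (Fe (tee (tee x w) w'))) = 0) ->
  (forall x w w', a (tri (Fe (tee (too x w) w'))) = 0) ->
  (forall x w w', a (tri (Fe (too (teo x w) w'))) = 0) ->
  (forall x w w', a (tri (Fe (too (toe x w) w'))) = 0) ->
  negligible a.
Proof.
move=> a1 a2 a3 a4; apply: negligible_tri => z.
have FeL := @Fe_linear F char3.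
pose l := (a \o tri \o linfun (fun t : ev (stens (stens X W) W) => Fe t))%VF.
have lE t : l t = a (tri (Fe t)) by rewrite !comp_lfunE linfunE.
rewrite -lE -[RHS](zero_lfunE _ z); congr (fun_of_lfun _ z).
apply: stens_ev_ext => [t w'|t w']; rewrite zero_lfunE.
  have tl : linear
      (fun t : ev (stens X W) => tee t w' : ev (stens (stens X W) W)).
    by move=> k u v; rewrite /tee tensor_linl pair0_linearl.
  rewrite -(linfunE tl) -comp_lfunE -[RHS](zero_lfunE _ t).
  congr (fun_of_lfun _ t); apply: stens_ev_ext => x w;
    by rewrite zero_lfunE comp_lfunE linfunE // lE ?a1 ?a2.
have tl : linear
    (fun t : od (stens X W) => too t w' : ev (stens (stens X W) W)).
  by move=> k u v; rewrite /too tensor_linl pair0_linearr.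
rewrite -(linfunE tl) -comp_lfunE -[RHS](zero_lfunE _ t).
congr (fun_of_lfun _ t); apply: stens_od_ext => x w;
  by rewrite zero_lfunE comp_lfunE linfunE // lE ?a3 ?a4.
Qed.

Lemma skew_lE x y z :
  skew_l (tensor (tensor x y) z) = bc (tensor (FJ mu (tensor x y)) z).
Proof. by rewrite [LHS]homME tensME hom1E. Qed.

Lemma skew_rE x y z :
  skew_r (tensor (tensor x y) z) = bc (tensor y (FJ mu (tensor x z))).
Proof. by rewrite [LHS]homME (homME (tensM _ _)) twistE tensME hom1E. Qed.

Lemma triE t z :
  tri (Fe (tee t z)) = tensor (Ji X W (Fe t)) (Fe z).
Proof. by rewrite homME Ji_ee tensME hom1E. Qed.

Lemma triEo t z :
  tri (Fe (too t z)) = tensor (Ji X W (Fo t v1)) (Fo z v0)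
                       - tensor (Ji X W (Fo t v0)) (Fo z v1).
Proof. by rewrite homME Ji_oo lfunB !tensME !hom1E. Qed.

Lemma skewP : (skew_l =v homN skew_r) <-> super_skew.
Proof.
have tl1 x w w' : skew_l (tri (Fe (tee (tee x w) w'))) = mee c (mee mu x w) w'.
  by rewrite triE Ji_ee skew_lE FJ_ee bc_ee.
have tl2 x w w' : skew_l (tri (Fe (tee (too x w) w'))) = mee c (moo mu x w) w'.
  rewrite triE Ji_oo tensorBl lfunB !skew_lE !FJ_oo !tensorZl !lfunZ bc_ee.
  by rewrite !(lamE char3) (scaleN1B1 char3).
have tl3 x w w' : skew_l (tri (Fe (too (teo x w) w'))) = moo c (meo mu x w) w'.
  rewrite triEo !Ji_eo lfunB !skew_lE !FJ_eo !bc_oo.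
  by rewrite !(lamE char3) (scaleN1B1 char3).
have tl4 x w w' : skew_l (tri (Fe (too (toe x w) w'))) = moo c (moe mu x w) w'.
  rewrite triEo !Ji_oe lfunB !skew_lE !FJ_oe !bc_oo.
  by rewrite !(lamE char3) (scaleN1B1 char3).
have tr1 x w w' : skew_r (tri (Fe (tee (tee x w) w'))) = mee c w (mee mu x w').
  by rewrite triE Ji_ee skew_rE FJ_ee bc_ee.
(* The Koszul sign: x carries v_1 and w carries v_0 in the first term, and after [twist] moves w in
   front the pairing gives lambda(v_0, v_1) - lambda(v_1, v_0) = 2 = -1. *)
have tr2 x w w' :
    skew_r (tri (Fe (tee (too x w) w'))) = - moo c w (moe mu x w').
  rewrite triE Ji_oo tensorBl lfunB !skew_rE !FJ_oe !bc_oo.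
  by rewrite !(lamE char3) (scale1BN1 char3).
have tr3 x w w' : skew_r (tri (Fe (too (teo x w) w'))) = moo c w (meo mu x w').
  rewrite triEo !Ji_eo lfunB !skew_rE !FJ_eo !bc_oo.
  by rewrite !(lamE char3) (scaleN1B1 char3).
have tr4 x w w' : skew_r (tri (Fe (too (toe x w) w'))) = mee c w (moo mu x w').
  rewrite triEo !Ji_oe lfunB !skew_rE !FJ_oo !tensorZr !lfunZ bc_ee.
  by rewrite !(lamE char3) (scaleN1B1 char3).
split=> [S|[s1 s2 s3 s4]].
  have E z : skew_l (tri (Fe z)) = - skew_r (tri (Fe z)).
    rewrite -homNE -(homME skew_l) -(homME (homN skew_r)).
    exact: (ver_unit_values (ver_compr tri S)).
  split=> x w w'; first by rewrite -tl1 E tr1.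
  - by rewrite -tl2 E tr2 opprK.
  - by rewrite -tl3 E tr3.
  by rewrite -tl4 E tr4.
apply: negligible_tri_pure => x w w'; rewrite homBE homNE opprK.
- by rewrite tl1 tr1 s1 addNr.
- by rewrite tl2 tr2 s2 subrr.
- by rewrite tl3 tr3 s3 addNr.
by rewrite tl4 tr4 s4 addNr.
Qed.

Local Notation evV := (evR V).
Variable h : homC3 (Fobj X) (endR V).
Hypothesis hmu : represents f h mu.

Lemma represents_skew_l :
  homM b (tensM (homM evV (tensM h f)) f) =v skew_l.
Proof.
apply: (@ver_trans _ _ _ (homM b (tensM (homM f (FJ mu)) f))).
  exact/ver_compl/ver_tensl.
rewrite -[in X in tensM _ X](homM1 f) tensMM homMA.
exact/ver_compr/ver_sym.
Qed.

Lemma represents_skew_r :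
  homM b (homM (tensM f (homM evV (tensM h f))) (twist (Fobj X) (Fobj W)))
  =v skew_r.
Proof.
rewrite /skew_r (homMA b) (homMA bc); apply: ver_compr.
apply: (@ver_trans _ _ _ (homM b (tensM f (homM f (FJ mu))))).
  exact/ver_compl/ver_tensr.
rewrite -[in X in tensM X _](homM1 f) tensMM homMA.
exact/ver_compr/ver_sym.
Qed.

Lemma skew_of_so (k : homC3 (Fobj X) (soR b)) :
  h = homM (so_incl b) k -> super_skew.
Proof.
move=> hk; apply/skewP; apply: ver_trans (ver_sym represents_skew_l) _.
refine (ver_trans _ (ver_homN represents_skew_r)).
suff -> : homM b (tensM (homM evV (tensM h f)) f) =
    homN (homM b (homM (tensM f (homM evV (tensM h f)))
                       (twist (Fobj X) (Fobj W)))).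
  exact: ver_refl.
apply: tens3_homP => x w w'.
rewrite homNE homME tensME homME tensME evRE homME homME twistE tensME.
rewrite homME tensME evRE hk homME so_inclE.
have /so_memP/(_ (f w) (f w')) := subvsP (k x).
by move/eqP; rewrite addr_eq0 => /eqP.
Qed.

Lemma ver_pre_f (Z U : repC3 F) (q q' : homC3 (tensR (tensR Z V) V) U) :
  (homM q (tensM (tensM (hom1 Z) f) f) =v homM q' (tensM (tensM (hom1 Z) f) f))
  -> (q =v q').
Proof.
pose G := tensM (tensM (hom1 Z) g) g.
have K (r : homC3 (tensR (tensR Z V) V) U) :
    r =v homM (homM r (tensM (tensM (hom1 Z) f) f)) G.
  rewrite -homMA -!tensMM homM1 -[X in X =v _]homM1 -!tensM1.
  by apply/ver_compl/ver_tens; [apply/ver_tensr/ver_sym|apply: ver_sym].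
move=> /(ver_compr G) qq'.
exact: ver_trans (K q) (ver_trans qq' (ver_sym (K q'))).
Qed.

(** Skewness is known only in Ver_3, so h itself may fail to land in so(V, b). Uncurrying and
    pairing by b turn the two sides into functionals on F(X) (x) V (x) V, whose pullbacks along f
    are, in Ver_3, [skew_r] and minus [skew_l]. *)
Lemma adj_of_skew : super_skew -> homM (adjR b_nondeg) h =v homN h.
Proof.
move=> /skewP S; apply/ver_end/(ver_form b_nondeg)/ver_pre_f.
set lhs := homM _ _; set rhs := homM _ _.
have -> : lhs = homM b (homM (tensM f (homM evV (tensM h f)))
                       (twist (Fobj X) (Fobj W))).
  apply: tens3_homP => x w w'.
  rewrite /lhs [LHS]homME !tensME homME tensME homME tensME evRE homME !hom1E.
  rewrite [RHS]homME homME twistE tensME homME tensME evRE.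
  exact: (form_adjE b_nondeg (h x)).
have -> : rhs = homN (homM b (tensM (homM evV (tensM h f)) f)).
  apply: tens3_homP => x w w'.
  rewrite /rhs [LHS]homME !tensME homME tensME homME tensME evRE homNE !hom1E.
  rewrite homNE [in RHS]homME tensME homME tensME evRE.
  by rewrite opp_lfunE tensorNl lfunN.
apply: ver_trans represents_skew_r _.
rewrite -[X in X =v _]homNK; apply: ver_homN.
exact: ver_trans (ver_sym S) (ver_sym represents_skew_l).
Qed.

End Skew.
End Form.
End SuperForm.

(** * Superalgebras of endomorphisms *)

Section SubAlgebras.
Variable F : fieldType.
Hypothesis char3 : 3%N \in [pchar F].
Implicit Types (X Y Z : svect F) (U : vectType F).

Local Notation Fobj := (Fobj char3).
Local Notation Fmor := (Fmor char3).
Local Notation Ji := (Ji char3).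

Section Action.
Variable W : svect F.
Local Notation T := (total W).

Section Endos.
Variables (X : svect F) (mu : shom (stens X W) W).

Definition aev (x : ev X) : 'End(T) :=
  linfun (fun w : T => (mee mu x w.1, meo mu x w.2) : T).

Definition aod (x : od X) : 'End(T) :=
  linfun (fun w : T => (moo mu x w.2, moe mu x w.1) : T).

Lemma aevE x (w : T) : aev x w = (mee mu x w.1, meo mu x w.2).
Proof.
rewrite linfunE // => a u v.
by rewrite /= (mee_bilin mu).2 (meo_bilin mu).2.
Qed.

Lemma aodE x (w : T) : aod x w = (moo mu x w.2, moe mu x w.1).
Proof.
rewrite linfunE // => a u v.
by rewrite /= (moo_bilin mu).2 (moe_bilin mu).2.
Qed.

Lemma aev_linear : linear aev.
Proof.
move=> a x y; apply/lfunP => w; rewrite add_lfunE scale_lfunE !aevE.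
by rewrite (mee_bilin mu).1 (meo_bilin mu).1.
Qed.

Lemma aod_linear : linear aod.
Proof.
move=> a x y; apply/lfunP => w; rewrite add_lfunE scale_lfunE !aodE.
by rewrite (moo_bilin mu).1 (moe_bilin mu).1.
Qed.

Lemma aev0 : aev 0 = 0.
Proof. by rewrite -(linfunE aev_linear) lfun0. Qed.

Lemma aod0 : aod 0 = 0.
Proof. by rewrite -(linfunE aod_linear) lfun0. Qed.

Lemma aev_send x : aev x \in send W false.
Proof.
apply/send_memP => -[] w; rewrite /homog /= aevE /= => ->.
  exact: bilin0r (mee_bilin mu).
exact: bilin0r (meo_bilin mu).
Qed.

Lemma aod_send x : aod x \in send W true.
Proof.
apply/send_memP => -[] w; rewrite /homog /= aodE /= => ->.
  exact: bilin0r (moe_bilin mu).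
exact: bilin0r (moo_bilin mu).
Qed.

End Endos.

Definition sub_svect (U : bool -> {vspace 'End(T)}) : svect F :=
  SVect (subvs_of (U false)) (subvs_of (U true)).

Section Restriction.
Variable U : bool -> {vspace 'End(T)}.
Hypothesis U_send : forall p d, d \in U p -> d \in send W p.

(** The tautological action of [U] on [W]. Only the blocks compatible with the parity are read off;
    the others vanish by [U_send], so nothing is lost. *)
Definition sub_act : shom (stens (sub_svect U) W) W :=
  @SHom _ (stens (sub_svect U) W) W
    (linfun (fun z : dsum _ _ =>
       tlift (fun (d : subvs_of (U false)) w => (vsval d (w, 0)).1) z.1
       + tlift (fun (d : subvs_of (U true)) w => (vsval d (0, w)).1) z.2))
    (linfun (fun z : dsum _ _ =>
       tlift (fun (d : subvs_of (U false)) w => (vsval d (0, w)).2) z.1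
       + tlift (fun (d : subvs_of (U true)) w => (vsval d (w, 0)).2) z.2)).

Lemma linear_sum2 (A B C : vectType F) (r : 'Hom(A, C)) (s : 'Hom(B, C)) :
  linear (fun z : dsum A B => r z.1 + s z.2).
Proof.
by move=> a [u1 u2] [v1 v2]; rewrite !linearP /= scalerDr addrACA.
Qed.

Lemma vsval_bilin q (A : vectType F) (r : A -> T) : linear r ->
  bilin (fun (d : subvs_of (U q)) w => (vsval d (r w)).1) /\
  bilin (fun (d : subvs_of (U q)) w => (vsval d (r w)).2).
Proof.
move=> rl; split; split=> [w a d d'|d a w w'];
  by rewrite ?linearP ?add_lfunE ?scale_lfunE // rl linearP.
Qed.

Lemma total_decomp (w : T) : w = (w.1, 0) + (0, w.2).
Proof. by case: w => w1 w2; congr (_, _); rewrite /= ?addr0 ?add0r. Qed.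

Lemma sub_act_ev (d : ev (sub_svect U)) : aev sub_act d = vsval d.
Proof.
have /send_memP dU := U_send (subvsP d).
have [Bl _] := vsval_bilin false (@pair0_linearl _ (ev W) (od W)).
have [_ Br] := vsval_bilin false (@pair0_linearr _ (ev W) (od W)).
apply/lfunP => w; rewrite aevE /mee /meo /= !(linfunE (linear_sum2 _ _)).
rewrite /= !lfun0 !addr0 (tliftE _ _ Bl) (tliftE _ _ Br).
rewrite [in RHS](total_decomp w) lfunD.
have /= d1 : homog false (vsval d (w.1, 0)) by apply: (dU false).
have /= d2 : homog true (vsval d (0, w.2)) by apply: (dU true).
rewrite [in RHS](surjective_pairing (vsval d (w.1, 0))) d1.
rewrite [in RHS](surjective_pairing (vsval d (0, w.2))) d2.
by congr (_, _); rewrite /= ?addr0 ?add0r.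
Qed.

Lemma sub_act_od (d : od (sub_svect U)) : aod sub_act d = vsval d.
Proof.
have /send_memP dU := U_send (subvsP d).
have [_ Bl] := vsval_bilin true (@pair0_linearl _ (ev W) (od W)).
have [Br _] := vsval_bilin true (@pair0_linearr _ (ev W) (od W)).
apply/lfunP => w; rewrite aodE /moo /moe /= !(linfunE (linear_sum2 _ _)).
rewrite /= !lfun0 !add0r (tliftE _ _ Bl) (tliftE _ _ Br).
rewrite [in RHS](total_decomp w) lfunD.
have /= d1 : homog true (vsval d (w.1, 0)) by apply: (dU false).
have /= d2 : homog false (vsval d (0, w.2)) by apply: (dU true).
rewrite [in RHS](surjective_pairing (vsval d (w.1, 0))) d1.
rewrite [in RHS](surjective_pairing (vsval d (0, w.2))) d2.
by congr (_, _); rewrite /= ?addr0 ?add0r.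
Qed.

End Restriction.

Definition acts_by_op (L : salg F) (mu : shom (stens L W) W)
    (op : bool -> bool -> 'End(T) -> 'End(T) -> 'End(T)) :=
  [/\ forall x y,
        aev mu (mee (smul L) x y) = op false false (aev mu x) (aev mu y),
      forall x y,
        aev mu (moo (smul L) x y) = op true true (aod mu x) (aod mu y),
      forall x y,
        aod mu (meo (smul L) x y) = op false true (aev mu x) (aod mu y) &
      forall x y,
        aod mu (moe (smul L) x y) = op true false (aod mu x) (aev mu y)].

Section Isomorphism.
Variable U : bool -> {vspace 'End(T)}.
Variable op : bool -> bool -> 'End(T) -> 'End(T) -> 'End(T).
Hypothesis op_bilin : forall p q, bilin (op p q).
Hypothesis op_closed :
  forall p q d e, d \in U p -> e \in U q -> op p q d e \in U (p (+) q).
Variables (L : salg F) (mu : shom (stens L W) W).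
Hypothesis mu_op : acts_by_op mu op.
Hypothesis mu_ev : forall x, aev mu x \in U false.
Hypothesis mu_od : forall x, aod mu x \in U true.
Hypothesis mu_ev_inj : forall x, aev mu x = 0 -> x = 0.
Hypothesis mu_od_inj : forall x, aod mu x = 0 -> x = 0.
Variable chi : shom (sub_salg U op) L.
Hypothesis chi_ev : forall d, aev mu (hev chi d) = vsval d.
Hypothesis chi_od : forall d, aod mu (hod chi d) = vsval d.

(** The action corestricts to a map [psi] from L to U, whose multiplicativity is [mu_op]. The lift
    [chi] is a section of [psi], and injectivity of the action makes it the two-sided inverse, so
    that it inherits multiplicativity. *)
Lemma sub_salg_iso : salg_iso (sub_salg U op) L.
Proof.
pose psi : shom L (sub_salg U op) := @SHom _ L (sub_salg U op)
  (linfun (fun x => vsproj (U false) (aev mu x)))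
  (linfun (fun x => vsproj (U true) (aod mu x))).
have psi_ev x : vsval (hev psi x) = aev mu x.
  rewrite linfunE ?vsprojK // => a u v; rewrite aev_linear linearP.
  by [].
have psi_od x : vsval (hod psi x) = aod mu x.
  rewrite linfunE ?vsprojK // => a u v; rewrite aod_linear linearP.
  by [].
have chiK : cancel (sapp chi) (sapp psi).
  move=> d; rewrite /sapp !pmapE [RHS]surjective_pairing.
  by congr (_, _); apply: val_inj; rewrite /= ?psi_ev ?psi_od.
have psiK : cancel (sapp psi) (sapp chi).
  move=> x; rewrite /sapp !pmapE [RHS]surjective_pairing /=.
  congr (_, _); apply/eqP; rewrite -subr_eq0; apply/eqP.
    apply: mu_ev_inj; rewrite -(linfunE (aev_linear mu)) lfunB.
    by rewrite !(linfunE (aev_linear mu)) chi_ev psi_ev subrr.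
  apply: mu_od_inj; rewrite -(linfunE (aod_linear mu)) lfunB.
  by rewrite !(linfunE (aod_linear mu)) chi_od psi_od subrr.
have psiM x y : sapp psi (sprod x y) = sprod (sapp psi x) (sapp psi y).
  have [mul_ee mul_oo mul_eo mul_oe] := mu_op.
  have [P1 P2] := sub_salgE op_bilin op_closed (sapp psi x) (sapp psi y).
  rewrite [RHS]surjective_pairing {1}/sapp {1}/sprod sapp_stensor pmapE.
  congr (_, _); apply: val_inj; rewrite /= ?psi_ev ?psi_od.
    rewrite P1 /sapp !pmapE /= !psi_ev !psi_od -mul_ee -mul_oo.
    by rewrite -!(linfunE (aev_linear mu)) lfunD.
  rewrite P2 /sapp !pmapE /= !psi_ev !psi_od -mul_eo -mul_oe.
  by rewrite -!(linfunE (aod_linear mu)) lfunD.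
exists chi; split; first by exists (sapp psi).
by move=> x y; apply: (can_inj psiK); rewrite psiM !chiK.
Qed.

End Isomorphism.

Section Transport.
Variables (V : repC3 F) (f : homC3 (Fobj W) V) (g : homC3 V (Fobj W)).
Hypothesis gf1 : homM g f =v hom1 _.
Hypothesis fg1 : homM f g =v hom1 _.

Lemma represents_act_comp X Y (h : homC3 (Fobj X) (endR V)) mu (chi : shom Y X)
    nu :
  represents f h mu -> represents f (homM h (Fmor chi)) nu ->
  (forall y, aev nu y = aev mu (hev chi y)) /\
  (forall y, aod nu y = aod mu (hod chi y)).
Proof.
move=> hm hn; have [ee oo eo oe] := represents_comp gf1 hm hn.
by split=> y; apply/lfunP => w; rewrite ?aevE ?aodE ?ee ?oo ?eo ?oe.
Qed.

Lemma represents_act_homB X (h h' : homC3 (Fobj X) (endR V)) mu mu' nu :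
  represents f h mu -> represents f h' mu' -> represents f (homB h h') nu ->
  (forall x, aev nu x = aev mu x - aev mu' x) /\
  (forall x, aod nu x = aod mu x - aod mu' x).
Proof.
move=> hm hm' hn; have [E O] := represents_homB gf1 hm hm' hn.
by split=> x; apply/lfunP => w; rewrite add_lfunE opp_lfunE ?aevE ?aodE;
  rewrite /mee /moo /meo /moe !E !O.
Qed.

Lemma represents_act_mul X Y (h : homC3 (Fobj X) (endR V)) mu
    (h' : homC3 (Fobj Y) (endR V)) mu' nu :
  represents f h mu -> represents f h' mu' ->
  represents f (homM (homM (amul (endA V)) (tensM h h')) (Ji X Y)) nu ->
  [/\ forall x y, aev nu (tee x y) = (aev mu x \o aev mu' y)%VF,
      forall x y, aev nu (too x y) = (aod mu x \o aod mu' y)%VF,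
      forall x y, aod nu (teo x y) = (aev mu x \o aod mu' y)%VF &
      forall x y, aod nu (toe x y) = (aod mu x \o aev mu' y)%VF].
Proof.
move=> hm hm' hn.
have [[e1 e2 e3 e4] [o1 o2 o3 o4]] := represents_mul gf1 hm hm' hn.
split=> x y; apply/lfunP => w; rewrite comp_lfunE !(aevE, aodE) /=.
- by rewrite e1 o1.
- by rewrite e2 o2.
- by rewrite e3 o3.
by rewrite e4 o4.
Qed.

(** * Retracts of End(V) in Ver_3 that act on W *)

Section Subalgebra.
Variables (S : repC3 F) (i : homC3 S (endR V)) (p : homC3 (endR V) S).
Hypothesis pi1 : homM p i =v hom1 S.
Variables (L : salg F) (k : homC3 (Fobj L) S).
Hypothesis k_iso : ver_isom k.
Variable mu : shom (stens L W) W.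
Hypothesis hmu : represents f (homM i k) mu.

(** As a morphism P from the (1|1)-dimensional superspace, the pair (x, y) acts by zero, so i k P is
    negligible; the retraction p and the inverse of k then show that P is. *)
Lemma act_faithful x y : aev mu x = 0 -> aod mu y = 0 -> x = 0 /\ y = 0.
Proof.
move=> x0 y0; have [k' [k'k _]] := k_iso.
apply: (@point_negligible _ char3); set P := Fmor _.
have kP : P =v homM k' (homM p (homM (homM i k) P)).
  have -> : homM p (homM (homM i k) P) = homM (homM (homM p i) k) P.
    by rewrite (homMA p) (homMA p i k).
  apply: ver_sym; rewrite (homMA k') -[X in _ =v X]hom1M; apply: ver_compr.
  apply: ver_trans (ver_compl k' (ver_compr k pi1)) _.
  by rewrite hom1M.
apply: negligible_ver (ver_sym kP) _; do 2!apply: negligibleMl.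
have x0w w : mee mu x w.1 = 0 /\ meo mu x w.2 = 0.
  by have := aevE mu x w; rewrite x0 zero_lfunE => -[-> ->].
have y0w w : moo mu y w.2 = 0 /\ moe mu y w.1 = 0.
  by have := aodE mu y w; rewrite y0 zero_lfunE => -[-> ->].
apply: (represents_eq0 fg1 hmu) => a w; rewrite ?hev_point ?hod_point.
- by rewrite meeZl (x0w (w, 0)).1 scaler0.
- by rewrite mooZl (y0w (0, w)).1 scaler0.
- by rewrite meoZl (x0w (0, w)).2 scaler0.
by rewrite moeZl (y0w (w, 0)).2 scaler0.
Qed.

Variable U : bool -> {vspace 'End(T)}.
Variable op : bool -> bool -> 'End(T) -> 'End(T) -> 'End(T).
Hypothesis U_send : forall p d, d \in U p -> d \in send W p.
Hypothesis op_bilin : forall p q, bilin (op p q).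
Hypothesis op_closed :
  forall p q d e, d \in U p -> e \in U q -> op p q d e \in U (p (+) q).
Hypothesis mu_op : acts_by_op mu op.
Hypothesis mu_ev : forall x, aev mu x \in U false.
Hypothesis mu_od : forall x, aod mu x \in U true.
Variable h0 : homC3 (Fobj (sub_svect U)) (endR V).
Hypothesis h0_act : represents f h0 (sub_act U).
Hypothesis iph0 : homM i (homM p h0) =v h0.

(** The isomorphism comes from the tautological action of [U]: its lift [h0] factors through S by
    [iph0], and following p [h0] by the inverse of k gives a morphism into F(L), hence a map [chi]
    by fullness. *)
Lemma ss_sub_salg_iso : salg_iso (sub_salg U op) L.
Proof.
have [k' [k'k kk']] := k_iso.
pose t := homM k' (homM p h0).
pose chi : shom (sub_salg U op) L := SHom (ev_part t) (od_part t).
have tF : t =v Fmor chi := F_full t.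
have hchi : represents f (homM (homM i k) (Fmor chi)) (sub_act U).
  apply: represents_ver h0_act; apply: ver_sym.
  apply: ver_trans (ver_compl _ (ver_sym tF)) (ver_trans _ iph0).
  rewrite -homMA; apply: ver_compl.
  by rewrite /t homMA -[X in _ =v X]hom1M; apply: ver_compr.
have [ce co] := represents_act_comp hmu hchi.
apply: (@sub_salg_iso U op op_bilin op_closed L mu mu_op mu_ev mu_od _ _ chi).
- by move=> x x0; have [] := act_faithful x0 (aod0 mu).
- by move=> x x0; have [] := act_faithful (aev0 mu) x0.
- by move=> d; rewrite -ce sub_act_ev.
by move=> d; rewrite -co sub_act_od.
Qed.

End Subalgebra.
End Transport.
End Action.
End SubAlgebras.

(** * Composition and supercommutator as products *)

Section Products.
Variable F : fieldType.
Hypothesis char3 : 3%N \in [pchar F].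

Local Notation Fobj := (Fobj char3).
Local Notation Fmor := (Fmor char3).
Local Notation J := (J char3).
Local Notation Ji := (Ji char3).
Local Notation Fe := (Fe char3).

Definition super_swap (X : svect F) : shom (stens X X) (stens X X) :=
  @SHom _ (stens X X) (stens X X)
    (linfun (fun z : dsum _ _ =>
       (swap_lfun _ _ z.1, - swap_lfun _ _ z.2) : dsum _ _))
    (linfun (fun z : dsum _ _ =>
       (swap_lfun _ _ z.2, swap_lfun _ _ z.1) : dsum _ _)).

Lemma super_swap_evE (X : svect F) z :
  hev (super_swap X) z = (swap_lfun _ _ z.1, - swap_lfun _ _ z.2).
Proof.
rewrite linfunE // => a u v.
by congr (_, _); rewrite /= linearP // scalerN opprD.
Qed.

Lemma super_swap_odE (X : svect F) z :
  hod (super_swap X) z = (swap_lfun _ _ z.2, swap_lfun _ _ z.1).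
Proof. by rewrite linfunE // => a u v; congr (_, _); rewrite /= linearP. Qed.

Lemma super_swap_tee X (x y : ev X) :
  hev (super_swap X) (tee x y) = tee y x.
Proof. by rewrite super_swap_evE /= swap_lfunE lfun0 oppr0. Qed.

Lemma super_swap_too X (x y : od X) :
  hev (super_swap X) (too x y) = - too y x.
Proof.
by rewrite super_swap_evE /= swap_lfunE lfun0; congr (_, _); rewrite /= oppr0.
Qed.

Lemma super_swap_teo X (x : ev X) (y : od X) :
  hod (super_swap X) (teo x y) = toe y x.
Proof. by rewrite super_swap_odE /= swap_lfunE lfun0. Qed.

Lemma super_swap_toe X (x : od X) (y : ev X) :
  hod (super_swap X) (toe x y) = teo y x.
Proof. by rewrite super_swap_odE /= swap_lfunE lfun0. Qed.

(** F is braided: the sign in [super_swap] matches the antisymmetry of v_1 (x) v_0 - v_0 (x) v_1. *)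
Lemma swap_Ji X :
  homM (swapR _ _) (Ji X X) = homM (Ji X X) (Fmor (super_swap X)).
Proof.
have FeN Y (y : ev Y) : Fe (- y) = - Fe y by rewrite -!scaleN1r FeZ.
apply: homC3P => z; congr (fun_of_lfun _ z).
apply: F_stens_ext => [x y|x y|x y v|x y v]; rewrite [LHS]homME [RHS]homME.
- by rewrite Fmor_Fe super_swap_tee !Ji_ee swapRE.
- rewrite Fmor_Fe super_swap_too FeN lfunN !Ji_oo lfunB !swapRE.
  by rewrite opprB.
- by rewrite Fmor_Fo super_swap_teo Ji_eo Ji_oe swapRE.
by rewrite Fmor_Fo super_swap_toe Ji_eo Ji_oe swapRE.
Qed.

Variables (V : repC3 F) (W : svect F).
Variables (f : homC3 (Fobj W) V) (g : homC3 V (Fobj W)).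
Hypothesis gf1 : homM g f =v hom1 _.
Hypothesis fg1 : homM f g =v hom1 _.

Lemma mul_Ji (A : algC3 F) (B : salg F) (k : homC3 (Fobj B) A) :
  (homM k (homM (Fmor (smul B)) (J B B)) =v homM (amul A) (tensM k k)) ->
  homM k (Fmor (smul B)) =v homM (homM (amul A) (tensM k k)) (Ji B B).
Proof.
move=> /(ver_compr (Ji B B)).
by rewrite -(homMA k) -(homMA (Fmor _)) JJi homM1.
Qed.

(** The product of B followed by k and the product of k with itself have the same class on F(B (x)
    B), hence the same action on W. *)
Lemma acts_by_comp (B : salg F) (k : homC3 (Fobj B) (endR V)) mu :
  represents f k mu ->
  (homM k (homM (Fmor (smul B)) (J B B)) =v
   homM (amul (endA V)) (tensM k k)) ->
  acts_by_op mu (fun _ _ d e => (d \o e)%VF).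
Proof.
move=> km /(@mul_Ji (endA V)) kM.
pose kk : homC3 (Fobj (stens B B)) (endR V) :=
  homM (homM (amul (endA V)) (tensM k k)) (Ji B B).
have [nu hnu] := represents_exists fg1 kk.
have [ce co] := represents_act_comp gf1 km (represents_ver (ver_sym kM) hnu).
have [m1 m2 m3 m4] := represents_act_mul gf1 km km hnu.
by split=> x y; rewrite /mee /moo /meo /moe -?ce -?co ?m1 ?m2 ?m3 ?m4.
Qed.

Section Orthosymplectic.
Variable b : homC3 (tensR V V) (unitR F).

(** The bracket of so(V, b) is N - N swap, with N the composition product. Along [Ji] the swap
    becomes [super_swap], whose sign on two odd factors turns the commutator into the
    supercommutator. *)
Lemma acts_by_scomm (L : salg F) (k : homC3 (Fobj L) (soR b)) mu :
  represents f (homM (so_incl b) k) mu ->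
  (homM k (homM (Fmor (smul L)) (J L L)) =v homM (amul (soA b)) (tensM k k)) ->
  acts_by_op mu (fun p q => @scomm F (total W) (p && q)).
Proof.
move=> km /(@mul_Ji (soA b)) kM.
pose h := homM (so_incl b) k.
pose N := homM (amul (endA V)) (tensM h h).
have hM : homM h (Fmor (smul L)) =v
    homB (homM N (Ji L L)) (homM (homM N (Ji L L)) (Fmor (super_swap L))).
  rewrite {1}/h -(homMA (so_incl b) k).
  apply: ver_trans (ver_compl _ kM) _.
  rewrite -(homMA N (Ji L L)) -swap_Ji (homMA N (swapR _ _)).
  rewrite (homMA (so_incl b) _ (Ji L L)).
  have -> : homM (so_incl b) (homM (amul (soA b)) (tensM k k)) =
      homB N (homM N (swapR _ _)).
    apply: tens_homP => x y; rewrite homBE (homME N) swapRE.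
    rewrite /N !(homME (amul (endA V))) !tensME ![amul (endA V) _]end_mulE.
    rewrite (homME (so_incl b)) (homME (amul (soA b))) tensME so_inclE.
    rewrite [vsval _]so_mulE /h !(homME (so_incl b)) !so_inclE /scomm expr0.
    by rewrite scale1r.
  have -> : homM (homB N (homM N (swapR _ _))) (Ji L L) =
      homB (homM N (Ji L L)) (homM (homM N (swapR _ _)) (Ji L L)).
    apply: homC3P => z.
    by rewrite (homME (homB _ _)) !homBE !(homME _ (Ji L L)).
  exact: ver_refl.
have [nu hnu] := represents_exists fg1 (homM N (Ji L L)).
have [nu' hnu'] := represents_exists fg1
  (homM (homM N (Ji L L)) (Fmor (super_swap L))).
have [rho hrho] := represents_exists fg1 (homM h (Fmor (smul L))).
have [ce co] := represents_act_comp gf1 km hrho.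
have [se so] := represents_act_comp gf1 hnu hnu'.
have [be bo] := represents_act_homB gf1 hnu hnu' (represents_ver hM hrho).
have [m1 m2 m3 m4] := represents_act_mul gf1 km km hnu.
have nuN z : aev nu (- z) = - aev nu z.
  by rewrite -!(linfunE (aev_linear nu)) lfunN.
split=> x y; rewrite /mee /moo /meo /moe -?ce -?co ?be ?bo ?se ?so.
- by rewrite super_swap_tee !m1 /scomm expr0 scale1r.
- by rewrite super_swap_too nuN !m2 /scomm expr1 scaleN1r.
- by rewrite super_swap_teo m3 m4 /scomm expr0 scale1r.
by rewrite super_swap_toe m3 m4 /scomm expr0 scale1r.
Qed.

Variable c : shom (stens W W) (sunit F).

Lemma skew_osp X (mu : shom (stens X W) W) : super_skew c mu ->
  (forall x, aev mu x \in osp c false) /\ (forall x, aod mu x \in osp c true).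
Proof.
move=> [s1 s2 s3 s4]; split=> x; apply/osp_memP; split.
- exact: aev_send.
- move=> q r w w' _ _; rewrite expr0 mul1r !sformE !aevE /=.
  by rewrite s1 s3 addrACA !addNr addr0.
- exact: aod_send.
move=> q r w w' hw _; rewrite !sformE !aodE /= s2 s4.
have e0 := bilin0l _ (mee_bilin c); have o0 := bilin0l _ (moo_bilin c).
case: q hw => /= ->; rewrite ?e0 ?o0 ?expr1 ?mulN1r ?mul1r.
  by rewrite oppr0 addr0 add0r subrr.
by rewrite add0r addr0 addNr.
Qed.

Lemma osp_send p d : d \in osp c p -> d \in send W p.
Proof. by case/osp_memP. Qed.

Lemma osp_skew : super_skew c (sub_act (osp c)).
Proof.
have e0l := bilin0l _ (mee_bilin c); have e0r := bilin0r _ (mee_bilin c).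
have o0l := bilin0l _ (moo_bilin c); have o0r := bilin0r _ (moo_bilin c).
have skE p (d : subvs_of (osp c p)) q r w w' : homog q w -> homog r w' ->
    sform c (vsval d w) w' = - ((-1) ^+ (p && q) * sform c w (vsval d w')).
  move=> hw hw'; apply/eqP; rewrite -addr_eq0; apply/eqP.
  by have /osp_memP[_ /(_ q r)] := subvsP d; apply.
split=> x w w'.
- have := skE _ x false false (w, 0) (w', 0) erefl erefl.
  rewrite -(sub_act_ev osp_send) !sformE !aevE /= !(e0l, e0r, o0l, o0r).
  by rewrite !addr0 mul1r.
- have := skE _ x true false (0, w) (w', 0) erefl erefl.
  rewrite -(sub_act_od osp_send) !sformE !aodE /= !(e0l, e0r, o0l, o0r).
  by rewrite addr0 add0r expr1 mulN1r opprK.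
- have := skE _ x true true (0, w) (0, w') erefl erefl.
  rewrite -(sub_act_ev osp_send) !sformE !aevE /= !(e0l, e0r, o0l, o0r).
  by rewrite !add0r mul1r.
have := skE _ x false true (w, 0) (0, w') erefl erefl.
rewrite -(sub_act_od osp_send) !sformE !aodE /= !(e0l, e0r, o0l, o0r).
by rewrite addr0 add0r mul1r.
Qed.

End Orthosymplectic.
End Products.

Theorem proposition4p1 (F : fieldType) (char3 : 3%N \in [pchar F])
    (V : repC3 F) :
  (forall W : svect F, ss_obj char3 V W ->
   forall B : salg F, ss_alg char3 (endA V) B ->
     salg_iso (sendA W) B) /\
  (forall b : homC3 (tensR V V) (unitR F),
     form_sym b -> form_nondeg b ->
   forall (W : svect F) (c : shom (stens W W) (sunit F)),
     ss_form char3 b c ->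
     [/\ supersymmetric c,
         sform_nondeg c &
         forall L : salg F, ss_alg char3 (soA b) L -> salg_iso (ospA c) L]).
Proof.
split=> [W [f [g [gf1 fg1]]] B [k [k_iso kM]]|
  b b_sym b_nondeg W c [f [[g [gf1 fg1]] cb]]].
  have [mu hmu] := represents_exists fg1 k.
  have [h0 hh0] := represents_lift gf1 (sub_act (send W)).
  (* End(V) is the trivial retract of itself, with i = p = id. *)
  apply: (@ss_sub_salg_iso _ char3 W V f g gf1 fg1 (endR V) (hom1 _) (hom1 _)
            _ B k k_iso mu _ (send W) _ _ _ _ _ _ _ h0 hh0).
  - by rewrite hom1M; apply: ver_refl.
  - by rewrite hom1M.
  - by [].
  - move=> p q; split=> [z a u v|z a u v].
      by rewrite comp_lfunDl comp_lfunZl.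
    by rewrite comp_lfunDr comp_lfunZr.
  - exact: send_comp.
  - exact: (acts_by_comp gf1 fg1 hmu kM).
  - exact: aev_send.
  - exact: aod_send.
  by rewrite !hom1M; apply: ver_refl.
split; first exact: (c_supersymmetric b_sym cb).
  exact: (c_nondeg b_nondeg gf1 fg1 cb).
move=> L [k [k_iso kM]].
have [mu hmu] := represents_exists fg1 (homM (so_incl b) k).
have [h0 hh0] := represents_lift gf1 (sub_act (osp c)).
have [mu_ev mu_od] := skew_osp (skew_of_so cb hmu erefl).
apply: (@ss_sub_salg_iso _ char3 W V f g gf1 fg1 (soR b) (so_incl b)
          (so_proj b_nondeg b_sym) _ L k k_iso mu hmu (osp c)
          _ _ _ _ _ _ _ h0 hh0).
- by rewrite (so_proj_incl _ _ char3); apply: ver_refl.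
- exact: osp_send.
- by move=> p q; apply: scomm_bilin.
- exact: osp_comm.
- exact: (acts_by_scomm gf1 fg1 hmu kM).
- exact: mu_ev.
- exact: mu_od.
(* Here [h0] need not land in so(V, b). As adj [h0] = - [h0] in Ver_3, the projection adj - 1 sends
   it to -2 [h0] = [h0], which is the required factorization. *)
have adj := adj_of_skew b_nondeg fg1 cb hh0 (osp_skew c).
apply: ver_trans (_ : _ =v homB (homN h0) h0) _.
  rewrite (_ : homM _ _ = homB (homM (adjR b_nondeg) h0) h0).
    exact: ver_subr adj (ver_refl h0).
  by apply: homC3P => z; rewrite !homME so_incl_proj homBE homME.
rewrite (_ : homB _ _ = h0); first exact: ver_refl.
apply: homC3P => z; rewrite homBE homNE -opprD -mulr2n -scaler_nat.
by rewrite (two_eqN1 char3) scaleN1r opprK.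
Qed.
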